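(* Let $\pi\colon A\to M$ be a Banach vector bundle such that there exist a linear connection on $A$ and a linear connection on $TM$, and such that $M$ is regular as a topological space. Let $k\in\mathbb N\cup\{\infty\}$, $k\ge 2$, and let $\gamma\colon[0,1]^2\to M$, $(\varepsilon,t)\mapsto\gamma_\varepsilon(t)$, be a $C^k$-map with $\gamma(\varepsilon,0)=\gamma(0,0)$ and $\gamma(\varepsilon,1)=\gamma(0,1)$ for all $\varepsilon\in[0,1]$. Let $\eta>0$, $J:=[-\eta,1+\eta]$, and let $\hat\gamma\colon[0,1]\times J\to M$ be a $C^k$-extension of $\gamma$ such that $\hat\gamma(\varepsilon,t)=\gamma_\varepsilon(0)$ for $t\in[-\eta,-\tfrac{\eta}{2}]$ and $\hat\gamma(\varepsilon,t)=\gamma_\varepsilon(1)$ for $t\in[1+\tfrac{\eta}{2},1+\eta]$. (1) For every $s\in[0,1]$ there are $\delta_s>0$ and an open set $\mathcal W_s\subseteq J\times M$ which is a neighbourhood of the graph $\{(t,\hat\gamma_\varepsilon(t)) : t\in J\}$ for every $\varepsilon\in I_s:=[0,1]\cap[s-\delta_s,s+\delta_s]$, such that the following holds. For every $\ell\le k$ and every $C^\ell$-map $c\colon[0,1]^2\to A$ with $\pi\circ c=\gamma$ there is a $C^{\ell,\infty}$-map $\mathfrak u^s\colon I_s\times\mathcal W_s\to A$ (with respect to the splitting of variables $((\varepsilon,t),y)$) such that $\pi(\mathfrak u^s(\varepsilon,t,y))=y$ for all $(\varepsilon,t,y)$ in the domain and $$\mathfrak u^s(\varepsilon,t,\gamma_\varepsilon(t))=c_\varepsilon(t)\quad\text{for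 all }(\varepsilon,t)\in I_s\times[0,1].$$ Further, $\mathfrak u^s$ can be chosen such that, for each $\varepsilon$ and $y$, $\mathfrak u^s(\varepsilon,t,y)$ is constant in $t$ on $\{t\in[-\eta,-\tfrac{\eta}{2}] : (t,y)\in\mathcal W_s\}$ and on $\{t\in[1+\tfrac{\eta}{2},1+\eta] : (t,y)\in\mathcal W_s\}$, and such that if $c_\varepsilon(0)=0$ (respectively $c_\varepsilon(1)=0$) for $\varepsilon\in I_s$, then also $\mathfrak u^s(\varepsilon,0,\cdot)=0$ (respectively $\mathfrak u^s(\varepsilon,1,\cdot)=0$). (2) If $M$ is smoothly paracompact, then a $C^{\ell,\infty}$-section $\mathfrak u$ with these properties can be defined on all of $[0,1]\times J\times M$ (that is, with $I_s\times \mathcal W_s$ replaced by $[0,1]\times J\times M$).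
   Context: Manifolds are smooth and modelled on Banach spaces; no paracompactness is assumed unless stated. For a map $c\colon[0,1]^2\to N$ write $c_\varepsilon:=c(\varepsilon,\cdot)$. A linear connection on a Banach vector bundle $E\to M$ is a smooth splitting $TE=HE\oplus VE$ ($VE=\ker T\pi$) whose connector $K\colon TE\to E$ is smooth and is, in local trivializations, of the form $K(x,u,y,v)=(x,v+\mathcal C_x(u,y))$ with $x\mapsto\mathcal C_x$ a smooth map into the continuous bilinear maps. $C^{r,s}$-maps: A continuous map is (Bastiani) $C^r$ if its iterated directional derivatives up to order $r$ exist and are continuous (on non-open locally convex domains with dense interior: they exist in the interior and extend continuously). A continuous map $f\colon U\times V\to F$ is $C^{r,s}$ ($r,s\in\mathbb N_0\cup\{\infty\}$) if for each fixed $y\in V$ the map $f(\cdot,y)$ is $C^r$ and each of its iterated directional derivatives is $C^s$ in the parameter $y$. For maps between manifolds this is understood in charts. $M$ is smoothly paracompact ($C^\infty$-paracompact) if every open cover of $M$ admits a subordinate partition of unity by $C^\infty$-functions. *)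

(* Defs.v *)
From HB Require Import structures.
From mathcomp Require Import all_boot all_order all_algebra.
From mathcomp Require Import mathcomp_extra boolp classical_sets functions.
From mathcomp Require Import cardinality fsbigop set_interval.
From mathcomp Require Import reals topology normedtype derive.

Set Implicit Arguments.
Unset Strict Implicit.
Unset Printing Implicit Defensive.

Import Order.TTheory GRing.Theory Num.Theory.
Import numFieldNormedType.Exports.

Local Open Scope classical_set_scope.
Local Open Scope ring_scope.

Section product_complete.
Context {R : realType} {E F : completeNormedModType R}.

Let EF : normedModType R := (E * F)%type.

Let prod_complete (G : set_system EF) :
  ProperFilter G -> cauchy G -> cvg G.
Proof.
move=> GF Gc.
have c1 : cauchy (fst @ G).
  move=> A /= entA; rewrite near_simpl -near2E near_map2.
  apply: Gc; exists (A, setT); first by split => //; exact: filterT.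
  by move=> [[x1 x2] [y1 y2]] [/= ? _]; exists ((x1, y1), (x2, y2)).
have c2 : cauchy (snd @ G).
  move=> A /= entA; rewrite near_simpl -near2E near_map2.
  apply: Gc; exists (setT, A); first by split => //; exact: filterT.
  by move=> [[x1 x2] [y1 y2]] [/= _ ?]; exists ((x1, y1), (x2, y2)).
have h1 := @cauchy_cvg _ _ (fmap_proper_filter _ GF) c1.
have h2 := @cauchy_cvg _ _ (fmap_proper_filter _ GF) c2.
apply/(@cvg_ex EF); exists (lim (fst @ G), lim (snd @ G)).
move=> U [[A B] /= [nA nB] AB].
have GA : G (fst @^-1` A) by exact: (h1 _ nA).
have GB : G (snd @^-1` B) by exact: (h2 _ nB).
apply: (@filterS _ G _ _ _ _ (filterI GA GB)) => -[x y] [/= Ax By].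
exact: AB.
Qed.

HB.instance Definition _ := Uniform_isComplete.Build (E * F)%type prod_complete.

End product_complete.

Section continuous_linear.
Context {R : realType} (E F : normedModType R).

Definition clinear_pred : {pred E -> F} :=
  [pred f : E -> F | `[< linear f /\ continuous f >]].

Record clinear := CLinear { clfun :> E -> F ; _ : clfun \in clinear_pred }.

HB.instance Definition _ := [isSub for clfun].
HB.instance Definition _ := gen_eqMixin clinear.
HB.instance Definition _ := gen_choiceMixin clinear.

Lemma clinearP (f : clinear) : linear f /\ continuous f.
Proof. by case: f => f fP; apply/asboolP; exact: fP. Qed.

Let clinear_submod : submod_closed clinear_pred.
Proof.
split.
  apply/asboolP; split => [a x y|x]; last exact: cst_continuous.
  by rewrite /= scaler0 addr0.
move=> a f g /asboolP[fl fc] /asboolP[gl gc].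
have afgE z : (a *: f + g) z = a *: f z + g z by [].
apply/asboolP; split => [k x y|x].
  rewrite !afgE fl gl !scalerDr !scalerA [a * k]mulrC.
  by rewrite -!addrA; congr (_ + _); rewrite addrCA.
apply: (@cvgD _ _ _ _ _ (a \*: f) g); last exact: gc.
by apply: cvgZr; exact: fc.
Qed.

HB.instance Definition _ := GRing.isSubmodClosed.Build _ _ clinear_pred
  (GRing.submod_closed_semi clinear_submod).
HB.instance Definition _ := [SubChoice_isSubLmodule of clinear by <:].

Definition opnorm (f : clinear) : R := sup [set `|f x| | x in [set x | `|x| <= 1]].

Let opset (f : clinear) := [set `|f x| | x in [set x | `|x| <= 1]].

Let clin0 (f : clinear) : f 0 = 0.
Proof. by have [/(_ (-1) 0 0)] := clinearP f; rewrite scaler0 scaleN1r addr0 addNr. Qed.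

Let clinZ (f : clinear) a x : f (a *: x) = a *: f x.
Proof. by have [/(_ a x 0)] := clinearP f; rewrite clin0 !addr0. Qed.

Let opset_sup f : has_sup (opset f).
Proof.
split; first by exists 0, 0; rewrite ?clin0 /= ?normr0.
have [fl fc] := clinearP f.
have /= := fc 0; rewrite /continuous_at clin0 => /cvgr0Pnorm_le.
move=> /(_ _ ltr01) /nbhs_norm0P[e /= e0 He].
exists (2 / e) => _ [x /= x1 <-].
have e2 : 0 < e / 2 by rewrite divr_gt0.
have n2 : `|(e / 2) *: x| < e.
  rewrite normrZ gtr0_norm // (@le_lt_trans _ _ (e / 2)) //.
    by rewrite ler_piMr // ltW.
  by rewrite ltr_pdivrMr // ltr_pMr // ltr1n.
have := He _ n2; rewrite /= clinZ normrZ gtr0_norm //.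
by rewrite -ler_pdivlMl // mulr1 invf_div.
Qed.

Let opset_le (f : clinear) x : `|x| <= 1 -> `|f x| <= opnorm f.
Proof. by move=> x1; apply: sup_upper_bound; [exact: opset_sup|exists x]. Qed.

Let opnorm_le (f : clinear) M : (forall x, `|x| <= 1 -> `|f x| <= M) -> opnorm f <= M.
Proof.
move=> fM; apply: sup_le_ub; first by have [] := opset_sup f.
by move=> _ [x /= x1 <-]; exact: fM.
Qed.

Let opnormD (f g : clinear) : opnorm (f + g) <= opnorm f + opnorm g.
Proof.
apply: opnorm_le => x x1.
by rewrite (le_trans (ler_normD _ _)) // lerD // opset_le.
Qed.

Let opnormZle l (f : clinear) : opnorm (l *: f) <= `|l| * opnorm f.
Proof.
by apply: opnorm_le => x x1; rewrite normrZ ler_wpM2l // opset_le.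
Qed.

Let opnormZ l (f : clinear) : opnorm (l *: f) = `|l| * opnorm f.
Proof.
have [->|l0] := eqVneq l 0.
  rewrite normr0 mul0r scale0r; apply/eqP; rewrite eq_le; apply/andP; split.
    by apply: opnorm_le => x _; rewrite /= normr0.
  by apply: le_trans (@opset_le 0 0 _); rewrite ?normr0.
apply/eqP; rewrite eq_le opnormZle /= -ler_pdivlMl ?normr_gt0 //.
by rewrite -normfV -{1}[f](scalerK l0) opnormZle.
Qed.

Let opnorm0_eq0 (f : clinear) : opnorm f = 0 -> f = 0.
Proof.
move=> f0; apply/val_inj/funext => x /=; apply/eqP; rewrite -normr_le0.
have [->|x0] := eqVneq x 0; first by rewrite clin0 normr0.
have := @opset_le f (`|x|^-1 *: x); rewrite clinZ !normrZ normfV normr_id f0.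
rewrite mulVf ?normr_eq0 // => /(_ (lexx _)).
by rewrite pmulr_rle0 // invr_gt0 normr_gt0.
Qed.

HB.instance Definition _ :=
  Lmodule_isNormed.Build R clinear opnormD opnormZ opnorm0_eq0.

End continuous_linear.

(* Orders of differentiability are [option nat], [None] being infinity. *)

Definition le_order (j : nat) (r : option nat) : bool :=
  if r is Some n then (j <= n)%N else true.

Section bastiani.
Context {R : realType}.

(* [iter_derive f [:: v1; ...; vn]] = D_{v1} (... (D_{vn} f)). *)
Fixpoint iter_derive {X F : normedModType R} (f : X -> F) (vs : seq X) : X -> F :=
  if vs is v :: vs' then fun x => 'D_v (iter_derive f vs') x else f.

(* Meant for sets D contained in the closure of their interior: the iterated
   directional derivatives exist in the interior of D and extend to maps which
   are jointly continuous in the base point (in D) and the directions. *)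
Definition Cr_on {X F : normedModType R} (r : option nat) (D : set X)
    (f : X -> F) : Prop :=
  [/\ {within D, continuous f},
      forall (vs : seq X) v x, le_order (size vs).+1 r ->
        interior D x -> derivable (iter_derive f vs) x v
    & forall j, le_order j r -> exists g : X * {ptws 'I_j -> X} -> F,
        {within D `*` setT, continuous g} /\
        forall x (v : 'I_j -> X), interior D x ->
          g (x, v) = iter_derive f (codom v) x].

(* First differentiate in the X-directions xs, then in the Y-directions ys. *)
Definition mixed_dirs {X Y : normedModType R} (xs : seq X) (ys : seq Y) :
    seq (X * Y) :=
  [seq (0, y) | y <- ys] ++ [seq (x, 0) | x <- xs].

(* C^{r,s}, with joint continuity of the mixed derivatives; D need not be a
   product, but is locally one in the applications. *)
Definition Crs_on {X Y F : normedModType R} (r s : option nat)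
    (D : set (X * Y)) (f : X * Y -> F) : Prop :=
  [/\ {within D, continuous f},
      forall xs x p, le_order (size xs).+1 r -> interior D p ->
        derivable (iter_derive f (mixed_dirs xs [::])) p (x, 0),
      forall xs ys y p, le_order (size xs) r -> le_order (size ys).+1 s ->
        interior D p -> derivable (iter_derive f (mixed_dirs xs ys)) p (0, y)
    & forall i j, le_order i r -> le_order j s ->
        exists g : (X * Y) * ({ptws 'I_i -> X} * {ptws 'I_j -> Y}) -> F,
        {within D `*` setT, continuous g} /\
        forall p (v : 'I_i -> X) (w : 'I_j -> Y), interior D p ->
          g (p, (v, w)) = iter_derive f (mixed_dirs (codom v) (codom w)) p].

End bastiani.

(* The bare data of an atlas; the axioms are in [banach_manifold].  Each chart
   has its own model space, and [cinv i] is only meaningful on [cimg i]. *)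
Record atlas (R : realType) (X : Type) := Atlas {
  cix : Type ;
  model : cix -> completeNormedModType R ;
  cdom : cix -> set X ;
  chart : forall i, X -> model i ;
  cinv : forall i, model i -> X }.

Arguments cdom {R X} a i.
Arguments chart {R X} a i.
Arguments cinv {R X} a i.

Definition cimg {R : realType} {X} (a : atlas R X) (i : cix a) : set (model i) :=
  chart a i @` cdom a i.
Arguments cimg {R X} a i.

Definition trans {R : realType} {X} (a : atlas R X) (i j : cix a) :
  model i -> model j := chart a j \o cinv a i.
Arguments trans {R X} a i j.

Record banach_manifold {R : realType} {M : topologicalType} (a : atlas R M) :
    Prop := BanachManifold {
  _ : hausdorff_space M ;
  _ : forall i, open (cdom a i) ;
  _ : forall x, exists i, cdom a i x ;
  _ : forall i, open (cimg a i) ;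
  _ : forall i x, cdom a i x -> cinv a i (chart a i x) = x ;
  _ : forall i, {within cdom a i, continuous (chart a i)} ;
  _ : forall i, {within cimg a i, continuous (cinv a i)} ;
  _ : forall i j, Cr_on None (chart a i @` (cdom a i `&` cdom a j))
                    (trans a i j) }.

(* Smooth maps from an open subset S of a manifold to a normed space. *)
Definition smooth_fun {R : realType} {M : topologicalType} (a : atlas R M)
    {F : normedModType R} (S : set M) (h : M -> F) : Prop :=
  forall i, Cr_on None (chart a i @` (cdom a i `&` S)) (h \o cinv a i).

Definition Cr_map {R : realType} {X : normedModType R} {N : topologicalType}
    (b : atlas R N) (r : option nat) (D : set X) (f : X -> N) : Prop :=
  {within D, continuous f} /\
  forall j, Cr_on r (D `&` f @^-1` cdom b j) (chart b j \o f).

Definition Crs_map {R : realType} {X : normedModType R} {M N : topologicalType}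
    (a : atlas R M) (b : atlas R N) (r s : option nat)
    (D : set (X * M)) (f : X * M -> N) : Prop :=
  {within D, continuous f} /\
  forall i j, let fi (p : X * model i) := f (p.1, cinv a i p.2) in
    Crs_on r s
      [set p | [/\ cimg a i p.2, D (p.1, cinv a i p.2) & cdom b j (fi p)]]
      (chart b j \o fi).

Definition smoothly_paracompact {R : realType} {M : topologicalType}
    (a : atlas R M) : Prop :=
  forall (I : choiceType) (U : I -> set M),
    (forall i, open (U i)) -> \bigcup_i U i = setT ->
  exists h : I -> M -> R, let supp i := closure [set x | h i x != 0] in
    [/\ forall i, smooth_fun a setT (h i),
        forall i x, 0 <= h i x,
        forall i, supp i `<=` U i,
        forall x : M, exists2 V, nbhs x V &
          finite_set [set i | V `&` supp i !=set0]
      & forall x, \sum_(i \in [set: I]) h i x = 1].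

(* The bare data of a bundle E over M with local trivializations
   e |-> (proj e, triv j e) over [tdom j]; the axioms are in
   [banach_vector_bundle]. *)
Record vbundle (R : realType) (M E : Type) := VBundle {
  proj : E -> M ;
  tix : Type ;
  fib : tix -> completeNormedModType R ;
  tdom : tix -> set M ;
  triv : forall j, E -> fib j ;
  tinv : forall j, M -> fib j -> E }.

Arguments proj {R M E} v.
Arguments tdom {R M E} v j.
Arguments triv {R M E} v j.
Arguments tinv {R M E} v j.

Record banach_vector_bundle {R : realType} {M E : topologicalType}
    (a : atlas R M) (b : vbundle R M E) : Prop := BanachVectorBundle {
  _ : continuous (proj b) ;
  _ : forall j, open (tdom b j) ;
  _ : forall x, exists j, tdom b j x ;
  _ : forall j x f, tdom b j x ->
        proj b (tinv b j x f) = x /\ triv b j (tinv b j x f) = f ;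
  _ : forall j e, tdom b j (proj b e) -> tinv b j (proj b e) (triv b j e) = e ;
  _ : forall j, {within proj b @^-1` tdom b j, continuous (triv b j)} ;
  _ : forall j, {within tdom b j `*` setT,
        continuous (fun p : M * fib j => tinv b j p.1 p.2)} ;
  _ : forall j j', exists G : M -> clinear (fib j) (fib j'),
        smooth_fun a (tdom b j `&` tdom b j') G /\
        forall x f, tdom b j x -> tdom b j' x ->
          triv b j' (tinv b j x f) = G x f }.

Definition zero_vector {R : realType} {M E : Type} (b : vbundle R M E) (e : E) :
  Prop := exists2 j, tdom b j (proj b e) & triv b j e = 0.

(* The manifold structure of the total space: the bundle chart (i, j) has domain
   the preimage of [cdom i `&` tdom j]. *)
Definition total_atlas {R : realType} {M E : Type} (a : atlas R M)
    (b : vbundle R M E) : atlas R E :=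
  @Atlas R E (cix a * tix b)%type
    (fun q => (model q.1 * fib q.2)%type)
    (fun q => proj b @^-1` (cdom a q.1 `&` tdom b q.2))
    (fun q e => (chart a q.1 (proj b e), triv b q.2 e))
    (fun q p => tinv b q.2 (cinv a q.1 p.1) p.2).

(* A tangent vector is a base point with a family of representatives, one for
   each chart around the base point, related by the derivatives of the changes
   of charts; the components for the other charts are normalized to 0. *)
Record tangent {R : realType} {X : Type} (a : atlas R X) := Tangent {
  tbase : X ;
  tvec : forall i : cix a, model i ;
  _ : forall i j, cdom a i tbase -> cdom a j tbase ->
        tvec j = 'D_(tvec i) (trans a i j) (chart a i tbase) ;
  _ : forall i, ~ cdom a i tbase -> tvec i = 0 }.
Arguments tvec {R X a} t i.

HB.instance Definition _ (R : realType) X (a : atlas R X) :=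
  gen_eqMixin (tangent a).
HB.instance Definition _ (R : realType) X (a : atlas R X) :=
  gen_choiceMixin (tangent a).

Lemma derive_dir0 {R : realType} {V W : normedModType R} (f : V -> W) x :
  'D_0 f x = 0.
Proof.
rewrite /derive (_ : (fun h : R => _) = cst 0) ?lim_cst //.
by apply/funext => h /=; rewrite scaler0 add0r subrr scaler0.
Qed.

Definition tangent0 {R : realType} {X : Type} (a : atlas R X) (x : X) :
    tangent a :=
  @Tangent R X a x (fun=> 0) (fun i j _ _ => esym (derive_dir0 _ _))
    (fun i _ => erefl).

Definition tangent_bundle {R : realType} {X : Type} (a : atlas R X) :
    vbundle R X (tangent a) :=
  @VBundle R X (tangent a) (@tbase R X a) (cix a) (@model R X a) (cdom a)
    (fun i xi => tvec xi i)
    (fun i x v => xget (tangent0 a x) [set xi | tbase xi = x /\ tvec xi i = v]).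

(* In the bundle chart q = (i, j), a tangent vector xi of the total space has
   base point (x, u) and components [tvec xi q] = (y, v); it is vertical if and
   only if y = 0, and the vertical lift of e is (0, triv j e). *)
Section linear_connection.
Context {R : realType} {M E : Type} (a : atlas R M) (b : vbundle R M E).

Definition horizontal_at (H : set (tangent (total_atlas a b))) (e : E)
    (q : cix (total_atlas a b)) : set (model q) :=
  [set tvec xi q | xi in H `&` [set xi | tbase xi = e]].
Arguments horizontal_at H e q : clear implicits.

(* The fields say, in this order: the horizontal spaces are linear complements
   of the vertical ones; the connector covers the projection, and xi minus the
   vertical lift of [connector xi] is horizontal; the Christoffel forms are
   smooth for the operator norm, continuous bilinear maps being curried; the
   connector is smooth in charts, and K (x, u, y, v) = (x, v + C_x (u, y)). *)
Record linear_connection := LinearConnection {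
  horizontal : set (tangent (total_atlas a b)) ;
  connector : tangent (total_atlas a b) -> E ;
  christoffel : forall (i : cix a) (j : tix b),
    model i -> clinear (fib j) (clinear (model i) (fib j)) ;
  _ : forall e q, cdom (total_atlas a b) q e ->
        let H := horizontal_at horizontal e q in
        [/\ H 0,
            forall (l : R) w w', H w -> H w' -> H (l *: w + w')
          & forall w, exists! h, H h /\ (w - h).1 = 0] ;
  _ : forall xi, proj b (connector xi) = proj b (tbase xi) ;
  _ : forall xi q, cdom (total_atlas a b) q (tbase xi) ->
        horizontal_at horizontal (tbase xi) q
          (tvec xi q - (0, triv b q.2 (connector xi))) ;
  _ : forall i j,
        Cr_on None (chart a i @` (cdom a i `&` tdom b j)) (@christoffel i j) ;
  _ : forall i j, Cr_on None
        [set p | (chart a i @` (cdom a i `&` tdom b j)) p.1.1]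
        (fun p : (model i * fib j) * (model i * fib j) =>
           p.2.2 + @christoffel i j p.1.1 p.1.2 p.2.1) ;
  _ : forall (xi : tangent (total_atlas a b)) i j,
        cdom (total_atlas a b) (i, j) (tbase xi) ->
        let x := chart a i (proj b (tbase xi)) in
        let u := triv b j (tbase xi) in
        let w : model i * fib j := tvec xi (i, j) in
        triv b j (connector xi) = w.2 + @christoffel i j x u w.1 }.

End linear_connection.

Definition unit_square {R : realType} : set (R * R) :=
  `[0, 1]%classic `*` `[0, 1]%classic.

(* [u] is the C^{l,infty}-map (eps, t, y) |-> u ((eps, t), y) on
   {((eps, t), y) | eps in I, (t, y) in W}. *)
Definition adapted_section {R : realType} {M A : topologicalType}
    (a : atlas R M) (b : vbundle R M A) (gamma : R * R -> M) (eta : R)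
    (l : option nat) (I : set R) (W : set (R * M))
    (c : R * R -> A) (u : (R * R) * M -> A) : Prop :=
  [/\ Crs_map a (total_atlas a b) l None
        [set p | I p.1.1 /\ W (p.1.2, p.2)] u,
      forall (e t : R) (y : M), I e -> W (t, y) -> proj b (u ((e, t), y)) = y,
      forall e t : R, I e -> 0 <= t <= 1 -> u ((e, t), gamma (e, t)) = c (e, t),
      forall (e t t' : R) (y : M), I e -> W (t, y) -> W (t', y) ->
        (- eta <= t <= - (eta / 2) /\ - eta <= t' <= - (eta / 2)) \/
        (1 + eta / 2 <= t <= 1 + eta /\ 1 + eta / 2 <= t' <= 1 + eta) ->
        u ((e, t), y) = u ((e, t'), y)
    & forall e t : R, I e -> t = 0 \/ t = 1 -> zero_vector b (c (e, t)) ->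
        forall y, W (t, y) -> zero_vector b (u ((e, t), y))].

(* Main.v *)
From mathcomp Require Import all_boot all_order all_algebra.
From mathcomp Require Import mathcomp_extra boolp classical_sets functions.
From mathcomp Require Import fsbigop set_interval.
From mathcomp Require Import reals topology normedtype derive sequences exp realfun.
From mathcomp Require Import ring lra.
Require Import Defs.
Set Implicit Arguments.
Unset Strict Implicit.
Unset Printing Implicit Defensive.
Import Order.TTheory GRing.Theory Num.Theory.
Import numFieldNormedType.Exports.
Local Open Scope classical_set_scope.
Local Open Scope ring_scope.

(** Over a short interval of t the curve stays in a single trivialization of A,
    where a lift extends off the curve by keeping its fibre coordinate constant.
    These extensions are glued by a partition of unity on the parameter domain:
    in t alone for the first part, so that W does not depend on eps, and in
    (eps, t) for the second, where bump functions on M extend the pieces by zero.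
    The fibre coordinates are first extended from t in [0, 1] to all t: near t = 0
    by Seeley's reflection f (- t) = sum_k a_k f (b_k t), where
    sum_k a_k (- b_k)^m = 1 for every m makes all derivatives match at t = 0. *)

(** * Directional derivatives *)

(** The obstacle is one-sided regularity: [c] is of class C^l on the closed square only, with
    derivatives in the interior that extend continuously to the boundary, while the section must
    keep this class across t = 0 and t = 1 and be constant in t near the ends of J. Freezing the
    fibre coordinates beyond the end points would destroy their derivatives there. As l may be
    infinite, one extension has to serve all orders at once; hence infinitely many reflected terms.
    The extension is cut off within distance [tau <= eta / 2] of [0, 1], so the section is zero, in
    particular constant in t, where constancy is required. Every operation is linear in the fibre
    coordinates and keeps their values on [0, 1], so a zero of [c] at an end point kills the whole
    section there. All boundary analysis takes place in the two real variables. The point y enters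
    only through a smooth factor paired bilinearly with a function of (eps, t); since the two
    factors depend on different variables, mixed derivatives of such a product are again products,
    and C^{l,infty} regularity reduces to C^l in the plane and smoothness in y. *)

Section calculus.
Context {R : realType}.
Implicit Types (V W E : normedModType R).

(** At [h = 0] both sides of the estimate vanish, so the punctured neighbourhood in the definition
    of the derivative can be replaced by a full one. Most derivatives computed by hand below go
    through this form. *)
Lemma is_deriveP {V W} (f : V -> W) x v L : is_derive x v f L <->
  forall e : R, 0 < e ->
    \forall h \near (0 : R), `|f (h *: v + x) - f x - h *: L| <= e * `|h|.
Proof.
split.
  case=> df fL e e0.
  have /cvgrPdist_le /(_ _ e0) := df; rewrite -/(derive f x v) fL.
  rewrite /dnbhs near_withinE; apply: filterS => h /= hP.
  have [->|h0] := eqVneq h 0.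
    by rewrite !scale0r add0r !subrr !normr0 mulr0.
  rewrite (_ : _ - _ = - (h *: (L - h^-1 *: (f (h *: v + x) - f x)))).
    by rewrite normrN normrZ mulrC ler_wpM2r// hP.
  by rewrite scalerBr scalerA mulfV// scale1r opprB.
move=> H.
suff cv : (fun h => h^-1 *: ((f \o shift x) (h *: v) - f x)) @ 0^' --> L.
  by apply: DeriveDef; [apply/cvg_ex; exists L | exact: cvg_lim cv].
apply/cvgrPdist_le => e e0; rewrite /dnbhs near_withinE.
apply: filterS (H e e0) => h /= hP h0.
rewrite -(ler_pM2l (_ : 0 < `|h|)) ?normr_gt0// -normrZ scalerBr scalerA.
by rewrite mulfV// scale1r distrC mulrC.
Qed.

Lemma mean_value_norm {E} (f df : R -> E) (a b M : R) : a <= b ->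
  {within `[a, b], continuous f} ->
  (forall t, a < t < b -> is_derive t 1 f (df t)) ->
  (forall t, a < t < b -> `|df t| <= M) ->
  `|f b - f a| <= M * (b - a).
Proof.
(* With slack e, the set of the t up to which |f t - f a| <= (M + e) (t - a) + e
   is closed by continuity and open to the right by differentiability. *)
move=> ab /subspace_continuousP fc fd dM.
have [->|aNb] := eqVneq a b; first by rewrite !subrr normr0 mulr0.
have ltab : a < b by rewrite lt_neqAle aNb.
suff H e : 0 < e -> `|f b - f a| <= (M + e) * (b - a) + e.
  apply/ler_addgt0Pr => e e0; pose k := b - a + 1.
  have k0 : 0 < k by rewrite /k; lra.
  apply: le_trans (H (e / k) _) _; first by rewrite divr_gt0.
  rewrite mulrDl -addrA lerD2l -[X in _ + X]mulr1 -mulrDr.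
  by rewrite -/k divfK// gt_eqF.
move=> e0.
pose P t := forall s, a <= s <= t -> `|f s - f a| <= (M + e) * (s - a) + e.
pose A := [set t | a <= t <= b /\ P t].
have Aa : A a.
  split; first by rewrite lexx.
  move=> s /andP[sa as_]; have -> : s = a by apply/eqP; rewrite eq_le sa as_.
  by rewrite !subrr normr0 mulr0 add0r ltW.
have As : has_sup A by split; [exists a|exists b => t [/andP[]]].
pose c := sup A.
have ac : a <= c by apply: sup_upper_bound.
have cb : c <= b by apply: sup_le_ub => //; [exists a|move=> t [/andP[]]].
have Plt s : a <= s < c -> `|f s - f a| <= (M + e) * (s - a) + e.
  move=> /andP[as_ sc].
  have [t [_ Pt] st] := sup_adherent (eps := c - s) ltac:(lra) As.
  by apply: Pt; rewrite as_ /=; rewrite /c in st *; lra.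
have nearI (t : R) (d : R) : 0 < d -> a <= t <= b ->
    exists2 r, 0 < r & forall s, a <= s <= b -> `|s - t| < r -> `|f s - f t| <= d.
  move=> d0 tab.
  have := fc t; rewrite /= in_itv /= => /(_ tab) /cvgrPdist_le /(_ _ d0).
  rewrite near_withinE => /nbhs_ballP[r /= r0 Hr]; exists r => // s sab st.
  by rewrite distrC; apply: Hr; rewrite /ball /= 1?distrC// in_itv.
have Pc : `|f c - f a| <= (M + e) * (c - a) + e.
  have [<-|aNc] := eqVneq a c.
    by rewrite !subrr normr0 mulr0 add0r ltW.
  have ltac : a < c by rewrite lt_neqAle aNc.
  apply/ler_addgt0Pr => d d0; pose d' := d / 2 / (`|M + e| + 1).
  have p0 : 0 < `|M + e| + 1 by rewrite ltr_pwDr.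
  have d'0 : 0 < d' by rewrite !divr_gt0.
  have [||r r0 Hr] := nearI c (d / 2); rewrite ?divr_gt0 ?ac ?cb//.
  pose m := Num.min (Num.min d' (r / 2)) (c - a).
  have m0 : 0 < m by rewrite !lt_min d'0 divr_gt0//= subr_gt0.
  have mc : m <= c - a by rewrite ge_min lexx orbT.
  have md : m <= d' by rewrite !ge_min lexx.
  have mr : m <= r / 2 by rewrite !ge_min lexx orbT.
  have {Hr} : `|f (c - m) - f c| <= d / 2.
    apply: Hr; first by apply/andP; split; lra.
    by rewrite addrAC subrr sub0r normrN gtr0_norm//; lra.
  have : `|f (c - m) - f a| <= (M + e) * (c - m - a) + e.
    by apply: Plt; apply/andP; split; lra.
  have : - (M + e) * m <= d / 2.
    have : - (M + e) * m <= (`|M + e| + 1) * d'.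
      apply: (@le_trans _ _ ((`|M + e| + 1) * m)).
        by rewrite ler_wpM2r// ?ltW//; have := ler_norm (- (M + e)); rewrite normrN; lra.
      by rewrite ler_wpM2l// ltW.
    by rewrite /d' [_ * (d / 2 / _)]mulrC divfK ?gt_eqF.
  have := ler_distD (f (c - m)) (f c) (f a); rewrite [`|f c - f (c - m)|]distrC.
  by rewrite !mulrDr !mulrDl; lra.
have [->|cNb] := eqVneq b c; first exact: Pc.
have ltcb : c < b by rewrite lt_neqAle eq_sym cNb.
suff [d d0 Hd] : exists2 d, 0 < d & forall h, 0 <= h <= d -> c + h <= b ->
    `|f (c + h) - f a| <= (M + e) * (c + h - a) + e.
  pose t := c + Num.min d (b - c).
  have md : Num.min d (b - c) <= d by rewrite ge_min lexx.
  have mb : Num.min d (b - c) <= b - c by rewrite ge_min lexx orbT.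
  have m0 : 0 < Num.min d (b - c) by rewrite lt_min d0 subr_gt0.
  have : A t.
    split; first by apply/andP; split; rewrite /t; lra.
    move=> s /andP[as_ st]; have [sc|cs] := ltP s c.
      by apply: Plt; rewrite as_.
    have -> : s = c + (s - c) by lra.
    by apply: Hd; rewrite /t in st; [apply/andP; split; lra|lra].
  by move=> /(sup_upper_bound As); rewrite -/c /t; lra.
(* At [c = a] no derivative is assumed, and the additive slack [e] pays for the increment by
   continuity alone; at an interior [c] the slack [e] in the slope pays for it. *)
have [<-|aNc] := eqVneq a c.
  have [|r r0 Hr] := nearI a e e0; first by rewrite lexx.
  exists (r / 2); first by rewrite divr_gt0.
  move=> h /andP[h0 hr] hb; have := Hr (a + h).
  rewrite (_ : a + h - a = h); last by lra.
  have M0 : 0 <= M.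
    by apply: le_trans (normr_ge0 _) (dM ((a + b) / 2) _); apply/andP; split; lra.
  move=> Hr'; apply: le_trans (Hr' _ _) _.
  - by apply/andP; split; lra.
  - by rewrite ger0_norm//; lra.
  - by rewrite lerDr mulr_ge0// addr_ge0// ltW.
have ltac : a < c by rewrite lt_neqAle aNc.
have cab : a < c < b by rewrite ltac ltcb.
have /is_deriveP /(_ e e0) := fd _ cab.
move=> /nbhs_ballP[r /= r0 Hr]; exists (r / 2); first by rewrite divr_gt0.
move=> h /andP[h0 hr] hb.
have {Hr} : `|f (c + h) - f c - h *: df c| <= e * h.
  have := Hr h; rewrite /ball /= sub0r normrN ger0_norm// [h *: 1]mulr1.
  by rewrite [h + c]addrC; apply; lra.
have : `|h *: df c| <= M * h.
  by rewrite normrZ ger0_norm// mulrC ler_wpM2r// dM.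
have := ler_normD (f (c + h) - f c - h *: df c) (h *: df c); rewrite subrK.
have := ler_distD (f c) (f (c + h)) (f a).
by move: Pc; rewrite !mulrDr !mulrDl; lra.
Qed.

End calculus.

Section plane.
Context {R : realType}.
Implicit Types (V W E : normedModType R).

Lemma is_derive_line {V E} (f : V -> E) x v L (a s : R) :
  is_derive ((s * a) *: v + x) v f L ->
  is_derive s 1 (fun s : R => f ((s * a) *: v + x)) (a *: L).
Proof.
move=> H; apply/is_deriveP => e e0.
have h1 : 0 < `|a| + 1 by rewrite ltr_wpDl.
have /is_deriveP /(_ (e / (`|a| + 1)) (divr_gt0 e0 h1)) := H.
move=> /nbhs_ballP[r /= r0 Hr].
apply/nbhs_ballP; exists (r / (`|a| + 1)) => /=; first by rewrite divr_gt0.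
move=> k; rewrite /ball /= sub0r normrN ltr_pdivlMr// => kr.
have := Hr (k * a); rewrite /ball /= sub0r normrN normrM.
move=> /(_ _)/wrap[].
  by apply: le_lt_trans kr; rewrite ler_wpM2l// lerDl.
rewrite [k *: 1]mulr1 mulrDl scalerDl [k *: (a *: L)]scalerA.
rewrite -[(k * a) *: v + _ + x]addrA.
move=> Hk; apply: (le_trans Hk).
rewrite mulrCA [leRHS]mulrC ler_wpM2l// mulrAC ler_pdivrMr// ler_wpM2l ?ltW//.
by rewrite ltrDl.
Qed.

Lemma is_derive1_cvg {E} (f : R -> E) (s : R) L :
  is_derive s 1 f L -> {for s, continuous f}.
Proof.
case=> fd _; apply/differentiable_continuous; exact/derivable1_diffP.
Qed.

(** This is the mean value inequality for [f] minus its linear approximation along the segment. The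
    open segment suffices for differentiability, which matters in [is_derive_glue], where the
    derivative at the starting point is what is sought. *)
Lemma mean_value_dir {V E} (f : V -> E) (df : R -> E) x v L (M h : R) :
  {within `[0, 1], continuous (fun s : R => f ((s * h) *: v + x))} ->
  (forall s : R, 0 < s < 1 -> is_derive ((s * h) *: v + x) v f (df s)) ->
  (forall s : R, 0 < s < 1 -> `|df s - L| <= M) ->
  `|f (h *: v + x) - f x - h *: L| <= M * `|h|.
Proof.
move=> fc fd dM.
have dl (s : R) : is_derive s 1 (fun s : R => (s * h) *: L) (h *: L).
  apply/is_deriveP => e e0; near=> k.
  rewrite [k *: 1]mulr1 mulrDl scalerDl addrK scalerA subrr normr0.
  by rewrite mulr_ge0// ltW.
pose g s := f ((s * h) *: v + x) - (s * h) *: L.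
have := @mean_value_norm _ _ g (fun s => h *: df s - h *: L) 0 1 (M * `|h|) ler01.
rewrite /g mul0r mul1r !scale0r add0r !subr0 mulr1 addrAC; apply.
- apply/subspace_continuousP => s s01; apply: cvgB.
    by have /subspace_continuousP := fc; exact.
  by apply: cvg_within_filter; exact: (is_derive1_cvg (dl s)).
- move=> s s01; have /is_derive_line d1 := fd s s01.
  exact: is_deriveB.
- move=> s s01; rewrite -scalerBr normrZ mulrC ler_wpM2r//; exact: dM.
Unshelve. all: by end_near. Qed.

Lemma mean_value_dir_derive {V E} (f : V -> E) (df : R -> E) x v L (M h : R) :
  (forall s : R, 0 <= s <= 1 -> is_derive ((s * h) *: v + x) v f (df s)) ->
  (forall s : R, 0 <= s <= 1 -> `|df s - L| <= M) ->
  `|f (h *: v + x) - f x - h *: L| <= M * `|h|.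
Proof.
move=> fd dM; apply: (mean_value_dir (df := df)).
- apply/subspace_continuousP => s; rewrite /= in_itv /= => s01.
  apply: cvg_within_filter.
  exact: (is_derive1_cvg (is_derive_line (fd s s01))).
- by move=> s /andP[s0 s1]; apply: fd; rewrite !ltW.
- by move=> s /andP[s0 s1]; apply: dM; rewrite !ltW.
Qed.

(** The increment along [h *: v] is split at the corner [(p.1, h * v.2 + p.2)]; on each leg,
    parallel to an axis, the mean value inequality compares the partial derivative with its value at
    [p]. *)
Lemma derive_pair {E} (f f1 f2 : R * R -> E) (p : R * R) (v : R * R) :
  (\forall q \near p, is_derive (q : R * R) (1, 0) f (f1 q)) ->
  (\forall q \near p, is_derive (q : R * R) (0, 1) f (f2 q)) ->
  {for p, continuous f1} -> {for p, continuous f2} ->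
  is_derive p v f (v.1 *: f1 p + v.2 *: f2 p).
Proof.
move=> d1 d2 c1 c2; apply/is_deriveP => e e0.
have k0 : 0 < `|v.1| + `|v.2| + 1 by rewrite ltr_wpDl// addr_ge0.
pose e' := e / (`|v.1| + `|v.2| + 1).
have e'0 : 0 < e' by rewrite divr_gt0.
have /cvgrPdist_le /(_ _ e'0) n1 := c1.
have /cvgrPdist_le /(_ _ e'0) n2 := c2.
have [r /= r0 Hr] : exists2 r : R, 0 < r & forall q, ball p r q ->
   [/\ is_derive (q : R * R) (1, 0) f (f1 q), is_derive (q : R * R) (0, 1) f (f2 q),
     `|f1 p - f1 q| <= e' & `|f2 p - f2 q| <= e'].
  have : \forall q \near p, [/\ is_derive (q : R * R) (1, 0) f (f1 q),
      is_derive (q : R * R) (0, 1) f (f2 q),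
      `|f1 p - f1 q| <= e' & `|f2 p - f2 q| <= e'].
    by near=> q; split; near: q.
  by move=> /nbhs_ballP[r /= r0 Hr]; exists r.
have near0 : \forall h \near (0:R), `|h * v.1| < r /\ `|h * v.2| < r.
  near=> h; suff : `|h| * (`|v.1| + `|v.2| + 1) < r.
    have := mulr_ge0 (normr_ge0 h) (normr_ge0 v.1).
    have := mulr_ge0 (normr_ge0 h) (normr_ge0 v.2).
    by rewrite !normrM; have := normr_ge0 h; rewrite !mulrDr; split; lra.
  rewrite -ltr_pdivlMr//; near: h; exact: (@nbhs0_lt R R _ (divr_gt0 r0 k0)).
apply: filterS near0 => h [h1 h2].
have inb (a b : R) : `|a| < r -> `|b| < r -> ball p r (a + p.1, b + p.2).
  by move=> ar br; split; rewrite /ball /= opprD addrCA subrr addr0 normrN.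
have small (s a : R) : 0 <= s <= 1 -> `|a| < r -> `|s * a| < r.
  move=> /andP[s0 s1]; apply: le_lt_trans.
  by rewrite normrM ger0_norm// ler_piMl.
have E1 (a b c : R) : a *: ((1, 0) : R * R) + (b, c) = (a + b, c).
  by congr pair => /=; [rewrite [a *: _]mulr1|rewrite scaler0 add0r].
have E2 (a b c : R) : a *: ((0, 1) : R * R) + (b, c) = (b, a + c).
  by congr pair => /=; [rewrite scaler0 add0r|rewrite [a *: _]mulr1].
have m1 := @mean_value_dir_derive _ _ f
   (fun s => f1 (s * (h * v.1) + p.1, h * v.2 + p.2))
   (p.1, h * v.2 + p.2) (1, 0) (f1 p) e' (h * v.1).
have m2 := @mean_value_dir_derive _ _ f
   (fun s => f2 (p.1, s * (h * v.2) + p.2))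
   (p.1, p.2) (0, 1) (f2 p) e' (h * v.2).
rewrite E1 in m1; rewrite E2 -surjective_pairing in m2.
have {}m1 := m1 ltac:(move=> s s01; rewrite E1;
  have [] := Hr _ (inb _ _ (small _ _ s01 h1) h2); done)
  ltac:(move=> s s01; rewrite distrC; have [] := Hr _ (inb _ _ (small _ _ s01 h1) h2); done).
have p1E (b : R) : (p.1, b) = (0 + p.1, b) by rewrite add0r.
have z0 : `|0 : R| < r by rewrite normr0.
have {}m2 := m2 ltac:(move=> s s01; rewrite [p in _ *: _ + p]surjective_pairing E2 p1E;
  have [] := Hr _ (inb _ _ z0 (small _ _ s01 h2)); done)
  ltac:(move=> s s01; rewrite distrC p1E; have [] := Hr _ (inb _ _ z0 (small _ _ s01 h2)); done).
rewrite (_ : h *: v + p = (h * v.1 + p.1, h * v.2 + p.2)); last first.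
  by rewrite [v in LHS]surjective_pairing [p in LHS]surjective_pairing.
rewrite (_ : f _ - _ - _ = (f (h * v.1 + p.1, h * v.2 + p.2) - f (p.1, h * v.2 + p.2) - (h * v.1) *: f1 p) + (f (p.1, h * v.2 + p.2) - f p - (h * v.2) *: f2 p)).
  apply: le_trans (ler_normD _ _) _; apply: le_trans (lerD m1 m2) _.
  rewrite -mulrDr !normrM -mulrDr mulrCA mulrC ler_wpM2r//.
  by rewrite /e' mulrAC ler_pdivrMr// ler_wpM2l ?ltW// ltrDl.
rewrite scalerDr !scalerA !opprD !addrA.
by rewrite [RHS](ACl (1*5*3*6*(4*2))%AC)/= subrr addr0.
Unshelve. all: by end_near. Qed.

End plane.

(** * Maps of class C^n on subsets of the plane *)

Section plane_maps.
Context {R : realType}.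
Implicit Types (E : normedModType R) (D : set (R * R)).

(* C^n through partial derivatives along the axes; f1 and f2 are required on all
   of D, where they are the continuous extensions of the partial derivatives.
   [derive_pair] recovers the other directions. *)
Fixpoint Cplane {E} (n : nat) D (f : R * R -> E) : Prop :=
  {within D, continuous f} /\
  if n is n'.+1 then
    exists f1 f2 : R * R -> E, [/\ Cplane n' D f1, Cplane n' D f2 &
      forall p, interior D p ->
        is_derive p (1, 0) f (f1 p) /\ is_derive p (0, 1) f (f2 p)]
  else True.

(** On such a domain a derivative known in the interior has at most one continuous extension to
    [D]. *)
Definition fat D := D `<=` closure (interior D).

Lemma Cplane_continuous {E} n D (f : R * R -> E) :
  Cplane n D f -> {within D, continuous f}.
Proof. by case: n => [|n] []. Qed.

Lemma CplaneS {E} n D (f : R * R -> E) : Cplane n.+1 D f -> Cplane n D f.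
Proof.
elim: n f => [|n IH] f [cf [f1 [f2 [H1 H2 H3]]]]; split => //.
by exists f1, f2; split => //; exact: IH.
Qed.

Lemma Cplane_sub {E} n D D' (f : R * R -> E) : D' `<=` D -> Cplane n D f -> Cplane n D' f.
Proof.
move=> DD'; elim: n f => [|n IH] f [cf].
  by split => //; exact: continuous_subspaceW cf.
move=> [f1 [f2 [H1 H2 H3]]]; split; first exact: continuous_subspaceW cf.
exists f1, f2; split; [exact: IH|exact: IH|move=> p /(interiorS DD')].
exact: H3.
Qed.

Lemma Cplane_eq {E} n D (f g : R * R -> E) :
  (forall p, D p -> f p = g p) -> Cplane n D f -> Cplane n D g.
Proof.
move=> fg; case: n => [|n] [cf Hf]; split => //.
- by apply: subspace_eq_continuous cf => p /set_mem; exact: fg.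
- by apply: subspace_eq_continuous cf => p /set_mem; exact: fg.
move: Hf => [f1 [f2 [H1 H2 H3]]]; exists f1, f2; split => // p Dp.
have [d1 d2] := H3 p Dp.
have fgp : \forall q \near p, f q = g q.
  by apply: filterS Dp => q; exact: fg.
by split; exact: near_eq_is_derive fgp _.
Qed.

Lemma Cplane_cst {E} n D (c : E) : Cplane n D (cst c).
Proof.
elim: n c => [|n IH] c; split => //.
- by apply: continuous_subspaceT => x; exact: cvg_cst.
- by apply: continuous_subspaceT => x; exact: cvg_cst.
- exists (cst 0), (cst 0); split; [exact: IH|exact: IH|move=> p Dp].
  by split; exact: is_derive_cst.
Qed.

Lemma CplaneD {E} n D (f g : R * R -> E) :
  Cplane n D f -> Cplane n D g -> Cplane n D (fun p => f p + g p).
Proof.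
elim: n f g => [|n IH] f g [cf Hf] [cg Hg].
  split => //; apply/subspace_continuousP => p Dp.
  apply: cvgD; [by move/subspace_continuousP: cf; apply|].
  by move/subspace_continuousP: cg; apply.
split.
  apply/subspace_continuousP => p Dp.
  apply: cvgD; [by move/subspace_continuousP: cf; apply|].
  by move/subspace_continuousP: cg; apply.
move: Hf Hg => [f1 [f2 [F1 F2 F3]]] [g1 [g2 [G1 G2 G3]]].
exists (fun p => f1 p + g1 p), (fun p => f2 p + g2 p).
split; [exact: IH|exact: IH|move=> p Dp].
have [? ?] := F3 _ Dp; have [? ?] := G3 _ Dp.
by split; apply: is_deriveD.
Qed.

Lemma is_deriveZf {V E : normedModType R} (phi : V -> R) (f : V -> E) p v (a : R) (L : E) :
  is_derive p v phi a -> is_derive p v f L ->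
  is_derive p v (fun q => phi q *: f q) (a *: f p + phi p *: L).
Proof.
move=> [dp pa] [df fL].
suff cv : (fun h => h^-1 *: (((fun q => phi q *: f q) \o shift p) (h *: v) -
    phi p *: f p)) @ 0^' --> a *: f p + phi p *: L.
  by apply: DeriveDef; [apply/cvg_ex; eexists; exact: cv|exact: cvg_lim cv].
have fc : f (h *: v + p) @[h --> 0^'] --> f p.
  apply: cvg_within_filter.
  have /derivable1P/derivable1_diffP/differentiable_continuous fc := df.
  have : {for 0, continuous (fun h : R => f (h *: v + p))} by exact: fc.
  by rewrite /prop_for /continuous_at scale0r add0r.
rewrite -pa -fL; move/cvg_ex: (dp) => [l hl]; have := hl.
rewrite {1}(_ : l = 'D_v phi p); last by rewrite -(cvg_lim _ hl).
move=> dp'; move/cvg_ex: (df) => [l' hl']; have := hl'.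
rewrite {1}(_ : l' = 'D_v f p); last by rewrite -(cvg_lim _ hl').
move=> df'.
apply: cvg_trans (cvgD (cvgZ dp' fc) (cvgZ (cvg_cst (phi p)) df')).
apply: near_eq_cvg; near=> h.
rewrite -[LHS]/((h^-1 * (phi (h *: v + p) - phi p)) *: f (h *: v + p) +
  phi p *: (h^-1 *: (f (h *: v + p) - f p))) /= scalerA [phi p * _]mulrC.
by rewrite -!scalerA -scalerDr scalerBl scalerBr addrA subrK.
Unshelve. all: by end_near. Qed.

Lemma CplaneZ {E} n D (phi : R * R -> R) (f : R * R -> E) :
  Cplane n D phi -> Cplane n D f -> Cplane n D (fun p => phi p *: f p).
Proof.
elim: n phi f => [|n IH] f g [cf Hf] [cg Hg].
  split => //; apply/subspace_continuousP => p Dp.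
  apply: cvgZ; [by move/subspace_continuousP: cf; apply|].
  by move/subspace_continuousP: cg; apply.
split.
  apply/subspace_continuousP => p Dp.
  apply: cvgZ; [by move/subspace_continuousP: cf; apply|].
  by move/subspace_continuousP: cg; apply.
have f0 : Cplane n D f by apply: CplaneS.
have g0 : Cplane n D g by apply: CplaneS.
move: Hf Hg => [f1 [f2 [F1 F2 F3]]] [g1 [g2 [G1 G2 G3]]].
exists (fun p => f1 p *: g p + f p *: g1 p), (fun p => f2 p *: g p + f p *: g2 p).
split; [by apply: CplaneD; exact: IH|by apply: CplaneD; exact: IH|move=> p Dp].
have [? ?] := F3 _ Dp; have [? ?] := G3 _ Dp.
by split; apply: is_deriveZf.
Qed.

Lemma is_derive_invf {V : normedModType R} (phi : V -> R) p v (d : R) :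
  phi p != 0 -> is_derive p v phi d ->
  is_derive p v (fun q => (phi q)^-1) (- phi p ^- 2 *: d).
Proof.
move=> p0 [dp <-]; apply: DeriveDef; first exact: derivableV p0 dp.
exact: deriveV p0 dp.
Qed.

Lemma CplaneV n D (phi : R * R -> R) : (forall p, D p -> phi p != 0) ->
  Cplane n D phi -> Cplane n D (fun p => (phi p)^-1).
Proof.
move=> phi0; elim: n => [|n IH] [cf Hf].
  split => //; apply/subspace_continuousP => p Dp.
  by apply: cvgV; [exact: phi0|move/subspace_continuousP: cf; apply].
split.
  apply/subspace_continuousP => p Dp.
  by apply: cvgV; [exact: phi0|move/subspace_continuousP: cf; apply].
have {}IH := IH (CplaneS (conj cf Hf)).
move: Hf => [f1 [f2 [F1 F2 F3]]].
have aux g : Cplane n D g -> Cplane n D (fun p => - (phi p ^- 2 *: g p)).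
  move=> Hg; have H := CplaneZ IH (CplaneZ IH Hg).
  have H' := CplaneZ (Cplane_cst n D (-1 : R)) H.
  by apply: Cplane_eq H' => p _; rewrite scaleN1r expr2 invfM scalerA.
exists (fun p => - (phi p ^- 2 *: f1 p)), (fun p => - (phi p ^- 2 *: f2 p)).
split; [exact: aux|exact: aux|move=> p Dp].
have p0 : phi p != 0 by apply: phi0; exact: interior_subset.
have [d1 d2] := F3 _ Dp.
by split; rewrite -scaleNr; exact: is_derive_invf.
Qed.

End plane_maps.

(** * Localization, affine substitutions and fat domains *)

Section local.
Context {R : realType}.
Implicit Types (E : normedModType R) (D N : set (R * R)).

Lemma interiorI_open (T : topologicalType) (D N : set T) :
  open N -> interior (D `&` N) = interior D `&` N.
Proof. by move=> oN; rewrite interiorI (iffLR (interior_id N) oN). Qed.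

Lemma within_local (T U : topologicalType) (D N : set T) (f : T -> U) p :
  open N -> N p -> f @ within (D `&` N) (nbhs p) --> f p ->
  f @ within D (nbhs p) --> f p.
Proof.
move=> oN Np cf V /cf H.
have {}H : \forall q \near p, (D `&` N) q -> V (f q) := H.
have nN : \forall q \near p, N q by exact: open_nbhs_nbhs.
change (\forall q \near p, D q -> V (f q)).
by apply: filterS2 H nN => q H Nq Dq; apply: H.
Qed.

Lemma within_comp (S T U : topologicalType) (D : set T) (C : set S)
    (g : S -> T) (f : T -> U) p :
  g @ within C (nbhs p) --> g p -> (forall q, C q -> D (g q)) ->
  f @ within D (nbhs (g p)) --> f (g p) ->
  (f \o g) @ within C (nbhs p) --> f (g p).
Proof.
move=> cg CD cf V /cf H.
have /cg {}H : \forall q \near g p, D q -> V (f q) := H.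
have {}H : \forall q \near p, C q -> D (g q) -> V (f (g q)) := H.
change (\forall q \near p, C q -> V (f (g q))).
by apply: filterS H => q H Cq; apply: H Cq (CD _ Cq).
Qed.

Lemma fat_continuous_eq {E} D N (f g : R * R -> E) : fat D -> open N ->
  {within D `&` N, continuous f} -> {within D `&` N, continuous g} ->
  (forall p, interior D p -> N p -> f p = g p) ->
  forall p, D p -> N p -> f p = g p.
Proof.
move=> fD oN /subspace_continuousP cf /subspace_continuousP cg fg p Dp Np.
apply/eqP/negPn/negP => fgp.
have e0 : 0 < `|f p - g p| / 2 by rewrite divr_gt0// normr_gt0 subr_eq0.
have /cvgrPdist_lt /(_ _ e0) := cf p (conj Dp Np).
have /cvgrPdist_lt /(_ _ e0) := cg p (conj Dp Np).
rewrite !near_withinE => ng nf.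
have [q [Dq [[qf qg] Nq]]] := fD p Dp _ (filterI (filterI nf ng) (open_nbhs_nbhs (conj oN Np))).
have DNq : (D `&` N) q by split => //; exact: interior_subset.
have := ler_distD (f q) (f p) (g p).
rewrite {2}(fg q Dq Nq) [`|g q - _|]distrC.
by move: (qf DNq) (qg DNq); lra.
Qed.

(** The extended partial derivatives are given only locally. By fatness two local choices agree on
    the overlap, boundary points included, so evaluating at [q] the choice made at [q] itself
    defines global ones. *)
Lemma Cplane_local {E} n D (f : R * R -> E) : fat D ->
  (forall p, D p -> exists N, [/\ open N, N p & Cplane n (D `&` N) f]) -> Cplane n D f.
Proof.
move=> fD; elim: n f => [|n IH] f H.
  split => //; apply/subspace_continuousP => p Dp.
  have [N [oN Np [/subspace_continuousP cf _]]] := H p Dp.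
  exact: within_local oN Np (cf p (conj Dp Np)).
have cf : {within D, continuous f}.
  apply/subspace_continuousP => p Dp.
  have [N [oN Np [/subspace_continuousP cf _]]] := H p Dp.
  exact: within_local oN Np (cf p (conj Dp Np)).
split => //.
have /choice[T HT] : forall p, exists t : set (R * R) * ((R * R -> E) * (R * R -> E)),
    D p -> [/\ open t.1, t.1 p, Cplane n (D `&` t.1) t.2.1, Cplane n (D `&` t.1) t.2.2 &
      forall q, interior D q -> t.1 q ->
        is_derive (q : R * R) (1, 0) f (t.2.1 q) /\ is_derive (q : R * R) (0, 1) f (t.2.2 q)].
  move=> p; have [Dp|nDp] := pselect (D p); last first.
    by exists (set0, (f, f)).
  have [N [oN Np [_ [f1 [f2 [H1 H2 H3]]]]]] := H p Dp.
  exists (N, (f1, f2)) => _; split => // q Dq Nq.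
  by apply: H3; rewrite interiorI_open.
have sub p q : (D `&` (T p).1) `&` (T q).1 `<=` D `&` (T p).1 by move=> x [].
have sub' p q : (D `&` (T p).1) `&` (T q).1 `<=` D `&` (T q).1 by move=> x [[? _] ?].
have E1 p q : D p -> D q -> (T p).1 q -> (T q).2.1 q = (T p).2.1 q.
  move=> Dp Dq pq.
  have [oP Pp P1 P2 P3] := HT p Dp; have [oQ Qq Q1 Q2 Q3] := HT q Dq.
  apply: (@fat_continuous_eq _ D ((T p).1 `&` (T q).1)) => //.
  - exact: openI.
  - rewrite setIA; apply: continuous_subspaceW (Cplane_continuous Q1); exact: sub'.
  - rewrite setIA; apply: continuous_subspaceW (Cplane_continuous P1); exact: sub.
  - move=> x Dx [px qx]; have [[_ <-] _] := P3 x Dx px.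
    by have [[_ <-] _] := Q3 x Dx qx.
have E2 p q : D p -> D q -> (T p).1 q -> (T q).2.2 q = (T p).2.2 q.
  move=> Dp Dq pq.
  have [oP Pp P1 P2 P3] := HT p Dp; have [oQ Qq Q1 Q2 Q3] := HT q Dq.
  apply: (@fat_continuous_eq _ D ((T p).1 `&` (T q).1)) => //.
  - exact: openI.
  - rewrite setIA; apply: continuous_subspaceW (Cplane_continuous Q2); exact: sub'.
  - rewrite setIA; apply: continuous_subspaceW (Cplane_continuous P2); exact: sub.
  - move=> x Dx [px qx]; have [_ [_ <-]] := P3 x Dx px.
    by have [_ [_ <-]] := Q3 x Dx qx.
exists (fun q => (T q).2.1 q), (fun q => (T q).2.2 q); split.
- apply: IH => p Dp; have [oP Pp P1 P2 P3] := HT p Dp.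
  exists (T p).1; split => //; apply: Cplane_eq P1 => q [Dq pq].
  by rewrite (E1 p q).
- apply: IH => p Dp; have [oP Pp P1 P2 P3] := HT p Dp.
  exists (T p).1; split => //; apply: Cplane_eq P2 => q [Dq pq].
  by rewrite (E2 p q).
move=> p Dp; have [oP Pp P1 P2 P3] := HT p (interior_subset Dp).
exact: P3.
Qed.

Lemma is_deriveZdir {V E : normedModType R} (f : V -> E) x v L (a : R) :
  is_derive x v f L -> is_derive x (a *: v) f (a *: L).
Proof.
move=> H; have {}H : is_derive ((0 * a) *: v + x) v f L.
  by rewrite mul0r scale0r add0r.
have /is_deriveP {}H := is_derive_line H; apply/is_deriveP => e /H.
apply: filterS => h; rewrite [h *: 1]mulr1 addr0 mul0r scale0r add0r.
by rewrite -scalerA.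
Qed.

Lemma cvg_pair_point (Z : Type) (F : set_system Z) (FF : Filter F)
    (S T : topologicalType) (f : Z -> S) (g : Z -> T) (x : S) (y : T) :
  f @ F --> x -> g @ F --> y -> (fun z => (f z, g z)) @ F --> (x, y).
Proof. by move=> fx gy; exact: cvg_pair. Qed.

(** One affine substitution in t covers the reflections ([c = 0], negative [b]) and the flip t |-> 1
    - t ([b = -1], [c = 1]). *)
Definition shear (b c : R) (p : R * R) : R * R := (p.1, b * p.2 + c).

Lemma continuous_shear b c : continuous (shear b c).
Proof.
move=> p; apply: cvg_pair_point; first exact: cvg_fst.
apply: cvgD; last exact: cvg_cst.
by apply: cvgM; [exact: cvg_cst|exact: cvg_snd].
Qed.

Lemma interior_shear b c D p : b != 0 ->
  interior (shear b c @^-1` D) p -> interior D (shear b c p).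
Proof.
move=> b0 Dp.
have inv q : shear b c (shear b^-1 (- (c / b)) q) = q.
  rewrite /shear /=; case: q => x y /=; congr pair.
  by rewrite mulrDr mulrA mulfV// mul1r mulrN mulrCA mulfV// mulr1 subrK.
have inv' q : shear b^-1 (- (c / b)) (shear b c q) = q.
  rewrite /shear /=; case: q => x y /=; congr pair.
  by rewrite mulrDr mulrA mulVf// mul1r [c / b]mulrC addrK.
rewrite -[p]inv' in Dp.
have H : \forall q \near shear b c p, D (shear b c (shear b^-1 (- (c / b)) q)).
  exact: (@continuous_shear b^-1 (- (c / b)) (shear b c p) _ Dp).
by apply: filterS H => q; rewrite inv.
Qed.

Lemma is_derive_shear_fst {E} (f : R * R -> E) b c p L :
  is_derive (shear b c p) (1, 0) f L -> is_derive p (1, 0) (f \o shear b c) L.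
Proof.
move=> /is_deriveP d; apply/is_deriveP => e e0; apply: filterS (d e e0) => h.
rewrite (_ : h *: _ + shear b c p = shear b c (h *: (1, 0) + p))//.
by congr pair; rewrite /= ?scaler0 ?add0r.
Qed.

Lemma is_derive_shear_snd {E} (f : R * R -> E) b c p L :
  is_derive (shear b c p) (0, 1) f L -> is_derive p (0, 1) (f \o shear b c) (b *: L).
Proof.
move=> /(is_deriveZdir b)/is_deriveP d; apply/is_deriveP => e e0.
apply: filterS (d e e0) => h.
rewrite (_ : h *: _ + shear b c p = shear b c (h *: (0, 1) + p))//.
congr pair; rewrite /= ?scaler0 ?add0r//.
rewrite [b *: 1]mulr1 [h *: 1]mulr1 mulrDr addrA; congr (_ + _ + _).
exact: mulrC.
Qed.

Lemma Cplane_shear {E} n D (f : R * R -> E) b c : b != 0 ->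
  Cplane n D f -> Cplane n (shear b c @^-1` D) (f \o shear b c).
Proof.
move=> b0.
have cont (g : R * R -> E) : {within D, continuous g} ->
    {within shear b c @^-1` D, continuous (g \o shear b c)}.
  move=> /subspace_continuousP cg; apply/subspace_continuousP => p Dp.
  apply: (within_comp _ _ (cg _ Dp)) => //.
  by apply: cvg_within_filter; exact: continuous_shear.
elim: n f => [|n IH] f [cf Hf]; first by split => //; exact: cont.
split; first exact: cont.
move: Hf => [f1 [f2 [H1 H2 H3]]].
exists (f1 \o shear b c), (fun p => cst b p *: (f2 \o shear b c) p).
split; [exact: IH|by apply: CplaneZ (Cplane_cst _ _ _) _; exact: IH|].
move=> p /(interior_shear b0) /H3[d1 d2].
by split; [exact: is_derive_shear_fst|exact: is_derive_shear_snd].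
Qed.

(** Any point of [D], moved slightly towards the centre [c], lands in the interior. *)
Lemma fat_star D (c : R * R) :
  (forall p (l : R), D p -> 0 < l <= 1 -> interior D (l *: (c - p) + p)) -> fat D.
Proof.
move=> H p Dp B nB.
have cv : (fun l : R => l *: (c - p) + p) @ (0 : R) --> p.
  suff : (fun l : R => l *: (c - p) + p) @ (0 : R) --> (0 : R) *: (c - p) + p.
    by rewrite scale0r add0r.
  by apply: cvgD; [apply: cvgZr_tmp; exact: cvg_id|exact: cvg_cst].
have /nbhs_ballP[r /= r0 Hr] := cv _ nB.
pose l := Num.min (r / 2) 1.
have l0 : 0 < l by rewrite /l lt_min divr_gt0//= ltr01.
have lr : l < r.
  by rewrite (@le_lt_trans _ _ (r / 2))// ?ge_min ?lexx// ltr_pdivrMr// ltr_pMr// ltr1n.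
exists (l *: (c - p) + p); split.
  by apply: H => //; rewrite l0 /l ge_min lexx orbT.
by apply: Hr; rewrite /ball /= sub0r normrN gtr0_norm.
Qed.

Lemma fat_slab (alpha beta t0 : R) (T : set R) : alpha < beta ->
  (forall t l : R, T t -> 0 < l <= 1 -> interior T (l * (t0 - t) + t)) ->
  fat [set p : R * R | alpha <= p.1 <= beta /\ T p.2].
Proof.
move=> ab HT; apply: (@fat_star _ ((alpha + beta) / 2, t0)) => -[x y] l [/= xab Ty] l01.
move/andP: (l01) => [l0 l1]; move/andP: xab => [ax xb].
pose u := l * ((alpha + beta) / 2 - x) + x.
have au : alpha < u.
  have : 0 < l * ((beta - alpha) / 2) by rewrite mulr_gt0// divr_gt0// subr_gt0.
  have : 0 <= (1 - l) * (x - alpha) by rewrite mulr_ge0 ?subr_ge0.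
  by rewrite /u; nra.
have ub : u < beta.
  have : 0 < l * ((beta - alpha) / 2) by rewrite mulr_gt0// divr_gt0// subr_gt0.
  have : 0 <= (1 - l) * (beta - x) by rewrite mulr_ge0 ?subr_ge0.
  by rewrite /u; nra.
have n1 : \forall v \near u, alpha <= v <= beta.
  near=> v; apply/andP; split; apply: ltW; near: v.
    exact: lt_nbhsr.
  exact: lt_nbhsl.
have n2 := HT y l Ty l01.
have : \forall q \near (u, l * (t0 - y) + y), alpha <= q.1 <= beta /\ T q.2.
  by exists ([set v | alpha <= v <= beta], T); [split|move=> [? ?] []].
exact.
Unshelve. all: by end_near. Qed.

End local.

(** * Iterated derivatives *)

Section iterated.
Context {R : realType}.
Implicit Types (X E F : normedModType R).

(** [iter_derive] is total and says nothing about existence; the rules for sums need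
    differentiability at every stage. *)
Fixpoint iter_derivable {X F} (f : X -> F) (O : set X) (vs : seq X) : Prop :=
  if vs is v :: vs' then
    iter_derivable f O vs' /\ forall x, O x -> derivable (iter_derive f vs') x v
  else True.

Lemma iter_derive_eq {X F} (O : set X) (f g : X -> F) : open O ->
  (forall x, O x -> f x = g x) ->
  forall vs x, O x -> iter_derive f vs x = iter_derive g vs x.
Proof.
move=> oO fg; elim=> [|v vs IH] x Ox /=; first exact: fg.
by apply: near_eq_derive; apply: filterS (open_nbhs_nbhs (conj oO Ox)).
Qed.

Lemma iter_derivable_eq {X F} (O : set X) (f g : X -> F) vs : open O ->
  (forall x, O x -> f x = g x) ->
  iter_derivable f O vs -> iter_derivable g O vs.
Proof.
move=> oO fg; elim: vs => [//|v vs IH] /= [Hf dF]; split; first exact: IH.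
move=> x Ox; apply: near_eq_derivable (dF x Ox).
by apply: filterS (open_nbhs_nbhs (conj oO Ox)); exact: iter_derive_eq.
Qed.

Lemma iter_derive_lin {X F} (O : set X) (f g : X -> F) (c d : R) vs : open O ->
  iter_derivable f O vs -> iter_derivable g O vs ->
  iter_derivable (fun x => c *: f x + d *: g x) O vs /\
  forall x, O x -> iter_derive (fun x => c *: f x + d *: g x) vs x =
    c *: iter_derive f vs x + d *: iter_derive g vs x.
Proof.
move=> oO; elim: vs => [//|v vs IH] /= [Hf dF] [Hg dG].
have [H1 H2] := IH Hf Hg.
have D x : O x -> is_derive x v (iter_derive (fun x => c *: f x + d *: g x) vs)
    (c *: 'D_v (iter_derive f vs) x + d *: 'D_v (iter_derive g vs) x).
  move=> Ox; apply: (@near_eq_is_derive _ _ _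
      (fun x => c *: iter_derive f vs x + d *: iter_derive g vs x)).
    by apply: filterS (open_nbhs_nbhs (conj oO Ox)) => y Oy; rewrite H2.
  have := derivableP (dF x Ox); have := derivableP (dG x Ox) => dg df.
  exact: is_deriveD (is_deriveZ c df) (is_deriveZ d dg).
split; first by split => // x /D[].
by move=> x /D[].
Qed.

Lemma iter_derive_cat {X F} (f : X -> F) vs us :
  iter_derive f (vs ++ us) = iter_derive (iter_derive f us) vs.
Proof. by elim: vs => //= v vs ->. Qed.

Lemma iter_derivable_cat {X F} (f : X -> F) O vs us :
  iter_derivable f O us -> iter_derivable (iter_derive f us) O vs ->
  iter_derivable f O (vs ++ us).
Proof.
move=> fu; elim: vs => //= v vs IH [H dF]; split; first exact: IH.
by rewrite iter_derive_cat.
Qed.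

Lemma iter_derive0 {X F} (vs : seq X) x : iter_derive (fun=> 0 : F) vs x = 0.
Proof.
elim: vs x => //= v vs IH x.
by rewrite (_ : iter_derive _ vs = cst 0) ?derive_cst//; apply/funext.
Qed.

Fixpoint all_cvg {Z : Type} {X} (F : set_system Z) (ws : seq ((Z -> X) * X)) : Prop :=
  if ws is w :: ws' then w.1 @ F --> w.2 /\ all_cvg F ws' else True.

Lemma all_cvg_cat {Z : Type} {X} (F : set_system Z) (us ws : seq ((Z -> X) * X)) :
  all_cvg F (us ++ ws) <-> all_cvg F us /\ all_cvg F ws.
Proof.
by elim: us => [|u us IH] /=; [tauto|rewrite IH; tauto].
Qed.

Lemma all_cvg_nth {Z : Type} {X} (F : set_system Z) (FF : Filter F)
    (ws : seq ((Z -> X) * X)) i : all_cvg F ws ->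
  nth 0 [seq w.1 z | w <- ws] i @[z --> F] --> nth 0 [seq w.2 | w <- ws] i.
Proof.
elim: ws i => [|w ws IH] [|i] /= H.
- exact: cvg_cst.
- exact: cvg_cst.
- by case: H.
- by apply: IH; case: H.
Qed.

Lemma codom_nth {T : Type} (x0 : T) (s : seq T) :
  codom (fun i : 'I_(size s) => nth x0 s i) = s.
Proof.
rewrite codomE (map_comp (nth x0 s) val) val_enum_ord.
exact: mkseq_nth.
Qed.

Lemma cvg_ptws (n : nat) {X : normedModType R} {Z : Type} (F : set_system Z) (FF : Filter F)
  (v : Z -> {ptws 'I_n -> X}) (v0 : {ptws 'I_n -> X}) :
  (forall i, v z i @[z --> F] --> v0 i) -> v @ F --> v0.
Proof.
move=> H; apply/cvg_sup => i.
rewrite cvg_image; last by rewrite eqEsubset; split=> w // _; exists (cst w).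
move=> W /= nW.
have {}H := H i W nW.
exists ((fun f : 'I_n -> X => f i) @^-1` W) => //=.
by rewrite eqEsubset; split => [_ [? + <-//]|w Ww]; exists (fun=> w).
Qed.

Lemma eval_ptws_cvg (n : nat) {X : normedModType R} (i : 'I_n) :
  continuous (fun v : {ptws 'I_n -> X} => v i).
Proof. exact: proj_continuous. Qed.

End iterated.

(** * Smooth maps on open sets and the Leibniz rule *)

Section smooth.
Context {R : realType}.
Implicit Types (X E F : normedModType R).

(* Joint continuity in base point and directions is stated along an arbitrary
   filter, each direction moving on its own and paired with its limit, so that
   sublists of directions can be treated separately in the Leibniz rule. *)
Definition smooth_at_all {X F} (O : set X) (f : X -> F) : Prop :=
  (forall vs x v, O x -> derivable (iter_derive f vs) x v) /\
  (forall (Z : Type) (G : set_system Z) (y : Z -> X) (x : X)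
      (ws : seq ((Z -> X) * X)), Filter G -> O x -> y @ G --> x ->
    all_cvg G ws ->
    iter_derive f [seq w.1 z | w <- ws] (y z) @[z --> G] -->
      iter_derive f [seq w.2 | w <- ws] x).

(** All of [O] lies in the interior of [D], so the extension [g] coincides there with the iterated
    derivative; a list of n moving directions is read as one moving point of the product indexed by
    ['I_n]. *)
Lemma Cr_on_smooth {X F} (D O : set X) (f : X -> F) : open O -> O `<=` D ->
  Cr_on None D f -> smooth_at_all O f.
Proof.
move=> oO OD [_ df cf].
have OD' x : O x -> interior D x.
  by move=> Ox; apply: filterS OD (open_nbhs_nbhs (conj oO Ox)).
split=> [vs x v /OD' Dx|Z G y x ws FG Ox yx wsc].
  exact: df.
have [g [gc gE]] := cf (size ws) isT.
have nthE (h : (Z -> X) * X -> X) :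
    codom (fun i : 'I_(size ws) => nth 0 [seq h w | w <- ws] i) = [seq h w | w <- ws].
  have := codom_nth (0 : X) [seq h w | w <- ws].
  by rewrite size_map.
pose v z : {ptws 'I_(size ws) -> X} := fun i => nth 0 [seq w.1 z | w <- ws] i.
pose v0 : {ptws 'I_(size ws) -> X} := fun i => nth 0 [seq w.2 | w <- ws] i.
have vc : v @ G --> v0 by apply: cvg_ptws => i; exact: all_cvg_nth.
have Dx : D x by exact: OD.
have /subspace_continuousP /(_ (x, v0) (conj Dx I)) gc' := gc.
have gE0 : g (x, v0) = iter_derive f [seq w.2 | w <- ws] x.
  by rewrite gE; [rewrite /v0 nthE|exact: OD'].
rewrite -gE0 => W /gc' HW.
have {}HW : \forall p \near (x, v0), (D `*` setT) p -> W (g p) := HW.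
have nO : \forall z \near G, O (y z) by apply: yx; exact: open_nbhs_nbhs.
have nW : \forall z \near G, (D `*` setT) (y z, v z) -> W (g (y z, v z)).
  exact: (cvg_pair_point FG yx vc) HW.
change (\forall z \near G, W (iter_derive f [seq w.1 z | w <- ws] (y z))).
near=> z.
have Oz : O (y z) by near: z.
have : W (g (y z, v z)) by apply: (near nW z) => //; split => //; exact: OD.
by rewrite gE; [rewrite /v nthE|exact: OD'].
Unshelve. all: by end_near. Qed.

Lemma smooth_at_allU {X F} (O O' : set X) (f : X -> F) :
  smooth_at_all O f -> smooth_at_all O' f -> smooth_at_all (O `|` O') f.
Proof.
move=> [d1 c1] [d2 c2]; split=> [vs x v [Ox|Ox]|Z G y x ws FG [Ox|Ox]].
- exact: d1.
- exact: d2.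
- exact: c1.
- exact: c2.
Qed.

Lemma smooth_at_all_sub {X F} (O O' : set X) (f : X -> F) : O' `<=` O ->
  smooth_at_all O f -> smooth_at_all O' f.
Proof.
move=> OO [d c]; split=> [vs x v /OO|Z G y x ws FG /OO]; [exact: d|exact: c].
Qed.

Lemma smooth_at_all_eq {X F} (O : set X) (f g : X -> F) : open O ->
  (forall x, O x -> f x = g x) -> smooth_at_all O f -> smooth_at_all O g.
Proof.
move=> oO fg [d c]; have E := iter_derive_eq oO fg; split.
  move=> vs x v Ox; apply: near_eq_derivable (d vs x v Ox).
  by apply: filterS (open_nbhs_nbhs (conj oO Ox)) => y; exact: E.
move=> Z G y x ws FG Ox yx wsc; rewrite -E//.
apply: cvg_trans (c Z G y x ws FG Ox yx wsc); apply: near_eq_cvg.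
have nO : \forall z \near G, O (y z) by apply: yx; exact: open_nbhs_nbhs.
by apply: filterS nO => z Oz; rewrite E.
Qed.

Lemma smooth_at_all_cst {X F} (O : set X) (c : F) : smooth_at_all O (fun=> c).
Proof.
have E vs x : iter_derive (fun=> c) vs x = if vs is [::] then c else 0 :> F.
  case: vs => //= v vs.
  elim: vs v x => [|w vs IH] v x; first exact: derive_cst.
  by rewrite /= (_ : 'D_w _ = cst 0) ?derive_cst//; apply/funext => z; exact: IH.
have {}E vs : iter_derive (fun _ : X => c) vs = cst (if vs is [::] then c else 0).
  by apply/funext => x; exact: E.
split=> [vs x v _|Z G y x ws FG _ _ _].
  by rewrite E; exact: derivable_cst.
under eq_cvg do rewrite E.
by rewrite E; case: ws => [|w ws]; exact: cvg_cst.
Qed.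

(* Leibniz rule: the factors are differentiated along complementary sublists. *)
Fixpoint splits {T : Type} (ws : seq T) : seq (seq T * seq T) :=
  if ws is w :: ws' then
    [seq (w :: p.1, p.2) | p <- splits ws'] ++ [seq (p.1, w :: p.2) | p <- splits ws']
  else [:: ([::], [::])].

Lemma splits_map {T U : Type} (h : T -> U) (ws : seq T) :
  splits (map h ws) = [seq (map h p.1, map h p.2) | p <- splits ws].
Proof.
elim: ws => //= w ws ->; rewrite map_cat -!map_comp.
by congr (_ ++ _); apply: eq_map.
Qed.

Lemma iter_deriveZ {X F} (O : set X) (phi : X -> R) (f : X -> F) vs : open O ->
  smooth_at_all O phi -> smooth_at_all O f -> forall x, O x ->
  (forall v, derivable (iter_derive (fun x => phi x *: f x) vs) x v) /\
  iter_derive (fun x => phi x *: f x) vs x =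
    \sum_(p <- splits vs) iter_derive phi p.1 x *: iter_derive f p.2 x.
Proof.
move=> oO [dp _] [df _].
have S (s : seq (seq X * seq X)) x v : O x -> is_derive x v
    (fun x => \sum_(p <- s) iter_derive phi p.1 x *: iter_derive f p.2 x)
    (\sum_(p <- s) (iter_derive phi (v :: p.1) x *: iter_derive f p.2 x +
                    iter_derive phi p.1 x *: iter_derive f (v :: p.2) x)).
  move=> Ox; elim: s => [|p s IH].
    rewrite big_nil (_ : (fun _ => _) = cst 0); first exact: is_derive_cst.
    by apply/funext => y; rewrite big_nil.
  rewrite big_cons (_ : (fun _ => _) = (fun y => iter_derive phi p.1 y *: iter_derive f p.2 y) +
    (fun y => \sum_(p <- s) iter_derive phi p.1 y *: iter_derive f p.2 y)).
    apply: is_deriveD => //.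
    by apply: is_deriveZf; apply: derivableP; [exact: dp|exact: df].
  by apply/funext => y; rewrite big_cons.
elim: vs => [|w vs IH] x Ox.
  split; last by rewrite big_seq1.
  move=> v /=; have [] := S [:: ([::], [::])] x v Ox => + _.
  by rewrite (_ : (fun _ => _) = (fun x => phi x *: f x))//; apply/funext => y; rewrite big_seq1.
have E y : O y -> 'D_w (iter_derive (fun x => phi x *: f x) vs) y =
    \sum_(p <- splits (w :: vs)) iter_derive phi p.1 y *: iter_derive f p.2 y.
  move=> Oy; have n : \forall z \near y, iter_derive (fun x => phi x *: f x) vs z =
      \sum_(p <- splits vs) iter_derive phi p.1 z *: iter_derive f p.2 z.
    by apply: filterS (open_nbhs_nbhs (conj oO Oy)) => z /IH[].
  rewrite (near_eq_derive _ n).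
  have [_ ->] := S (splits vs) y w Oy.
  by rewrite big_cat /= !big_map /= big_split.
split => [v|]; last exact: E.
have n : \forall z \near x, \sum_(p <- splits (w :: vs)) iter_derive phi p.1 z *: iter_derive f p.2 z
     = iter_derive (fun x => phi x *: f x) (w :: vs) z.
  by apply: filterS (open_nbhs_nbhs (conj oO Ox)) => z /E.
by apply: near_eq_derivable n _; have [] := S (splits (w :: vs)) x v Ox.
Qed.

Lemma all_cvg_splits {Z : Type} {X} (G : set_system Z) (ws : seq ((Z -> X) * X)) :
  all_cvg G ws -> forall i, 
  all_cvg G (nth ([::], [::]) (splits ws) i).1 /\ all_cvg G (nth ([::], [::]) (splits ws) i).2.
Proof.
elim: ws => [|w ws IH] /=; first by move=> _ [|[|]].
move=> [wc /IH H] i; rewrite nth_cat size_map.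
have [lt|ge] := ltnP i (size (splits ws)).
  by rewrite (nth_map ([::], [::]))//=; have [] := H i.
set k := (_ - _)%N; have [lt|ge'] := ltnP k (size (splits ws)).
  by rewrite (nth_map ([::], [::]))//=; have [] := H k.
by rewrite nth_default ?size_map.
Qed.

Lemma cvg_sum_nth {F} (Z I : Type) (G : set_system Z) (FG : Filter G)
    (A : I -> Z -> F) (B : I -> F) d s :
  (forall i, A (nth d s i) @ G --> B (nth d s i)) ->
  (fun z => \sum_(p <- s) A p z) @ G --> \sum_(p <- s) B p.
Proof.
elim: s => [|p s IH] H.
  rewrite big_nil; have -> : (fun z => \sum_(p <- [::]) A p z) = cst 0.
    by apply/funext => z; rewrite big_nil.
  exact: cvg_cst.
rewrite big_cons.
have -> : (fun z => \sum_(p <- p :: s) A p z) = A p \+ (fun z => \sum_(p <- s) A p z).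
  by apply/funext => z; rewrite big_cons.
by apply: cvgD; [exact: (H 0%N)|apply: IH => i; exact: (H i.+1)].
Qed.

Lemma smooth_at_allZ {X F} (O : set X) (phi : X -> R) (f : X -> F) : open O ->
  smooth_at_all O phi -> smooth_at_all O f ->
  smooth_at_all O (fun x => phi x *: f x).
Proof.
move=> oO Hp Hf; have L := iter_deriveZ _ oO Hp Hf; split.
  by move=> vs x v Ox; have [] := L vs x Ox.
move=> Z G y x ws FG Ox yx wsc; have [_ ->] := L [seq w.2 | w <- ws] x Ox.
have := cvg_sum_nth FG
  (A := fun p z => iter_derive phi [seq w.1 z | w <- p.1] (y z) *:
                   iter_derive f [seq w.1 z | w <- p.2] (y z))
  (B := fun p => iter_derive phi [seq w.2 | w <- p.1] x *:
                 iter_derive f [seq w.2 | w <- p.2] x)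
  (d := ([::], [::])) (s := splits ws).
rewrite splits_map big_map => /(_ _)/wrap[].
  move=> i; have [H1 H2] := all_cvg_splits wsc i.
  by apply: cvgZ; [exact: (proj2 Hp)|exact: (proj2 Hf)].
apply: cvg_trans; apply: near_eq_cvg.
have nO : \forall z \near G, O (y z) by apply: yx; exact: open_nbhs_nbhs.
apply: filterS nO => z Oz; have [_ ->] := L [seq w.1 z | w <- ws] (y z) Oz.
by rewrite splits_map big_map.
Qed.

End smooth.

(** * Iterated derivatives extended to the boundary *)

Section extension_of_derivatives.
Context {R : realType}.
Implicit Types (E F : normedModType R) (D : set (R * R)).

(** Freezing the directions in the joint extension [g] gives, for each list [vs], a continuous
    extension [H vs] of the iterated derivative to [D]. The partial derivatives of [H vs] are then
    [H] of the list prolonged by an axis vector. *)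
Lemma Cr_on_Cplane {E} r D (f : R * R -> E) n : Cr_on r D f -> le_order n r -> Cplane n D f.
Proof.
move=> [fc df cf].
have ext (vs : seq (R * R)) : exists h : R * R -> E, le_order (size vs) r ->
    {within D, continuous h} /\ forall x, interior D x -> h x = iter_derive f vs x.
  have [le|nle] := boolP (le_order (size vs) r); last by exists f.
  have [g [gc gE]] := cf _ le.
  pose v : {ptws 'I_(size vs) -> (R * R)%type} := fun i => nth 0 vs i.
  exists (fun x => g (x, v)) => _; split.
    apply/subspace_continuousP => x Dx.
    have /subspace_continuousP /(_ (x, v) (conj Dx I)) gc' := gc.
    move=> W /gc' HW.
    have {}HW : \forall p \near (x, v), (D `*` setT) p -> W (g p) := HW.
    change (\forall q \near x, D q -> W (g (q, v))).
    have : \forall q \near x, (D `*` setT) (q, v) -> W (g (q, v)).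
      exact: (cvg_pair_point _ (@cvg_id _ _) (@cvg_cst _ v _ _ _)) HW.
    by apply: filterS => q H Dq; apply: H.
  by move=> x Dx; rewrite gE//; congr (iter_derive f _ x); exact: codom_nth.
have /choice[H HP] := ext.
have leW i j : (i <= j)%N -> le_order j r -> le_order i r.
  by case: (r) => //= m ij; exact: leq_trans.
have main m vs : le_order (m + size vs)%N r -> Cplane m D (H vs).
  elim: m vs => [|m IH] vs le.
    by split => //; have [] := HP vs le.
  have lev : le_order (size vs) r by apply: leW le; exact: leq_addl.
  have [Hc HE] := HP vs lev.
  split => //; exists (H ((1, 0) :: vs)), (H ((0, 1) :: vs)).
  have le' : le_order (m + (size vs).+1)%N r by rewrite addnS.
  split; [exact: IH|exact: IH|move=> p Dp].
  have le1 : le_order (size vs).+1 r.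
    by apply: leW le; rewrite addSn ltnS leq_addl.
  have D1 v : is_derive p v (H vs) (H (v :: vs) p).
    have [_ ->//] := HP (v :: vs) le1.
    apply: near_eq_is_derive (derivableP (df vs v p le1 Dp)).
    by apply: filterS (open_nbhs_nbhs (conj (open_interior D) Dp)) => q Dq; rewrite HE.
  by split; exact: D1.
case: n => [|n] le; first by split.
split => //; exists (H [:: (1, 0)]), (H [:: (0, 1)]).
split; [by apply: main; rewrite addn1|by apply: main; rewrite addn1|move=> p Dp].
have le1 : le_order 1 r by apply: leW le.
have D1 v : is_derive p v f (H [:: v] p).
  have [_ ->//] := HP [:: v] le1.
  exact: derivableP (df [::] v p le1 Dp).
by split; exact: D1.
Qed.

(* G vs is the extension to D of the iterated derivative along vs. *)
Lemma Cplane_ext {E} n D (C : set (R * R)) (f : R * R -> E) : fat D -> closed C ->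
  (forall p, D p -> ~ C p -> f p = 0) -> Cplane n D f ->
  exists G : seq (R * R) -> R * R -> E,
  [/\ forall p, G [::] p = f p,
      forall vs p, (size vs <= n)%N -> interior D p -> G vs p = iter_derive f vs p,
      forall vs, (size vs <= n)%N -> iter_derivable f (interior D) vs,
      forall vs p, (size vs <= n)%N -> D p -> ~ C p -> G vs p = 0
    & forall (Z : Type) (F : set_system Z) (y : Z -> R * R) (x : R * R)
        (ws : seq ((Z -> R * R) * (R * R))), Filter F -> D x ->
        (size ws <= n)%N -> y @ F --> within D (nbhs x) -> all_cvg F ws ->
        (fun z => G [seq w.1 z | w <- ws] (y z)) @ F --> G [seq w.2 | w <- ws] x].
Proof.
move=> fD cC; elim: n f => [|n IH] f f0 [fc Hf].
  exists (fun _ => f); split => //.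
  - by case.
  - by case.
  - by move=> vs p _; exact: f0.
  - move=> Z F y x ws FF Dx _ yx _.
    have /subspace_continuousP/(_ _ Dx) fx := fc.
    exact: cvg_comp yx fx.
move: Hf => [f1 [f2 [F1 F2 F3]]].
(* As [C] is closed, [f] vanishes in a whole neighbourhood of each interior point off [C], hence so
   does its derivative; fatness carries this to the boundary. *)
have zero g b : (forall p, interior D p -> is_derive p b f (g p)) ->
    {within D, continuous g} -> forall p, D p -> ~ C p -> g p = 0.
  move=> gd gc p Dp nCp.
  apply: (@fat_continuous_eq _ _ D (~` C) g (cst 0) fD) => //.
  - exact: closed_openC.
  - by apply: continuous_subspaceW gc => q [].
  - by apply: continuous_subspaceT => q; exact: cvg_cst.
  - move=> q Dq nCq; have [_ <-] := gd q Dq.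
    rewrite (near_eq_derive _ (g := cst 0)) ?derive_cst//.
    have := open_nbhs_nbhs (conj (closed_openC cC) nCq).
    have := open_nbhs_nbhs (conj (open_interior D) Dq).
    apply: filterS2 => q' Dq' nCq'; apply: f0 => //; exact: interior_subset.
have z1 := zero f1 (1, 0) (fun p Dp => (F3 p Dp).1) (Cplane_continuous F1).
have z2 := zero f2 (0, 1) (fun p Dp => (F3 p Dp).2) (Cplane_continuous F2).
have [G1 [_ E1 I1 Z1 c1]] := IH f1 z1 F1.
have [G2 [_ E2 I2 Z2 c2]] := IH f2 z2 F2.
have oD := open_interior D.
have DV p v : interior D p -> is_derive p v f (v.1 *: f1 p + v.2 *: f2 p).
  move=> Dp; apply: derive_pair.
  - by apply: filterS (open_nbhs_nbhs (conj oD Dp)) => q /F3[].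
  - by apply: filterS (open_nbhs_nbhs (conj oD Dp)) => q /F3[].
  - have /subspace_continuousP/(_ _ (interior_subset Dp)) := Cplane_continuous F1.
    by rewrite within_interior.
  - have /subspace_continuousP/(_ _ (interior_subset Dp)) := Cplane_continuous F2.
    by rewrite within_interior.
(* The last entry of [vs] is the innermost direction. It is resolved into axis components first,
   after which the remaining directions act on [f1] and [f2], which the induction hypothesis
   covers. *)
pose G vs p := if rev vs is v :: us then
  v.1 *: G1 (rev us) p + v.2 *: G2 (rev us) p else f p.
have Grcons vs v p : G (rcons vs v) p = v.1 *: G1 vs p + v.2 *: G2 vs p.
  by rewrite /G rev_rcons revK.
have lin vs v : (size vs <= n)%N ->
    iter_derivable (fun p => v.1 *: f1 p + v.2 *: f2 p) (interior D) vs /\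
    forall p, interior D p ->
      iter_derive f (rcons vs v) p = v.1 *: iter_derive f1 vs p + v.2 *: iter_derive f2 vs p.
  move=> svs; have [L1 L2] := iter_derive_lin v.1 v.2 oD (I1 vs svs) (I2 vs svs).
  split => // p Dp; rewrite -L2// -cats1 iter_derive_cat.
  by apply: (iter_derive_eq oD) => // q Dq /=; have [_ ->] := DV q v Dq.
exists G; split.
- by [].
- move=> vs p; case: (lastP vs) => [|us v]; first by [].
  rewrite size_rcons ltnS => sus Dp; rewrite Grcons.
  by rewrite E1// E2//; have [_ ->] := lin us v sus.
- move=> vs; case: (lastP vs) => [|us v]; first by [].
  rewrite size_rcons ltnS => sus; rewrite -cats1; apply: iter_derivable_cat.
    by split => // p Dp; have [] := DV p v Dp.
  have [+ _] := lin us v sus; apply: iter_derivable_eq => // p Dp.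
  by rewrite /=; have [_ ->] := DV p v Dp.
- move=> vs p; case: (lastP vs) => [_|us v]; first by exact: f0.
  rewrite size_rcons ltnS => sus Dp nCp.
  by rewrite Grcons Z1// Z2// !scaler0 addr0.
- move=> Z F y x ws FF Dx; case: (lastP ws) => [|us w] sws yx.
    have /subspace_continuousP/(_ _ Dx) fx := fc.
    by move=> _; exact: cvg_comp yx fx.
  rewrite -cats1 => /all_cvg_cat[cus [cw _]].
  rewrite size_rcons ltnS in sws.
  rewrite cats1 map_rcons Grcons.
  have -> : (fun z => G [seq w.1 z | w <- rcons us w] (y z)) = 
    (fun z => (w.1 z).1 *: G1 [seq w.1 z | w <- us] (y z)) \+
    (fun z => (w.1 z).2 *: G2 [seq w.1 z | w <- us] (y z)).
    by apply/funext => z; rewrite map_rcons Grcons.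
  apply: cvgD; apply: cvgZ.
  + by apply: cvg_comp cw _; exact: cvg_fst.
  + exact: c1.
  + by apply: cvg_comp cw _; exact: cvg_snd.
  + exact: c2.
Qed.

End extension_of_derivatives.

(** * Mixed derivatives of parametrized maps *)

Section mixed.
Context {R : realType}.
Implicit Types (X Y E F H : normedModType R).

Lemma Crs_on_eq {X Y F} r s (D : set (X * Y)) (f g : X * Y -> F) :
  (forall p, D p -> f p = g p) -> Crs_on r s D f -> Crs_on r s D g.
Proof.
move=> fg [c d1 d2 d3]; have oD := open_interior D.
have fg' p : interior D p -> f p = g p by move/interior_subset; exact: fg.
have E := iter_derive_eq oD fg'.
have nE vs p : interior D p -> \forall q \near p, iter_derive f vs q = iter_derive g vs q.
  by move=> Dp; apply: filterS (open_nbhs_nbhs (conj oD Dp)); exact: E.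
split.
- by apply: subspace_eq_continuous c => p /set_mem; exact: fg.
- by move=> xs x p le Dp; apply: near_eq_derivable (nE _ _ Dp) _; exact: d1.
- by move=> xs ys y p le le' Dp; apply: near_eq_derivable (nE _ _ Dp) _; exact: d2.
- move=> i j le le'; have [h [hc hE]] := d3 i j le le'; exists h; split => // p v w Dp.
  by rewrite hE// E.
Qed.

Lemma Crs_on_iter_derivable {X Y F} r s (D : set (X * Y)) (f : X * Y -> F) xs ys :
  Crs_on r s D f -> le_order (size xs) r -> le_order (size ys) s ->
  iter_derivable f (interior D) (mixed_dirs xs ys).
Proof.
have leW i q : le_order i.+1 q -> le_order i q.
  by case: q => //= m; exact: ltnW.
move=> [_ d1 d2 _] lex; elim: ys => [|y ys IH] ley.
  elim: xs lex => [|x xs IH] lex //=; split; first by apply: IH; exact: leW.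
  by move=> p Dp; exact: d1.
by split; [apply: IH; exact: leW|move=> p Dp; exact: d2].
Qed.

Lemma Crs_onD {X Y F} r s (D : set (X * Y)) (f g : X * Y -> F) :
  Crs_on r s D f -> Crs_on r s D g -> Crs_on r s D (fun p => f p + g p).
Proof.
move=> Hf Hg; have oD := open_interior D.
suff : Crs_on r s D (fun p => 1 *: f p + 1 *: g p).
  by apply: Crs_on_eq => p _; rewrite !scale1r.
have L xs ys : le_order (size xs) r -> le_order (size ys) s ->
    iter_derivable (fun p => 1 *: f p + 1 *: g p) (interior D) (mixed_dirs xs ys) /\
    forall x, interior D x ->
      iter_derive (fun p => 1 *: f p + 1 *: g p) (mixed_dirs xs ys) x =
      1 *: iter_derive f (mixed_dirs xs ys) x + 1 *: iter_derive g (mixed_dirs xs ys) x.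
  move=> lex ley; apply: iter_derive_lin => //.
    exact: Crs_on_iter_derivable Hf lex ley.
  exact: Crs_on_iter_derivable Hg lex ley.
split.
- apply/subspace_continuousP => p Dp; apply: cvgD; apply: cvgZl_tmp.
    by case: Hf => /subspace_continuousP + _ _ _; apply.
  by case: Hg => /subspace_continuousP + _ _ _; apply.
- move=> xs x p le Dp; have les : le_order 0 s by case: (s).
  by have [[_ H] _] := L (x :: xs) [::] le les; exact: H.
- move=> xs ys y p le le' Dp.
  by have [[_ H] _] := L xs (y :: ys) le le'; exact: H.
move=> i j le le'.
have [_ _ _ /(_ i j le le')[h [hc hE]]] := Hf.
have [_ _ _ /(_ i j le le')[k [kc kE]]] := Hg.
exists (fun q => 1 *: h q + 1 *: k q); split.
  apply/subspace_continuousP => p Dp; apply: cvgD; apply: cvgZl_tmp.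
    by move/subspace_continuousP : hc; apply.
  by move/subspace_continuousP : kc; apply.
move=> p v w Dp; rewrite hE// kE//.
by have [|| _ ->//] := L (codom v) (codom w); rewrite ?size_codom ?card_ord.
Qed.

Lemma Crs_on0 {X Y F} r s (D : set (X * Y)) : Crs_on r s D (fun=> 0 : F).
Proof.
have E vs : iter_derive (fun _ : X * Y => 0 : F) vs = cst 0.
  by apply/funext => x; exact: iter_derive0.
split.
- by apply: continuous_subspaceT => q; exact: cvg_cst.
- by move=> *; rewrite E; exact: derivable_cst.
- by move=> *; rewrite E; exact: derivable_cst.
- move=> i j _ _; exists (cst 0); split.
    by apply: continuous_subspaceT => q; exact: cvg_cst.
  by move=> *; rewrite E.
Qed.

Lemma Crs_on_sum {X Y F} r s (D : set (X * Y)) (I : Type) (l : seq I)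
    (f : I -> X * Y -> F) :
  (forall i, Crs_on r s D (f i)) -> Crs_on r s D (fun p => \sum_(i <- l) f i p).
Proof.
move=> Hf; elim: l => [|i l IH].
  by apply: Crs_on_eq (Crs_on0 _ _ _) => p _; rewrite big_nil.
by apply: Crs_on_eq (Crs_onD (Hf i) IH) => p _; rewrite big_cons.
Qed.

Lemma is_derive_linear {X E F} (L : E -> F) (f : X -> E) x v df :
  linear L -> continuous L -> is_derive x v f df ->
  is_derive x v (L \o f) (L df).
Proof.
move=> lL cL [fd <-]; have LZ a e : L (a *: e) = a *: L e.
  have L0 : L 0 = 0.
    by have := lL (-1) 0 0; rewrite scaler0 scaleN1r !addr0 addNr => ->.
  by have := lL a e 0; rewrite L0 !addr0.
have LB e e' : L (e - e') = L e - L e'.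
  by have := lL (-1) e' e; rewrite !scaleN1r => H; rewrite addrC H addrC.
suff cv : (fun h => h^-1 *: (((L \o f) \o shift x) (h *: v) - (L \o f) x)) @ 0^' -->
    L ('D_v f x).
  by apply: DeriveDef; [apply/cvg_ex; eexists; exact: cv|exact: cvg_lim cv].
have -> : (fun h => h^-1 *: (((L \o f) \o shift x) (h *: v) - (L \o f) x)) =
    L \o (fun h => h^-1 *: ((f \o shift x) (h *: v) - f x)).
  by apply/funext => h /=; rewrite LZ LB.
apply: (cvg_comp _ L _ (cL _)).
exact: fd.
Qed.

End mixed.

(** * Products of a function of the parameters with a function of the point *)

Section product_term.
Context {R : realType}.

(* At each point of S, either f vanishes nearby or h is smooth nearby: the values
   of h off O are irrelevant. *)
Lemma Crs_on_bilinear {Y H E K : normedModType R} (B : H -> E -> K) (r : option nat)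
    (D C : set (R * R)) (f : R * R -> E) (O : set Y) (h : Y -> H)
    (S : set ((R * R) * Y)) :
  (forall e, linear (B^~ e)) -> (forall a, linear (B a)) ->
  continuous (fun q : H * E => B q.1 q.2) ->
  fat D -> closed C -> (forall x, D x -> ~ C x -> f x = 0) ->
  (forall n, le_order n r -> Cplane n D f) ->
  open O -> smooth_at_all O h ->
  (forall p, S p -> D p.1 /\ (C p.1 -> O p.2)) ->
  Crs_on r None S (fun p => B (h p.2) (f p.1)).
Proof.
move=> Bl Br Bc fD cC f0 Cf oO Sh SD.
have B0 a : B a 0 = 0.
  by have := Br a (-1) 0 0; rewrite scaler0 scaleN1r !addr0 addNr => ->.
have cl e : continuous (B^~ e).
  move=> a; apply: (cvg_comp (fun a => (a, e)) (fun q => B q.1 q.2) _ (Bc (a, e))).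
  by apply: cvg_pair_point; [exact: cvg_id|exact: cvg_cst].
have cr a : continuous (B a).
  move=> e; apply: (cvg_comp (fun e => (a, e)) (fun q => B q.1 q.2) _ (Bc (a, e))).
  by apply: cvg_pair_point; [exact: cvg_cst|exact: cvg_id].
have oS := open_interior S.
have SD' p : interior S p -> interior D p.1.
  move=> Sp.
  have n : \forall x \near p.1, S (x, p.2).
    have : (fun x => (x, p.2)) @ nbhs p.1 --> (p.1, p.2).
      by apply: cvg_pair_point; [exact: cvg_id|exact: cvg_cst].
    by rewrite -surjective_pairing; apply.
  by apply: filterS n => x /SD[].
pose T (p : (R * R) * Y) := B (h p.2) (f p.1).
(* Directions [(x, 0)] act on [f] alone and directions [(0, y)] on [h] alone, so no Leibniz sum
   arises. *)
have formula n xs ys : Cplane n D f -> (size xs <= n)%N ->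
    iter_derivable T (interior S) (mixed_dirs xs ys) /\
    forall p, interior S p -> iter_derive T (mixed_dirs xs ys) p =
      B (iter_derive h ys p.2) (iter_derive f xs p.1).
  move=> /(Cplane_ext fD cC f0)[G [G0 E1 I1 Z1 _]]; elim: ys => [|w ys IH] sxs.
    elim: xs sxs => [|v xs IH] sxs; first by split.
    have [IH1 IH2] := IH (ltnW sxs).
    have D1 p : interior S p -> is_derive p (v, 0) (iter_derive T (mixed_dirs xs [::]))
        (B (h p.2) (iter_derive f (v :: xs) p.1)).
      move=> Sp; apply: (@near_eq_is_derive _ _ _
          (fun p => B (h p.2) (iter_derive f xs p.1))).
        by apply: filterS (open_nbhs_nbhs (conj oS Sp)) => q Sq; rewrite IH2.
      have [_ dF] := I1 (v :: xs) sxs.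
      have /is_deriveP d := is_derive_linear (Br (h p.2)) (cr (h p.2))
         (derivableP (dF p.1 (SD' _ Sp))).
      apply/is_deriveP => e /d; apply: filterS => k /=.
      by rewrite scaler0 add0r.
    split; last by move=> p /D1[].
    by split => // p /D1[].
  have [IH1 IH2] := IH sxs.
  have D1 p : interior S p -> is_derive p (0, w) (iter_derive T (mixed_dirs xs ys))
        (B (iter_derive h (w :: ys) p.2) (iter_derive f xs p.1)).
    move=> Sp; apply: (@near_eq_is_derive _ _ _
        (fun p => B (iter_derive h ys p.2) (iter_derive f xs p.1))).
      by apply: filterS (open_nbhs_nbhs (conj oS Sp)) => q Sq; rewrite IH2.
    have [Cp|nCp] := pselect (C p.1).
      have [_ /(_ Cp) Op] := SD p (interior_subset Sp).
      have dh : derivable (iter_derive h ys) p.2 w by exact: (proj1 Sh).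
      have /is_deriveP d := is_derive_linear (Bl (iter_derive f xs p.1))
         (cl (iter_derive f xs p.1)) (derivableP dh).
      apply/is_deriveP => e /d; apply: filterS => k /=.
      by rewrite scaler0 add0r.
    (* Here [h] need not be differentiable. Moving along [(0, w)] leaves [p.1] fixed, so the product
       stays 0 whatever the values of [h]. *)
    have z : iter_derive f xs p.1 = 0.
      by rewrite -E1//; [apply: Z1 => //; apply: interior_subset|]; exact: SD'.
    apply/is_deriveP => e e0; near=> k.
    rewrite /= scaler0 add0r z !B0 subrr scaler0 subr0 normr0.
    exact: mulr_ge0 (ltW e0) (normr_ge0 _).
  split; last by move=> p /D1[].
  by split => // p /D1[].
(* At boundary points of [S] the iterated derivatives of [f] are replaced by their extension [G].
   Continuity is a dichotomy: over [C] both factors converge, and off [C] the product is identically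
   0 nearby. *)
have joint n : Cplane n D f -> exists G : seq (R * R) -> R * R -> E,
  [/\ forall p, G [::] p = f p,
   forall vs p, (size vs <= n)%N -> interior D p -> G vs p = iter_derive f vs p &
   forall (Z : Type) (F : set_system Z) (q : Z -> (R * R) * Y) (p : (R * R) * Y)
     (ws : seq ((Z -> R * R) * (R * R))) (us : seq ((Z -> Y) * Y)),
     Filter F -> S p -> (size ws <= n)%N -> q @ F --> within S (nbhs p) ->
     all_cvg F ws -> all_cvg F us ->
     (fun z => B (iter_derive h [seq u.1 z | u <- us] (q z).2)
                 (G [seq w.1 z | w <- ws] (q z).1)) @ F -->
     B (iter_derive h [seq u.2 | u <- us] p.2) (G [seq w.2 | w <- ws] p.1)].
  move=> /(Cplane_ext fD cC f0)[G [G0 E1 I1 Z1 c1]]; exists G; split => //.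
  move=> Z F q p ws us FF Sp sws qp wsc usc.
  have [Dp CO] := SD p Sp.
  have qp' : q @ F --> p by apply: cvg_trans qp _; exact: cvg_within.
  have nS : \forall z \near F, S (q z).
    apply: (qp S); change (\forall x \near p, S x -> S x). exact: filterE.
  have q1 : (fun z => (q z).1) @ F --> within D (nbhs p.1).
    move=> V HV; have {}HV : \forall x \near p.1, D x -> V x := HV.
    have n1 : \forall z \near F, D (q z).1 -> V (q z).1.
      by apply: (qp' (fun p => D p.1 -> V p.1)); exact: (cvg_fst HV).
    change (\forall z \near F, V (q z).1).
    by apply: filterS2 n1 nS => z Hz /SD[Dz _]; exact: Hz.
  have q2 : (fun z => (q z).2) @ F --> p.2.
    by apply: cvg_comp qp' _; exact: cvg_snd.
  have [Cp|nCp] := pselect (C p.1).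
    apply: (@cvg_comp _ _ _ (fun z => (iter_derive h [seq u.1 z | u <- us] (q z).2,
      G [seq w.1 z | w <- ws] (q z).1)) (fun q => B q.1 q.2) _ _ _ _ (Bc (_, _))).
    apply: cvg_pair_point; last exact: c1.
    exact: (proj2 Sh) (CO Cp) q2 usc.
  rewrite (Z1 [seq w.2 | w <- ws]) ?size_map// B0.
  apply: cvg_near_cst.
  have nC : \forall z \near F, ~ C (q z).1.
    have nCp' : \forall x \near p.1, ~ C x.
      exact: (open_nbhs_nbhs (conj (closed_openC cC) nCp)).
    by apply: (qp' (fun p => ~ C p.1)); exact: (cvg_fst nCp').
  by apply: filterS2 nS nC => z /SD[Dz _] nCz; rewrite Z1 ?size_map.
split.
- apply/subspace_continuousP => p Sp.
  have r0 : le_order 0 r by case: (r).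
  have [G [G0 _ c]] := joint 0%N (Cf _ r0).
  have := c _ (within S (nbhs p)) id p [::] [::] _ Sp isT _ I I.
  rewrite /= G0 => /(_ _ (@cvg_id _ _)).
  by apply: cvg_trans; apply: near_eq_cvg; apply: nearW => z /=; rewrite G0.
- move=> xs x p le Sp.
  by have [[_ Hd] _] := formula _ (x :: xs) [::] (Cf _ le) (leqnn _); exact: Hd.
- move=> xs ys y p le _ Sp.
  by have [[_ Hd] _] := formula _ xs (y :: ys) (Cf _ le) (leqnn _); exact: Hd.
move=> i j le _; have [G [_ E1 c]] := joint i (Cf _ le).
exists (fun q => B (iter_derive h (codom q.2.2) q.1.2) (G (codom q.2.1) q.1.1)).
split; last first.
  move=> p v w Sp /=.
  have sv : (size (codom v) <= i)%N by rewrite size_codom card_ord.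
  have [_ HF] := formula i (codom v) (codom w) (Cf _ le) sv.
  by rewrite HF// E1//; exact: SD'.
apply/subspace_continuousP => -[p [v0 w0]] [/= Sp _].
pose Z := (((R * R) * Y) * ({ptws 'I_i -> (R * R)%type} * {ptws 'I_j -> Y}))%type.
pose ws := [seq ((fun z : Z => z.2.1 k), v0 k) | k <- enum 'I_i].
pose us := [seq ((fun z : Z => z.2.2 k), w0 k) | k <- enum 'I_j].
have nb : (@snd _ _ : Z -> _) @ within (S `*` setT) (nbhs (p, (v0, w0))) --> (v0, w0).
  by apply: cvg_within_filter; exact: cvg_snd.
have := c Z (within (S `*` setT) (nbhs (p, (v0, w0)))) fst p ws us _ Sp.
rewrite size_map size_enum_ord => /(_ _ (leqnn _)).
have -> : [seq w.2 | w <- ws] = codom v0 by rewrite -map_comp codomE.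
have -> : [seq w.2 | w <- us] = codom w0 by rewrite -map_comp codomE.
have -> : (fun z : Z => B (iter_derive h [seq u.1 z | u <- us] z.1.2)
                 (G [seq w.1 z | w <- ws] z.1.1)) =
   (fun q : Z => B (iter_derive h (codom q.2.2) q.1.2) (G (codom q.2.1) q.1.1)).
  by apply/funext => z; congr (B (iter_derive h _ _) (G _ _)); rewrite codomE -map_comp.
apply.
- move=> V HV; have {}HV : \forall x \near p, S x -> V x := HV.
  change (\forall z \near (p, (v0, w0)), (S `*` setT) z -> V z.1).
  have : \forall z \near (p, (v0, w0)), S z.1 -> V z.1 by exact: (cvg_fst HV).
  by apply: filterS => z Hz [Sz _]; exact: Hz.
- rewrite /ws; elim: (enum 'I_i) => //= k s IH; split => //.
  have n1 : (fun z : Z => z.2.1) @ within (S `*` setT) (nbhs (p, (v0, w0))) --> v0.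
    by apply: cvg_comp nb _; exact: cvg_fst.
  exact: (cvg_comp _ _ n1 (@eval_ptws_cvg _ _ _ k v0)).
- rewrite /us; elim: (enum 'I_j) => //= k s IH; split => //.
  have n1 : (fun z : Z => z.2.2) @ within (S `*` setT) (nbhs (p, (v0, w0))) --> w0.
    by apply: cvg_comp nb _; exact: cvg_snd.
  exact: (cvg_comp _ _ n1 (@eval_ptws_cvg _ _ _ k w0)).
Unshelve. all: by end_near. Qed.

End product_term.

(** * A smooth step function *)

Section smooth_step.
Context {R : realType}.

(* The family x^-m exp (-1/x) is stable under differentiation, so that its
   smoothness at 0 follows from its continuity there by induction. *)
Definition flat (m : nat) (x : R) : R :=
  if 0 < x then x ^- m * expR (- x^-1) else 0.

(** The exponential series gives exp (1/x) >= x^-k / k! with [k = m.+2]. The two powers beyond [m]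
    leave a quadratic bound, which is what makes the derivative at 0 vanish. *)
Lemma flat_le (m : nat) (x : R) : 0 < x -> flat m x <= m.+2`!%:R * x ^+ 2.
Proof.
move=> x0; rewrite /flat x0; set k := m.+2.
have f0 : (0 : R) < k`!%:R by rewrite ltr0n fact_gt0.
have H : x ^- k / k`!%:R <= expR (x^-1).
  apply: le_trans (expR_ge1Dxn m.+1 _); last by rewrite invr_ge0 ltW.
  by rewrite exprVn lerDr.
have p0 : 0 < x ^- k / k`!%:R by rewrite divr_gt0// invr_gt0 exprn_gt0.
rewrite expRN; apply: (@le_trans _ _ (x ^- m * (x ^- k / k`!%:R)^-1)).
  apply: ler_wpM2l; first by rewrite invr_ge0 exprn_ge0// ltW.
  by rewrite lef_pV2// posrE ?expR_gt0.
rewrite invfM !invrK mulrA [leRHS]mulrC; apply: ler_wpM2r; first exact: ltW.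
by rewrite /k -addn2 exprD mulrA mulVf ?mul1r// expf_neq0// gt_eqF.
Qed.

Lemma is_derive_flat (m : nat) (x : R) :
  is_derive x 1 (flat m) (- m%:R * flat m.+1 x + flat m.+2 x).
Proof.
have [x0|x0|->] := ltgtP x 0.
- have near0 : \forall y \near x, (fun=> 0) y = flat m y.
    near=> y; rewrite /flat ifN// -leNgt ltW//; near: y; exact: lt_nbhsl.
  apply: near_eq_is_derive near0 _.
  rewrite /flat !ifN -?leNgt ?ltW// mulr0 addr0; exact: is_derive_cst.
- have near0 : \forall y \near x, y ^- m * expR (- y^-1) = flat m y.
    near=> y; rewrite /flat ifT//; near: y; exact: lt_nbhsr.
  apply: near_eq_is_derive near0 _.
  have xn0 : x != 0 by rewrite gt_eqF.
  rewrite /flat x0.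
  have di : is_derive x 1 (fun y : R => y^-1) (- x ^- 2).
    by apply: is_derive_eq (is_deriveV xn0 (is_derive_id x 1)) _; rewrite [_ *: _]mulr1.
  have de : is_derive x 1 (fun y : R => expR (- y^-1)) (expR (- x^-1) * x ^- 2).
    have := @is_derive1_comp _ expR (fun y => - y^-1) x _ _ (is_derive_expR (- x^-1)) (is_deriveN di).
    by rewrite opprK.
  have dm : is_derive x 1 (fun y : R => y ^- m) (- m%:R * x ^- m.+1).
    case: (m) => [|k].
      by rewrite oppr0 mul0r; under eq_fun do rewrite expr0 invr1; exact: is_derive_cst.
    have := is_deriveX k.+1 di; rewrite (_ : (fun y : R => y^-1) ^+ k.+1 = fun y => y ^- k.+1).
      move=> H; apply: (is_derive_eq H); rewrite /= [_ *: _]mulrN mulNr exprVn -mulrA -invfM.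
      by rewrite -exprD addn2.
    by apply/funext => y; rewrite exprfctE exprVn.
  apply: (is_derive_eq (is_deriveM dm de)); 
  rewrite -[LHS]/(x ^- m * (expR (- x^-1) * x ^- 2) +
    expR (- x^-1) * (- m%:R * x ^- m.+1)).
  rewrite addrC; congr (_ + _); first by rewrite mulrC -mulrA.
  by rewrite mulrCA -invfM -exprD addn2 mulrC.
rewrite /flat ltxx mulr0 addr0; apply/is_deriveP => e e0.
set K : R := m.+2`!%:R.
have K0 : 0 < K by rewrite ltr0n fact_gt0.
near=> h; rewrite /= [h *: 1]mulr1 addr0 ltxx scaler0 !subr0.
have [h0|h0] := ltP 0 h; last by rewrite normr0 mulr_ge0// ltW.
have := flat_le m h0; rewrite /flat h0 -/K => le.
rewrite ger0_norm ?mulr_ge0 ?invr_ge0 ?exprn_ge0 ?expR_ge0 ?(ltW h0)//.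
apply: le_trans le _; rewrite expr2 mulrA gtr0_norm//; apply: ler_wpM2r; first exact: ltW.
rewrite mulrC -ler_pdivlMr// (le_trans (ler_norm _))//; near: h.
exact: (@nbhs0_le R R _ (divr_gt0 e0 K0)).
Unshelve. all: by end_near. Qed.

Lemma Cplane_flat (m n : nat) D (a b c : R) :
  Cplane n D (fun p : R * R => flat m (a * p.1 + b * p.2 + c)).
Proof.
pose l (p : R * R) : R := a * p.1 + b * p.2 + c.
have lc : continuous l.
  move=> p; apply: cvgD; last exact: cvg_cst.
  by apply: cvgD; apply: cvgMl_tmp; [exact: cvg_fst|exact: cvg_snd].
apply: (@Cplane_sub _ _ _ setT) => //.
elim: n m => [|n IH] m; split => //.
- apply: continuous_subspaceT => p; apply: (cvg_comp l (flat m) (lc p)).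
  exact: is_derive1_cvg (is_derive_flat m _).
- apply: continuous_subspaceT => p; apply: (cvg_comp l (flat m) (lc p)).
  exact: is_derive1_cvg (is_derive_flat m _).
pose d p := (- m%:R) *: flat m.+1 (l p) + flat m.+2 (l p).
have dC : Cplane n setT d.
  by apply: CplaneD; [apply: (CplaneZ (Cplane_cst n _ (- m%:R : R)))|]; exact: IH.
exists (fun p => a *: d p), (fun p => b *: d p); split.
- exact: (CplaneZ (Cplane_cst n _ a)).
- exact: (CplaneZ (Cplane_cst n _ b)).
have key w k p : (forall h, l (h *: w + p) = h *: (k *: 1) + l p) ->
    is_derive p w (fun p : R * R => flat m (l p)) (k *: d p).
  move=> lh; have /is_deriveP H := is_deriveZdir k (is_derive_flat m (l p)).
  by apply/is_deriveP => e /H; apply: filterS => h; rewrite lh.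
move=> p _; split; apply: key => h; rewrite /l /=.
  rewrite scaler0 add0r ![_ *: 1]mulr1 [in RHS]/GRing.scale/= mulrDr -!addrA.
  by rewrite [h * a]mulrC.
rewrite scaler0 add0r ![_ *: 1]mulr1 [in RHS]/GRing.scale/= mulrDr.
by rewrite [h * b]mulrC; ring.
Qed.

Definition step (x : R) : R := flat 0 x / (flat 0 x + flat 0 (1 - x)).

Lemma flat_ge0 x : 0 <= flat 0 x.
Proof. by rewrite /flat; case: ifP => // _; rewrite mulr_ge0// ?expR_ge0// invr_ge0 expr0. Qed.

Lemma flat_gt0 x : 0 < x -> 0 < flat 0 x.
Proof. by rewrite /flat => ->; rewrite expr0 invr1 mul1r expR_gt0. Qed.

Lemma step_den_gt0 x : 0 < flat 0 x + flat 0 (1 - x).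
Proof.
have [x0|x0] := ltP 0 x.
  by rewrite ltr_pwDl ?flat_gt0 ?flat_ge0.
by rewrite ltr_wpDl ?flat_ge0// flat_gt0// subr_gt0; lra.
Qed.

Lemma step_le0 x : x <= 0 -> step x = 0.
Proof. by move=> x0; rewrite /step {1}/flat ltNge x0 mul0r. Qed.

Lemma step_ge1 x : 1 <= x -> step x = 1.
Proof.
move=> x1; rewrite /step {3}/flat ifN ?addr0 ?divff//; last by rewrite -leNgt subr_le0.
by rewrite gt_eqF// flat_gt0; lra.
Qed.

Lemma Cplane_step n D (a b c : R) :
  Cplane n D (fun p : R * R => step (a * p.1 + b * p.2 + c)).
Proof.
have Cplane_flat' : Cplane n D (fun p : R * R => flat 0 (1 - (a * p.1 + b * p.2 + c))).
  apply: Cplane_eq (Cplane_flat 0 n D (- a) (- b) (1 - c)) => p _.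
  by congr (flat 0 _); ring.
apply: (CplaneZ (Cplane_flat 0 n D a b c)); apply: CplaneV.
  by move=> p _; rewrite gt_eqF// step_den_gt0.
exact: CplaneD (Cplane_flat _ _ _ _ _ _) Cplane_flat'.
Qed.

End smooth_step.

(** * Extension across the boundary by reflection *)

Section seeley_weights.
Context {R : realType}.

(** The nodes -1, ..., -(N+1) are distinct, so their Vandermonde matrix is invertible and [w] solves
    the system whose right-hand side is the last unit vector. *)
Lemma dual_weights (N : nat) : exists w : nat -> R, forall m, (m <= N)%N ->
  \sum_(j < N.+1) w j * (- (j.+1)%:R) ^+ m = (m == N)%:R.
Proof.
pose a : 'rV[R]_N.+1 := \row_j - (j.+1)%:R.
have U : Vandermonde N.+1 a \in unitmx.
  rewrite unitmxE det_Vandermonde unitfE; apply/prodf_neq0 => i _.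
  apply/prodf_neq0 => j ij; rewrite !mxE subr_eq0 eqr_opp eqr_nat.
  by rewrite eqSS gt_eqF.
pose w := invmx (Vandermonde N.+1 a) *m (delta_mx ord_max 0 : 'cV_N.+1).
exists (fun j => w (inord j) 0) => m mN.
have : (Vandermonde N.+1 a *m w) (inord m) 0 = (m == N)%:R.
  rewrite mulKVmx// mxE eqxx andbT -val_eqE /= inordK//.
move=> <-; rewrite !mxE; apply: eq_bigr => j _.
by rewrite !mxE inord_val inordK// mulrC.
Qed.

Lemma seeley_block (N : nat) (e : R) : exists ab : (nat -> R) * (nat -> R),
  [/\ forall j, N.+1%:R <= ab.2 j,
      forall m, (m < N)%N -> \sum_(j < N.+1) `|ab.1 j| * ab.2 j ^+ m <= 2^-1 ^+ N,
      forall m, (m < N)%N -> \sum_(j < N.+1) ab.1 j * (- ab.2 j) ^+ m = 0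
    & \sum_(j < N.+1) ab.1 j * (- ab.2 j) ^+ N = e].
Proof.
(* Multiplying the nodes by l and the weights by l^-N preserves the N-th moment
   and makes the lower absolute moments small for large l. *)
have [w wE] := dual_weights N.
pose c := \sum_(j < N.+1) `|w j| * (j.+1)%:R ^+ N.
have c0 : 0 <= c by apply: sumr_ge0 => j _; rewrite mulr_ge0// exprn_ge0.
(* The first summand makes all nodes at least N + 1. The second makes [|e| * c / l] at most 2^-N,
   which bounds the lower absolute moments. *)
pose l := N.+1%:R + `|e| * c * 2 ^+ N : R.
have l1 : 1 <= l.
  by rewrite -[1]addr0 lerD ?ler1n// mulr_ge0 ?exprn_ge0// mulr_ge0.
have l0 : 0 < l by exact: lt_le_trans l1.
exists (fun j => e * l ^- N * w j, fun j => l * j.+1%:R) => /=; split.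
- move=> j; apply: (@le_trans _ _ (l * 1)).
    by rewrite mulr1 lerDl mulr_ge0 ?exprn_ge0// mulr_ge0.
  by rewrite ler_wpM2l ?ler1n// ltW.
- move=> m mN; apply: (@le_trans _ _ (\sum_(j < N.+1) `|e| * l^-1 * (`|w j| * j.+1%:R ^+ N))).
    apply: ler_sum => j _; rewrite !normrM exprMn.
    have -> : `|e| * `|l ^- N| * `|w j| * (l ^+ m * j.+1%:R ^+ m) =
       (`|e| * (`|l ^- N| * l ^+ m)) * (`|w j| * j.+1%:R ^+ m).
      by rewrite mulrACA; congr (_ * _); rewrite mulrA.
    rewrite [`|l ^- N|]ger0_norm ?invr_ge0 ?exprn_ge0 ?(ltW l0)//.
    apply: ler_pM.
    + by rewrite !mulr_ge0// ?invr_ge0 ?exprn_ge0 ?(ltW l0).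
    + by rewrite mulr_ge0// exprn_ge0.
    + apply: ler_wpM2l => //.
      rewrite ler_pdivrMl ?exprn_gt0// -(ltn_predK mN) exprS mulrAC mulfV ?gt_eqF//.
      by rewrite mul1r ler_weXn2l// -ltnS (ltn_predK mN).
    + by rewrite ler_wpM2l// ler_weXn2l// ?ler1n// ltnW.
  rewrite -mulr_sumr -/c mulrAC ler_pdivrMr// exprVn ler_pdivlMl ?exprn_gt0//.
  by rewrite mulrC /l lerDr.
- move=> m mN.
  rewrite (_ : \sum_(_ < _) _ = e * l ^- N * l ^+ m *
      \sum_(j < N.+1) w j * (- j.+1%:R) ^+ m).
    by rewrite (wE m (ltnW mN)) (ltn_eqF mN) mulr0.
  by rewrite mulr_sumr; apply: eq_bigr => j _; rewrite -mulrN exprMn mulrACA.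
- rewrite (_ : \sum_(_ < _) _ = e * l ^- N * l ^+ N *
      \sum_(j < N.+1) w j * (- j.+1%:R) ^+ N).
    by rewrite (wE N (leqnn N)) eqxx mulr1 divfK// expf_neq0// gt_eqF.
  by rewrite mulr_sumr; apply: eq_bigr => j _; rewrite -mulrN exprMn mulrACA.
Qed.

(** Block N corrects the N-th moment without disturbing the lower ones, so the m-th moment is
    exactly 1 after [m.+1] blocks and remains so. Working in blocks keeps the moment identities
    finite sums, and the absolute moments of the later blocks decay geometrically. *)
Lemma seeley_weights : exists a b : nat -> nat -> R,
  [/\ forall N j, N.+1%:R <= b N j,
      forall m N, (m < N)%N -> \sum_(j < N.+1) `|a N j| * b N j ^+ m <= 2^-1 ^+ N
    & forall m K, (m < K)%N ->
        \sum_(N < K) \sum_(j < N.+1) a N j * (- b N j) ^+ m = 1].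
Proof.
have /choice[blk blkP] : forall q : nat * R, exists ab : (nat -> R) * (nat -> R),
  [/\ forall j, q.1.+1%:R <= ab.2 j,
      forall m, (m < q.1)%N -> \sum_(j < q.1.+1) `|ab.1 j| * ab.2 j ^+ m <= 2^-1 ^+ q.1,
      forall m, (m < q.1)%N -> \sum_(j < q.1.+1) ab.1 j * (- ab.2 j) ^+ m = 0
    & \sum_(j < q.1.+1) ab.1 j * (- ab.2 j) ^+ q.1 = q.2].
  by move=> q; exact: seeley_block.
(* r N m is what is missing from the m-th moment after the first N blocks. *)
pose mu (ab : (nat -> R) * (nat -> R)) (N m : nat) : R := \sum_(j < N.+1) ab.1 j * (- ab.2 j) ^+ m.
pose r := fix r (N : nat) : nat -> R := if N is N'.+1 then
  fun m => r N' m - mu (blk (N', r N' N')) N' m else fun=> 1.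
pose ab N := blk (N, r N N).
exists (fun N => (ab N).1), (fun N => (ab N).2); split.
- by move=> N j; have [H _ _ _] := blkP (N, r N N); exact: H.
- by move=> m N mN; have [_ H _ _] := blkP (N, r N N); exact: H.
have rE K m : r K m = 1 - \sum_(N < K) mu (ab N) N m.
  elim: K => [|K IH] /=; first by rewrite big_ord0 subr0.
  by rewrite big_ord_recr /= IH opprD addrA.
move=> m K mK; apply/esym/eqP; rewrite -subr_eq0 -rE; apply/eqP.
elim: K mK => // K IH; rewrite ltnS leq_eqVlt => /predU1P[<-|mK] /=.
  by have [_ _ _ /= H] := blkP (m, r m m); rewrite /mu H subrr.
have [_ _ H _] := blkP (K, r K K).
by rewrite IH// sub0r /mu H// oppr0.
Qed.

End seeley_weights.

Section slabs.
Context {R : realType}.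
Variables (alpha beta : R).
Hypothesis ltab : alpha < beta.

Definition strip : set (R * R) := [set p | alpha <= p.1 <= beta].
Definition upper : set (R * R) := [set p | strip p /\ 0 <= p.2].
Definition rect : set (R * R) := [set p | strip p /\ 0 <= p.2 <= 1].

Lemma fat_strip : fat strip.
Proof.
have -> : strip = [set p | alpha <= p.1 <= beta /\ setT p.2].
  by apply/seteqP; split => p; [split|case].
apply: (@fat_slab _ _ _ 0) => // t l _ _.
by rewrite interiorT.
Qed.

Lemma fat_upper : fat upper.
Proof.
apply: (@fat_slab _ _ _ 1 [set t | 0 <= t]) => // t l /= t0 /andP[l0 l1].
near=> r; apply: ltW; near: r; apply: lt_nbhsr.
have : 0 <= (1 - l) * t by rewrite mulr_ge0 ?subr_ge0.
by lra.
Unshelve. all: by end_near. Qed.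

Lemma fat_rect : fat rect.
Proof.
apply: (@fat_slab _ _ _ 2^-1 [set t | 0 <= t <= 1]) => // t l /= /andP[t0 t1] /andP[l0 l1].
have : 0 <= (1 - l) * t by rewrite mulr_ge0 ?subr_ge0.
have : 0 <= (1 - l) * (1 - t) by rewrite mulr_ge0 ?subr_ge0.
move=> h1 h2.
near=> r; apply/andP; split; apply: ltW; near: r.
  by apply: lt_nbhsr; lra.
by apply: lt_nbhsl; lra.
Unshelve. all: by end_near. Qed.

Lemma open_snd_gt (x : R) : open [set q : R * R | x < q.2].
Proof.
rewrite (_ : [set _ | _] = (@snd R R) @^-1` [set y | x < y])//.
by apply: open_comp; [move=> q _; exact: cvg_snd|exact: open_gt].
Qed.

Lemma open_snd_lt (x : R) : open [set q : R * R | q.2 < x].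
Proof.
rewrite (_ : [set _ | _] = (@snd R R) @^-1` [set y | y < x])//.
by apply: open_comp; [move=> q _; exact: cvg_snd|exact: open_lt].
Qed.

End slabs.

Section reflection.
Context {R : realType} {E : normedModType R}.
Variables (alpha beta : R) (a b : nat -> nat -> R).
Hypothesis (ltab : alpha < beta).
Hypothesis b_ge : forall N j, N.+1%:R <= b N j.
Hypothesis ab_le : forall m N, (m < N)%N ->
  \sum_(j < N.+1) `|a N j| * b N j ^+ m <= 2^-1 ^+ N.
Hypothesis ab_sum : forall m K, (m < K)%N ->
  \sum_(N < K) \sum_(j < N.+1) a N j * (- b N j) ^+ m = 1.

Local Notation strip := (strip alpha beta).
Local Notation upper := (upper alpha beta).

Let b_gt0 N j : 0 < b N j.
Proof. by apply: lt_le_trans (b_ge N j); rewrite ltr0n. Qed.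

(* With the factor (- b)^m, the t-derivative of [reflect_ext m f] is [reflect_ext
   m.+1] of the t-derivative of f. *)
Definition reflect_sum (m K : nat) (f : R * R -> E) (p : R * R) : E :=
  \sum_(N < K) \sum_(j < N.+1)
    (a N j * (- b N j) ^+ m) *: f (p.1, - b N j * p.2).

(* As b N j > N, the terms left out vanish if f vanishes for t >= 1, and the sum is
   locally finite for t < 0. *)
Definition reflect_ext (m : nat) (f : R * R -> E) (p : R * R) : E :=
  if 0 <= p.2 then f p else reflect_sum m (Num.truncn (- p.2)^-1).+1 f p.

Definition vanish_above (s : R) (f : R * R -> E) :=
  forall p, upper p -> s < p.2 -> f p = 0.

(** The truncation index in [reflect_ext] jumps with the point. As any larger number of blocks gives
    the same value, a single [K] can be used in a neighbourhood. *)
Lemma reflect_extE m f p s K : s < 1 -> vanish_above s f -> strip p ->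
  p.2 < 0 -> 1 <= K%:R * - p.2 -> reflect_ext m f p = reflect_sum m K f p.
Proof.
move=> s1 f0 Sp p0 Kp.
have E0 K1 K2 : 1 <= K1%:R * - p.2 -> (K1 <= K2)%N ->
    reflect_sum m K2 f p = reflect_sum m K1 f p.
  move=> K1p /subnKC <-; rewrite /reflect_sum big_split_ord /= [X in _ + X]big1 ?addr0//.
  move=> N _; apply: big1 => j _; rewrite f0 ?scaler0//=.
    by split => //=; rewrite mulNr -mulrN mulr_ge0 ?(ltW (b_gt0 _ _))// oppr_ge0 ltW.
  apply: lt_le_trans s1 _; apply: le_trans K1p _; rewrite mulNr -mulrN.
  rewrite ler_wpM2r ?oppr_ge0 ?(ltW p0)//; apply: le_trans (b_ge _ _).
  by rewrite ler_nat; apply: leqW; exact: leq_addr.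
rewrite /reflect_ext leNgt p0 /=; set K0 := _.+1.
have K0p : 1 <= K0%:R * - p.2.
  rewrite -ler_pdivrMr ?oppr_gt0// mul1r /K0.
  by rewrite ltW// truncnS_gt.
have [le|/ltnW le] := leqP K0 K; first by rewrite (E0 _ _ K0p le).
by rewrite (E0 _ _ Kp le).
Qed.

Lemma cvg_reflect_sum m K f p : {within upper, continuous f} -> strip p -> p.2 <= 0 ->
  reflect_sum m K f @ within [set q | strip q /\ q.2 <= 0] (nbhs p) -->
  reflect_sum m K f p.
Proof.
move=> /subspace_continuousP fc Sp p0; rewrite /reflect_sum.
apply: cvg_big => [|N _]; first exact: add_continuous.
apply: cvg_big => [|j _]; first exact: add_continuous.
apply: cvgZl_tmp.
have up (q : R * R) : strip q /\ q.2 <= 0 -> upper (shear (- b N j) 0 q).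
  move=> [Sq q0]; split => //=; rewrite addr0 mulNr -mulrN.
  by rewrite mulr_ge0 ?(ltW (b_gt0 _ _))// oppr_ge0.
have -> : (fun x : R * R => f (x.1, - b N j * x.2)) = f \o shear (- b N j) 0.
  by apply/funext => q /=; rewrite /shear addr0.
have -> : f (p.1, - b N j * p.2) = f (shear (- b N j) 0 p) by rewrite /shear addr0.
apply: (within_comp _ up); last by apply: fc; exact: up.
by apply: cvg_within_filter; exact: continuous_shear.
Qed.

(** Vanishing above [s < 1] reduces the bound to a compact rectangle. *)
Lemma upper_bounded f s : {within upper, continuous f} -> s < 1 -> vanish_above s f ->
  exists2 C : R, 0 <= C & forall p, upper p -> `|f p| <= C.
Proof.
move=> fc s1 f0; pose Q : set (R * R) := `[alpha, beta]%classic `*` `[0, 1]%classic.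
have QU : Q `<=` upper.
  by move=> [x y] [/=]; rewrite !in_itv /= => xab /andP[y0 _]; split.
have cQ : compact (f @` Q).
  apply: continuous_compact; first exact: continuous_subspaceW QU fc.
  by apply: compact_setX; exact: segment_compact.
have [M [_ HM]] := compact_bounded cQ.
exists (Num.max (M + 1) 0); first by rewrite le_max lexx orbT.
move=> p Up; have [sp|ps] := ltP s p.2; first by rewrite f0// normr0 le_max lexx orbT.
rewrite le_max (HM (M + 1)) ?ltrDl//; exists p => //.
case: Up => Sp p0; split; rewrite /= in_itv//=.
by rewrite p0 (le_trans ps) ?ltW.
Qed.

Lemma reflect_sum_tail m f C K0 K p : (forall p, upper p -> `|f p| <= C) ->
  (m < K0)%N -> strip p -> p.2 <= 0 ->
  `|reflect_sum m (K0 + K) f p - reflect_sum m K0 f p| <= C * (2 * 2^-1 ^+ K0 ).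
Proof.
move=> fC mK Sp p0.
have C0 : 0 <= C.
  by apply: le_trans (normr_ge0 _) (fC (p.1, 0) _); split => /=.
rewrite /reflect_sum big_split_ord /= addrAC subrr add0r.
(* The geometric tail is kept in telescoping form, without which the induction on [K] would not
   close. *)
suff : `|\sum_(i < K) \sum_(j < (K0 + i).+1)
    (a (K0 + i)%N j * (- b (K0 + i)%N j) ^+ m) *: f (p.1, - b (K0 + i)%N j * p.2)| <=
    C * (2 * 2^-1 ^+ K0 - 2 * 2^-1 ^+ (K0 + K)).
  move=> /le_trans; apply; rewrite ler_wpM2l// gerBl mulr_ge0// exprn_ge0// invr_ge0//.
elim: K => [|K IH]; first by rewrite big_ord0 normr0 addn0 subrr mulr0.
rewrite big_ord_recr /=; apply: le_trans (ler_normD _ _) _.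
apply: (@le_trans _ _ (C * (2 * 2^-1 ^+ K0 - 2 * 2^-1 ^+ (K0 + K)) + C * 2^-1 ^+ (K0 + K))).
  apply: lerD => //; apply: (@le_trans _ _ (\sum_(j < (K0 + K).+1) C * (`|a (K0 + K)%N j| * b (K0 + K)%N j ^+ m))).
    apply: le_trans (ler_norm_sum _ _ _) _; apply: ler_sum => j _.
    rewrite normrZ mulrC normrM normrX normrN (gtr0_norm (b_gt0 _ _)).
    rewrite ler_wpM2r ?mulr_ge0 ?exprn_ge0 ?(ltW (b_gt0 _ _))//; apply: fC.
    by split => //=; rewrite mulNr -mulrN mulr_ge0 ?(ltW (b_gt0 _ _))// oppr_ge0.
  rewrite -mulr_sumr ler_wpM2l//; apply: ab_le; exact: ltn_addr.
rewrite -mulrDr ler_wpM2l// addnS exprS.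
by set x := 2^-1 ^+ _; set y := 2^-1 ^+ _; lra.
Qed.

End reflection.

Section glue.
Context {R : realType} {E : normedModType R}.

(* A segment along (0, 1) starting on {t = 0} meets it only there; a segment along
   (1, 0) is a limit of segments in {t > 0}. *)
Lemma is_derive_glue (f f1 : R * R -> E) (p v : R * R) :
  v = (1, 0) \/ v = (0, 1) -> p.2 = 0 ->
  (\forall q \near p, {for q, continuous f}) -> {for p, continuous f1} ->
  (\forall q \near p, q.2 != 0 -> is_derive (q : R * R) v f (f1 q)) ->
  is_derive p v f (f1 p).
Proof.
move=> vE p0 cf cf1 df; apply/is_deriveP => e e0.
have /cvgrPdist_le /(_ _ e0) n1 := cf1.
have [r /= r0 Hr] : exists2 r : R, 0 < r & forall q, ball p r q ->
   [/\ {for q, continuous f}, `|f1 p - f1 q| <= e &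
     q.2 != 0 -> is_derive (q : R * R) v f (f1 q)].
  have : \forall q \near p, [/\ {for q, continuous f}, `|f1 p - f1 q| <= e &
     q.2 != 0 -> is_derive (q : R * R) v f (f1 q)].
    by near=> q; split; near: q.
  by move=> /nbhs_ballP[r /= r0 Hr]; exists r.
have inb (x y : R) : `|x| < r -> `|y| < r -> ball p r (x + p.1, y + p.2).
  by move=> xr yr; split; rewrite /ball /= opprD addrCA subrr addr0 normrN.
have small (s x : R) : 0 <= s <= 1 -> `|x| < r -> `|s * x| < r.
  move=> /andP[s0 s1]; apply: le_lt_trans.
  by rewrite normrM ger0_norm// ler_piMl.
have E1 (x y c : R) : x *: ((1, 0) : R * R) + (y, c) = (x + y, c).
  by congr pair => /=; [rewrite [x *: _]mulr1|rewrite scaler0 add0r].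
have E2 (x y c : R) : x *: ((0, 1) : R * R) + (y, c) = (y, x + c).
  by congr pair => /=; [rewrite scaler0 add0r|rewrite [x *: _]mulr1].
have z0 : `|0 : R| < r by rewrite normr0.
apply/nbhs_ballP; exists r => //= h; rewrite /ball /= sub0r normrN => hr.
have [->|h0] := eqVneq h 0.
  by rewrite !scale0r add0r !subrr !normr0 mulr0.
have fin q : {for q, continuous f} -> forall d : R, 0 < d ->
    exists2 t : R, 0 < t & forall y, `|y| < t -> `|f q - f (q.1, y + q.2)| <= d.
  move=> cq d d0; have /cvgrPdist_le /(_ _ d0) := cq.
  move=> /nbhs_ballP[t /= t0 Ht]; exists t => // y yt; apply: Ht.
  by split; rewrite /ball /= ?subrr ?normr0// opprD addrCA subrr addr0 normrN.
case: vE => vE; rewrite vE in df Hr *.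
- apply/ler_addgt0Pr => d d0; have d3 : 0 < d / 2 by rewrite divr_gt0.
  have [c1 _ _] := Hr _ (inb h 0 hr z0).
  have [c2 _ _] := Hr _ (inb 0 0 z0 z0).
  have [t1 t10 T1] := fin _ c1 _ d3; have [t2 t20 T2] := fin _ c2 _ d3.
  (* The horizontal segment is lifted by [m] off the line t = 0. Lifting changes [f] by at most
     [d / 2] at each end, and on the lifted segment the mean value inequality applies; [d] is
     arbitrary. *)
  pose m := Num.min (Num.min t1 t2) r / 2.
  have m0 : 0 < m by rewrite divr_gt0// !lt_min t10 t20.
  have [m1 m2 mr] : [/\ m < t1, m < t2 & m < r].
    have : m < Num.min (Num.min t1 t2) r by rewrite ltr_pdivrMr// ltr_pMr ?ltr1n// !lt_min t10 t20.
    by rewrite !lt_min => /andP[/andP[]].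
  have nm : `|m| = m by rewrite gtr0_norm.
  have := T1 m; rewrite nm => /(_ m1) {}T1; have := T2 m; rewrite nm => /(_ m2) {}T2.
  have := @mean_value_dir_derive _ _ _ f (fun s => f1 (s * h + p.1, m + p.2))
     (p.1, m + p.2) (1, 0) (f1 p) e h.
  rewrite E1 => /(_ _ _)/wrap[].
  - move=> s s01; rewrite E1.
    have [|_ _] := Hr (s * h + p.1, m + p.2); first by apply: inb; [exact: small|rewrite nm].
    by apply; rewrite /= p0 addr0 gt_eqF.
  - move=> s s01; rewrite distrC.
    by have [|_ ? _] := Hr (s * h + p.1, m + p.2); first by apply: inb; [exact: small|rewrite nm].
  rewrite /= !add0r in T1 T2; rewrite [p in _ *: _ + p]surjective_pairing E1.
  rewrite -surjective_pairing in T2.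
  move: T1 T2; set A := f (h + p.1, p.2); set B := f (h + p.1, m + p.2).
  set C := f p; set D := f (p.1, m + p.2); set L := h *: _ => T1 T2 T3.
  have -> : A - C - L = (A - B) + (B - D - L) - (C - D).
    rewrite !opprD !opprK !addrA subrK.
    by rewrite [RHS](ACl (1*4*3*(2*5)))/= addNr addr0.
  apply: le_trans (ler_normB _ _) _; apply: le_trans (lerD (ler_normD _ _) (lexx _)) _.
  by rewrite [d](splitr d); lra.
have := @mean_value_dir _ _ _ f (fun s => f1 (p.1, s * h + p.2)) p (0, 1) (f1 p) e h.
apply.
- apply/subspace_continuousP => s; rewrite /= in_itv /= => s01.
  apply: cvg_within_filter.
  apply: (cvg_comp (fun s : R => (s * h) *: ((0, 1) : R * R) + p) f).
    apply: cvgD; last exact: cvg_cst.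
    by apply: cvgZr_tmp; apply: cvgMr_tmp; exact: cvg_id.
  suff c : {for (s * h) *: (0, 1) + p, continuous f} by exact: c.
  rewrite [p in _ *: _ + p]surjective_pairing E2.
  have -> : (p.1, s * h + p.2) = (0 + p.1, s * h + p.2) by rewrite add0r.
  by have [] := Hr _ (inb _ _ z0 (small s h s01 hr)).
- move=> s /andP[s0 s1]; have s01 : 0 <= s <= 1 by rewrite !ltW.
  rewrite [p in _ *: _ + p]surjective_pairing E2.
  have -> : (p.1, s * h + p.2) = (0 + p.1, s * h + p.2) by rewrite add0r.
  have [_ _] := Hr _ (inb _ _ z0 (small s h s01 hr)); apply => /=.
  by rewrite p0 addr0 mulf_neq0// gt_eqF.
- move=> s /andP[s0 s1]; have s01 : 0 <= s <= 1 by rewrite !ltW.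
  have -> : (p.1, s * h + p.2) = (0 + p.1, s * h + p.2) by rewrite add0r.
  by rewrite distrC; have [] := Hr _ (inb _ _ z0 (small s h s01 hr)).
Unshelve. all: by end_near. Qed.

End glue.

Section reflection_smooth.
Context {R : realType} {E : normedModType R}.
Variables (alpha beta : R) (a b : nat -> nat -> R).
Hypothesis (ltab : alpha < beta).
Hypothesis b_ge : forall N j, N.+1%:R <= b N j.
Hypothesis ab_le : forall m N, (m < N)%N ->
  \sum_(j < N.+1) `|a N j| * b N j ^+ m <= 2^-1 ^+ N.
Hypothesis ab_sum : forall m K, (m < K)%N ->
  \sum_(N < K) \sum_(j < N.+1) a N j * (- b N j) ^+ m = 1.
Variable s : R.
Hypothesis s1 : s < 1.

Local Notation strip := (strip alpha beta).
Local Notation upper := (upper alpha beta).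
Local Notation ext := (reflect_ext a b).
Local Notation psum := (reflect_sum a b).
Implicit Type f : R * R -> E.

Let b_gt0 N j : 0 < b N j.
Proof. by apply: lt_le_trans (b_ge N j); rewrite ltr0n. Qed.

Let near_snd_gt (p : R * R) (x : R) : x < p.2 -> \forall q \near p, x < q.2.
Proof. by move=> xp; exact: (cvg_snd (lt_nbhsr xp)). Qed.

Let near_snd_lt (p : R * R) (x : R) : p.2 < x -> \forall q \near p, q.2 < x.
Proof. by move=> xp; exact: (cvg_snd (lt_nbhsl xp)). Qed.

Lemma reflect_ext_upper m f p : 0 <= p.2 -> ext m f p = f p.
Proof. by rewrite /reflect_ext => ->. Qed.

(** The 2 in the index leaves room: the same [K] is large enough for all [q] with
    [q.2 < p.2 / 2]. *)
Let near_extE m f (p : R * R) : vanish_above alpha beta s f -> p.2 < 0 ->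
  let K := (Num.truncn (2 / - p.2)).+1 in
  \forall q \near p, strip q -> ext m f q = psum m K f q.
Proof.
move=> f0 p0 K.
have Kp : 2 <= K%:R * - p.2.
  by rewrite -ler_pdivrMr ?oppr_gt0// ltW// truncnS_gt.
have q2 : p.2 < p.2 / 2 by lra.
apply: filterS (near_snd_lt q2) => q qp Sq.
apply: (reflect_extE a b_ge m s1 f0) => //; first by lra.
apply: (@le_trans _ _ (K%:R * - (p.2 / 2))); first by lra.
by rewrite ler_wpM2l//; lra.
Qed.

(** Only t = 0 is delicate. There every reflected point is [p] itself, so k blocks with [m < k] sum
    to [f p] by the m-th moment identity; near [p] those finitely many blocks vary continuously and
    all later ones are uniformly small. *)
Lemma reflect_ext_continuous m f : {within upper, continuous f} ->
  vanish_above alpha beta s f -> {within strip, continuous (ext m f)}.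
Proof.
move=> fc f0; apply/subspace_continuousP => p Sp.
have [p0|p0|p0] := ltgtP p.2 0.
- have HK := near_extE m f0 p0; set K := _.+1 in HK.
  have := cvg_reflect_sum (a := a) b_ge (m := m) (K := K) fc Sp (ltW p0).
  rewrite -(nbhs_singleton HK Sp) => H V /H {}H.
  have {}H : \forall q \near p, strip q /\ q.2 <= 0 -> V (psum m K f q) := H.
  change (\forall q \near p, strip q -> V (ext m f q)).
  apply: filterS3 H HK (near_snd_lt p0) => q H HK q0 Sq.
  by rewrite HK//; apply: H; split => //; exact: ltW.
- have Up : upper p by split => //; exact: ltW.
  have /subspace_continuousP/(_ p Up) H := fc.
  rewrite /from_subspace reflect_ext_upper ?ltW// => V /H {}H.
  have {}H : \forall q \near p, upper q -> V (f q) := H.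
  change (\forall q \near p, strip q -> V (ext m f q)).
  apply: filterS2 H (near_snd_gt p0) => q H q0 Sq.
  by rewrite reflect_ext_upper ?ltW//; apply: H; split => //; exact: ltW.
have Up : upper p by split => //; rewrite p0.
have [C C0 fC] := upper_bounded fc s1 f0.
apply/cvgrPdist_le => e e0.
have e2 : 0 < e / 2 by rewrite divr_gt0.
rewrite /from_subspace reflect_ext_upper ?p0//.
(* [m < k] serves the moment identity and the tail estimate; the other bound holds because 2^k
   exceeds k, which exceeds 4C/e. *)
have [k [mk Ck]] : exists k, (m < k)%N /\ C * (2 * 2^-1 ^+ k) <= e / 2.
  pose k := (Num.truncn (4 * C / e) + m).+1; exists k; split.
    by rewrite ltnS leq_addl.
  have : 4 * C / e <= 2 ^+ k.
    apply: (@le_trans _ _ k%:R).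
      by rewrite ltW// (lt_le_trans (truncnS_gt _))// ler_nat ltnS leq_addr.
    by rewrite -natrX ler_nat ltnW// ltn_expl.
  rewrite ler_pdivrMr// exprVn => H.
  rewrite mulrA ler_pdivrMr ?exprn_gt0//.
  by set y := 2 ^+ k in H *; lra.
have psp : psum m k f p = f p.
  rewrite /reflect_sum -[RHS]scale1r -(ab_sum mk) scaler_suml; apply: eq_bigr => N _.
  rewrite scaler_suml; apply: eq_bigr => j _; congr (_ *: f _).
  by rewrite p0 mulr0 -p0 -surjective_pairing.
have := cvg_reflect_sum (a := a) b_ge (m := m) (K := k) fc Sp _.
rewrite p0 lexx psp => /(_ isT)/cvgrPdist_le/(_ _ e2).
rewrite near_withinE => n1.
have /subspace_continuousP/(_ p Up)/cvgrPdist_le/(_ _ e0) := fc.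
rewrite near_withinE => n2; rewrite near_withinE.
apply: filterS2 n1 n2 => q n1 n2 Sq.
have [q0|q0] := ltP q.2 0; last by rewrite reflect_ext_upper//; apply: n2.
have [K' [kK Kq]] : exists K', (k <= K')%N /\ 1 <= K'%:R * - q.2.
  exists (maxn k (Num.truncn (- q.2)^-1).+1); split; first exact: leq_maxl.
  apply: (@le_trans _ _ ((Num.truncn (- q.2)^-1).+1%:R * - q.2)).
    by rewrite -ler_pdivrMr ?oppr_gt0// mul1r ltW// truncnS_gt.
  by rewrite ler_wpM2r ?ler_nat ?leq_maxr//; lra.
rewrite (reflect_extE a b_ge m s1 f0 Sq q0 Kq) -(subnKC kK).
have := reflect_sum_tail b_ge ab_le (K' - k)%N fC mk Sq (ltW q0).
have := n1 (conj Sq (ltW q0)).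
have := ler_distD (psum m k f q) (f p) (psum m (k + (K' - k))%N f q).
by rewrite [`|psum m k f q - _|]distrC; lra.
Qed.

Let is_derive_bigsum (n : nat) (h : 'I_n -> R * R -> E) dh (p v : R * R) :
  (forall i, is_derive p v (h i) (dh i)) ->
  is_derive p v (fun q => \sum_(i < n) h i q) (\sum_(i < n) dh i).
Proof.
move=> H; have := is_derive_sum H.
by rewrite (_ : \sum_(i < n) h i = fun q => \sum_(i < n) h i q)//; apply/funext => q; rewrite fct_sumE.
Qed.

Let interior_strip (p : R * R) : interior strip p -> forall t : R, interior strip (p.1, t).
Proof.
move=> Sp t; have n1 : \forall x \near p.1, alpha <= x <= beta.
  have : (fun x : R => (x, p.2)) @ nbhs p.1 --> (p.1, p.2).
    by apply: cvg_pair_point; [exact: cvg_id|exact: cvg_cst].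
  by rewrite -surjective_pairing => /(_ _ Sp).
by have : \forall q \near (p.1, t), alpha <= q.1 <= beta by exact: (cvg_fst n1).
Qed.

Let interior_upper (p : R * R) : interior strip p -> 0 < p.2 -> interior upper p.
Proof.
move=> Sp p0; apply: filterS2 Sp (near_snd_gt p0) => q Sq q0.
by split => //; exact: ltW.
Qed.

Let is_derive_psum m K f f1 f2 (p : R * R) : interior strip p -> p.2 < 0 ->
  (forall q, interior upper q ->
    is_derive (q : R * R) (1, 0) f (f1 q) /\ is_derive (q : R * R) (0, 1) f (f2 q)) ->
  is_derive p (1, 0) (psum m K f) (psum m K f1 p) /\
  is_derive p (0, 1) (psum m K f) (psum m.+1 K f2 p).
Proof.
move=> Sp p0 df; have up N j : interior upper (shear (- b N j) 0 p).
  apply: interior_upper; first exact: interior_strip.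
  by rewrite /= addr0 mulNr -mulrN mulr_gt0// oppr_gt0.
have shE N j (g : R * R -> E) : (fun q : R * R => g (q.1, - b N j * q.2)) = g \o shear (- b N j) 0.
  by apply/funext => q /=; rewrite /shear addr0.
have shE' N j (g : R * R -> E) : g (p.1, - b N j * p.2) = g (shear (- b N j) 0 p).
  by rewrite /shear addr0.
split; apply: is_derive_bigsum => N; apply: is_derive_bigsum => j.
  apply: is_deriveZ; rewrite shE shE'.
  by apply: is_derive_shear_fst; have [] := df _ (up N j).
rewrite exprSr mulrA -scalerA; apply: is_deriveZ; rewrite shE shE'.
by apply: is_derive_shear_snd; have [] := df _ (up N j).
Qed.

(** Differentiating in eps keeps [m], differentiating in t raises it by one, so the induction on [n]
    runs over all [m] with the same weights. Off t = 0 the derivatives are computed termwise or are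
    those of [f]; on the line they follow from [is_derive_glue] and the continuity of the extended
    partial derivatives. *)
Lemma Cplane_reflect_ext n m f : vanish_above alpha beta s f ->
  Cplane n upper f -> Cplane n strip (ext m f).
Proof.
have oN : open [set q : R * R | s < q.2] by exact: open_snd_gt.
have fatU := fat_upper ltab.
elim: n m f => [|n IH] m f f0 [fc Hf].
  by split => //; exact: reflect_ext_continuous.
split; first exact: reflect_ext_continuous.
move: Hf => [f1 [f2 [F1 F2 F3]]].
have zero g v : (forall p, interior upper p -> is_derive (p : R * R) v f (g p)) ->
    {within upper, continuous g} -> vanish_above alpha beta s g.
  move=> gd gc p Up sp.
  apply: (fat_continuous_eq (g := cst 0) fatU oN) => //.
  - by apply: continuous_subspaceW gc => q [].
  - by apply: continuous_subspaceT => q; exact: cvg_cst.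
  - move=> q Uq sq; have [_ <-] := gd q Uq.
    rewrite (near_eq_derive _ (g := cst 0)) ?derive_cst//.
    by apply: filterS2 Uq (near_snd_gt sq) => q' Uq' sq'; apply: f0.
have z1 := zero f1 (1, 0) (fun p Up => (F3 p Up).1) (Cplane_continuous F1).
have z2 := zero f2 (0, 1) (fun p Up => (F3 p Up).2) (Cplane_continuous F2).
have H1 := IH m _ z1 F1; have H2 := IH m.+1 _ z2 F2.
exists (ext m f1), (ext m.+1 f2); split => // p Sp.
have off (q : R * R) : interior strip q -> q.2 != 0 ->
    is_derive q (1, 0) (ext m f) (ext m f1 q) /\
    is_derive q (0, 1) (ext m f) (ext m.+1 f2 q).
  move=> Sq; rewrite neq_lt => /orP[q0|q0].
    have HK0 := near_extE m f0 q0; set K := _.+1 in HK0.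
    have HK : \forall x \near q, psum m K f x = ext m f x.
      by apply: filterS2 HK0 Sq => x H /H ->.
    have Sq' := interior_subset Sq.
    rewrite (nbhs_singleton (near_extE m z1 q0) Sq').
    rewrite (nbhs_singleton (near_extE m.+1 z2 q0) Sq').
    have [d1 d2] := is_derive_psum m K Sq q0 F3.
    by split; exact: near_eq_is_derive HK _.
  have nf : \forall x \near q, f x = ext m f x.
    by apply: filterS (near_snd_gt q0) => x x0; rewrite reflect_ext_upper// ltW.
  rewrite !reflect_ext_upper ?(ltW q0)//.
  have [d1 d2] := F3 q (interior_upper Sq q0).
  by split; exact: near_eq_is_derive nf _.
have [p0|p0] := eqVneq p.2 0; last exact: off.
have cont (g : R * R -> E) : {within strip, continuous g} -> forall q, interior strip q -> {for q, continuous g}.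
  move=> /subspace_continuousP cg q Sq; have := cg q (interior_subset Sq).
  by rewrite within_interior.
have nS := open_nbhs_nbhs (conj (open_interior strip) Sp).
split; apply: is_derive_glue => //.
- by left.
- apply: filterS nS => q Sq; apply: cont => //; exact: reflect_ext_continuous.
- by apply: cont => //; exact: Cplane_continuous H1.
- by apply: filterS nS => q Sq /(off q Sq)[].
- by right.
- apply: filterS nS => q Sq; apply: cont => //; exact: reflect_ext_continuous.
- by apply: cont => //; exact: Cplane_continuous H2.
- by apply: filterS nS => q Sq /(off q Sq)[].
Unshelve. all: by end_near. Qed.

End reflection_smooth.

(** * Extension from a rectangle to a strip *)

Section extension.
Context {R : realType} {E : normedModType R}.
Variables (alpha beta tau : R).
Hypotheses (ltab : alpha < beta) (tau0 : 0 < tau) (tau1 : tau <= 1 / 2).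
Local Notation strip := (strip alpha beta).
Local Notation upper := (upper alpha beta).
Local Notation rect := (rect alpha beta).

(** Cutoff equal to 1 up to [tau / 3] and to 0 from [2 / 3 * tau] on. It lets the reflection see
    only values of [f] close to the end point. *)
Definition collar (t : R) : R := 1 - step (3 / tau * t - 1).

Lemma collar1 t : t <= tau / 3 -> collar t = 1.
Proof.
move=> tt; rewrite /collar step_le0 ?subr0// subr_le0.
by rewrite mulrAC ler_pdivrMr//; lra.
Qed.

Lemma collar0 t : 2 / 3 * tau <= t -> collar t = 0.
Proof.
move=> tt; rewrite /collar step_ge1 ?subrr// lerBrDr.
by rewrite mulrAC ler_pdivlMr//; lra.
Qed.

Lemma Cplane_collar n D (c d : R) : Cplane n D (fun p : R * R => collar (c * p.2 + d)).
Proof.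
have H := Cplane_step n D 0 (3 / tau * c) (3 / tau * d - 1).
have H' := CplaneD (Cplane_cst n D (1 : R)) (CplaneZ (Cplane_cst n D (-1 : R)) H).
apply: Cplane_eq H' => p _ /=; rewrite /collar scaleN1r; congr (_ - step _).
by rewrite mul0r add0r mulrDr !mulrA addrA.
Qed.

Lemma Cplane_upper_collar n (f : R * R -> E) : Cplane n rect f ->
  Cplane n upper (fun p => collar p.2 *: f p).
Proof.
move=> Cf; apply: (Cplane_local (fat_upper ltab)) => p [Sp p0].
have [pt|pt] := ltP p.2 (1 / 2 : R).
  exists [set q | q.2 < 1 / 2]; split => //; first exact: open_snd_lt.
  apply: CplaneZ.
    by apply: Cplane_eq (Cplane_collar _ _ 1 0) => q _; rewrite mul1r addr0.
  apply: Cplane_sub Cf => q [[Sq q0] /= q1]; split => //.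
  by rewrite q0 /=; lra.
exists [set q | 2 / 3 * tau < q.2]; split; [exact: open_snd_gt|rewrite /=|].
  by have := tau1; lra.
apply: Cplane_eq (Cplane_cst n _ (0 : E)) => q [_ /= q1].
by rewrite collar0 ?scale0r// ltW.
Qed.

Lemma Cplane_flip n (f : R * R -> E) : Cplane n rect f -> Cplane n rect (f \o shear (-1) 1).
Proof.
move=> Cf; have m1 : (-1 : R) != 0 by rewrite oppr_eq0 oner_eq0.
apply: (Cplane_sub _ (Cplane_shear 1 m1 Cf)) => q [Sq /andP[q0 q1]]; split => //=.
by apply/andP; split; lra.
Qed.

(** The coefficient vanishes identically near t = 0 and t = 1 and beyond, so the values of [f]
    outside the rectangle do not matter. *)
Lemma Cplane_mid n (f : R * R -> E) : Cplane n rect f ->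
  Cplane n strip (fun p => (1 - collar p.2 - collar (1 - p.2)) *: f p).
Proof.
have t0 := tau0; have t1 := tau1.
move=> Cf; apply: (Cplane_local (fat_strip ltab)) => p Sp.
have [pt|pt] := ltP p.2 (tau / 3).
  exists [set q | q.2 < tau / 3]; split => //; first exact: open_snd_lt.
  apply: Cplane_eq (Cplane_cst n _ (0 : E)) => q [_ /= q1].
  rewrite collar1 ?(ltW q1)// collar0; last by lra.
  by rewrite subrr subr0 scale0r.
have [pt'|pt'] := ltP (1 - tau / 3) p.2.
  exists [set q | 1 - tau / 3 < q.2]; split => //; first exact: open_snd_gt.
  apply: Cplane_eq (Cplane_cst n _ (0 : E)) => q [_ /= q1].
  rewrite collar0; last by lra.
  rewrite collar1; last by lra.
  by rewrite subr0 subrr scale0r.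
exists ([set q | q.2 < 1] `&` [set q | 0 < q.2]); split => /=.
- by apply: openI; [exact: open_snd_lt|exact: open_snd_gt].
- by split; lra.
apply: CplaneZ.
  have H c d := CplaneZ (Cplane_cst n (strip `&` ([set q : R * R | q.2 < 1] `&` [set q | 0 < q.2])) (-1 : R)) (Cplane_collar n _ c d).
  apply: Cplane_eq (CplaneD (CplaneD (Cplane_cst n _ (1 : R)) (H 1 0)) (H (-1) 1)) => q _ /=.
  rewrite !scaleN1r mul1r addr0; congr (_ - collar _).
  by rewrite mulN1r addrC.
by apply: Cplane_sub Cf => q [Sq [/= q1 q0]]; split => //; rewrite !ltW.
Qed.

(** Since all nodes are at least 1, the reflection at [p.2 < 0] only uses values of [f] at heights
    at least [- p.2]. *)
Lemma reflect_ext_eq0 (a b : nat -> nat -> R) m (f : R * R -> E) (p : R * R) :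
  (forall N j, N.+1%:R <= b N j) ->
  (forall t, 0 <= t -> t = p.2 \/ (p.2 < 0 /\ - p.2 <= t) -> f (p.1, t) = 0) ->
  reflect_ext a b m f p = 0.
Proof.
move=> b_ge H; rewrite /reflect_ext; case: ifPn => [p0|].
  by rewrite [p]surjective_pairing; apply: H => //; left.
rewrite -ltNge => p0; apply: big1 => N _; apply: big1 => j _.
have b1 : 1 <= b N j by apply: le_trans (b_ge N j); rewrite ler1n.
have le : - p.2 <= - b N j * p.2.
  by rewrite mulNr -mulrN ler_peMl// oppr_ge0 ltW.
rewrite H ?scaler0//; last by right.
by apply: le_trans le; rewrite oppr_ge0 ltW.
Qed.

(** Two collars and a middle part sum to [f]; the left collar is reflected at 0, the right one at 1
    after a flip, and the middle is continued by 0. The third clause yields constancy in t near the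
    ends of J. The fourth keeps the support near that of [f]: a reflected value comes from a height
    below [2 / 3 * tau], at distance at most [4 / 3 * tau] from the point. *)
Lemma extend_Cplane (r : option nat) (f : R * R -> E) :
  (forall n, le_order n r -> Cplane n rect f) ->
  exists F : R * R -> E,
  [/\ forall n, le_order n r -> Cplane n strip F,
      forall p, rect p -> F p = f p,
      forall p, strip p -> p.2 <= - tau \/ 1 + tau <= p.2 -> F p = 0
    & forall p, strip p ->
        (forall t, 0 <= t <= 1 -> `|t - p.2| <= 2 * tau -> f (p.1, t) = 0) ->
        F p = 0].
Proof.
have tau0' := tau0; have tau1' := tau1.
move=> Cf; have [a [b [b_ge ab_le ab_sum]]] := @seeley_weights R.
pose fL p := collar p.2 *: f p.
pose fR p := collar p.2 *: (f \o shear (-1) 1) p.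
pose mid p := (1 - collar p.2 - collar (1 - p.2)) *: f p.
have shE p : shear (-1) 1 p = (p.1, 1 - p.2).
  by rewrite /shear mulN1r addrC.
pose F p := reflect_ext a b 0 fL p + reflect_ext a b 0 fR (shear (-1) 1 p) + mid p.
have s1 : 2 / 3 * tau < 1 by lra.
have vL : vanish_above alpha beta (2 / 3 * tau) fL.
  by move=> p _ /ltW pt; rewrite /fL collar0// scale0r.
have vR : vanish_above alpha beta (2 / 3 * tau) fR.
  by move=> p _ /ltW pt; rewrite /fR collar0// scale0r.
have Z p : strip p -> p.2 <= - tau \/ 1 + tau <= p.2 \/
    (forall t, 0 <= t <= 1 -> `|t - p.2| <= 2 * tau -> f (p.1, t) = 0) -> F p = 0.
  move=> Sp H.
  have hL : reflect_ext a b 0 fL p = 0.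
    apply: reflect_ext_eq0 => // t t0 tp; rewrite /fL /=.
    have [tt|tt] := leP (2 / 3 * tau) t; first by rewrite collar0// scale0r.
    case: H => [?|[?|H]]; try by case: tp => [?|[? ?]]; exfalso; lra.
    rewrite H ?scaler0//; first by rewrite t0 /=; lra.
    by case: tp => [->|[? ?]]; rewrite ?subrr ?normr0 ?ger0_norm; lra.
  have hR : reflect_ext a b 0 fR (shear (-1) 1 p) = 0.
    rewrite shE; apply: reflect_ext_eq0 => // t t0 /= tp; rewrite /fR /= shE /=.
    have [tt|tt] := leP (2 / 3 * tau) t; first by rewrite collar0// scale0r.
    case: H => [?|[?|H]]; try by case: tp => [?|[? ?]]; exfalso; lra.
    rewrite H ?scaler0//; first by apply/andP; split; lra.
    by case: tp => [->|[? ?]]; [rewrite (_ : 1 - (1 - p.2) - p.2 = 0) ?normr0|rewrite ler0_norm]; lra.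
  have hM : mid p = 0.
    rewrite /mid; have [p0|p0] := ltP p.2 0.
      rewrite collar1 ?collar0 ?subr0 ?subrr ?scale0r//; lra.
    have [p1|p1] := ltP 1 p.2.
      rewrite collar0 ?collar1 ?subr0 ?subrr ?scale0r//; lra.
    case: H => [?|[?|H]]; try by exfalso; lra.
    rewrite [p in f p]surjective_pairing H ?scaler0//; first by rewrite p0.
    by rewrite subrr normr0; lra.
  by rewrite /F hL hR hM !addr0.
exists F; split.
- move=> n /Cf Cn; apply: CplaneD; last exact: Cplane_mid.
  apply: CplaneD; first exact: (Cplane_reflect_ext ltab b_ge ab_le ab_sum s1 _ vL (Cplane_upper_collar Cn)).
  have m1 : (-1 : R) != 0 by rewrite oppr_eq0 oner_eq0.
  have CR := Cplane_reflect_ext ltab b_ge ab_le ab_sum s1 0 vR (Cplane_upper_collar (Cplane_flip Cn)).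
  exact: Cplane_shear 1 m1 CR.
- move=> p [Sp /andP[p0 p1]]; rewrite /F shE /reflect_ext p0 /= subr_ge0 p1.
  rewrite /fL /fR /mid /= shE /= subKr -surjective_pairing -!scalerDl.
  by rewrite [X in X *: _](_ : _ = 1) ?scale1r//; ring.
- by move=> p Sp [H|H]; apply: Z => //; [left|right; left].
- by move=> p Sp H; apply: Z => //; right; right.
Qed.

End extension.

(** * Evaluation of continuous linear maps as a continuous bilinear map *)

Section evaluation.
Context {R : realType}.
Implicit Types (E F : normedModType R).

Lemma clinear_eval0 {E F} (g : clinear E F) : g 0 = 0.
Proof.
have [/(_ (-1) 0 0)] := clinearP g.
by rewrite scaler0 scaleN1r addr0 addNr.
Qed.

Lemma clinearZ {E F} (g : clinear E F) (c : R) e : g (c *: e) = c *: g e.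
Proof. by have [/(_ c e 0)] := clinearP g; rewrite clinear_eval0 !addr0. Qed.

Lemma clinearB {E F} (g : clinear E F) e e' : g (e - e') = g e - g e'.
Proof.
have [/(_ (-1) e' e)] := clinearP g.
by rewrite !scaleN1r => H _; rewrite addrC H addrC.
Qed.

Lemma clinear_scaleE {E F} (g : clinear E F) (c : R) e : (c *: g) e = c *: g e.
Proof. by []. Qed.

Lemma clinear_zeroE {E F} e : (0 : clinear E F) e = 0.
Proof. by []. Qed.

Lemma clinear_sum {E F} (g : clinear E F) (I : Type) (r : seq I) (f : I -> E) :
  g (\sum_(i <- r) f i) = \sum_(i <- r) g (f i).
Proof.
elim: r => [|i r IH]; first by rewrite !big_nil clinear_eval0.
rewrite !big_cons -IH; have [/(_ 1 (f i) (\sum_(i <- r) f i))] := clinearP g.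
by rewrite !scale1r.
Qed.

Lemma clinear_norm_le {E F} (g : clinear E F) e : `|g e| <= `|g| * `|e|.
Proof.
have [_ gc] := clinearP g.
have hs : has_sup [set `|g x| | x in [set x | `|x| <= 1]].
  split; first by exists `|g 0|, 0; rewrite //= normr0.
  have := gc 0; rewrite /continuous_at clinear_eval0 => /cvgrPdist_le /(_ _ ltr01).
  move=> /nbhs_ballP[d /= d0 Hd]; exists (2 / d) => _ [x /= x1 <-].
  have d2 : 0 < d / 2 by rewrite divr_gt0.
  have : `|g ((d / 2) *: x)| <= 1.
    have := Hd ((d / 2) *: x); rewrite /= sub0r normrN; apply.
    rewrite -ball_normE /= sub0r normrN normrZ gtr0_norm//.
    by apply: (@le_lt_trans _ _ (d / 2)); [rewrite ler_piMr// ltW|lra].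
  rewrite clinearZ normrZ gtr0_norm// -ler_pdivlMl// mulr1.
  by rewrite invfM invrK mulrC.
have [->|e0] := eqVneq e 0; first by rewrite clinear_eval0 !normr0 mulr0.
have n0 : 0 < `|e| by rewrite normr_gt0.
rewrite -ler_pdivrMr// mulrC -[X in X * _]gtr0_norm ?invr_gt0// -normrZ -clinearZ.
apply: (sup_upper_bound hs); exists (`|e|^-1 *: e) => //=.
by rewrite normrZ gtr0_norm ?invr_gt0// mulVf// gt_eqF.
Qed.

(** Joint continuity rests on the operator norm: [g e - g' e'] is split as
    [g (e - e') + (g - g') e']. This is what turns transition maps that are smooth in the operator
    norm into admissible factors of [Crs_on_bilinear]. *)
Lemma clinear_eval_continuous {E F} :
  continuous (fun q : clinear E F * E => q.1 q.2).
Proof.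
move=> [g e] /=; apply/cvgrPdist_le => d d0.
pose k := `|g| + `|e| + 1.
have k0 : 0 < k by rewrite ltr_wpDl// addr_ge0.
have m0 : 0 < Num.min 1 (d / k) by rewrite lt_min ltr01 divr_gt0.
have c1 : (fun q : clinear E F * E => q.1) @ (g, e) --> g by exact: cvg_fst.
have c2 : (fun q : clinear E F * E => q.2) @ (g, e) --> e by exact: cvg_snd.
have /cvgrPdist_le /(_ _ m0) n1 := c1.
have /cvgrPdist_le /(_ _ m0) n2 := c2.
near=> q.
have h1 : `|g - q.1| <= Num.min 1 (d / k) by near: q.
have h2 : `|e - q.2| <= Num.min 1 (d / k) by near: q.
move: h1 h2; rewrite !le_min => /andP[g1 gk] /andP[e1 ek].
have -> : g e - q.1 q.2 = g (e - q.2) + (g - q.1) q.2.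
  by rewrite clinearB -[(g - q.1) q.2]/(g q.2 - q.1 q.2) addrA subrK.
have q2 : `|q.2| <= `|e| + 1.
  have -> : q.2 = e - (e - q.2) by rewrite opprB addrC subrK.
  by apply: le_trans (ler_normB _ _) _; rewrite lerD2l.
apply: le_trans (ler_normD _ _) _.
apply: (@le_trans _ _ (`|g| * (d / k) + (d / k) * (`|e| + 1))).
  apply: lerD; apply: le_trans (clinear_norm_le _ _) _.
    by rewrite ler_wpM2l.
  by apply: ler_pM.
rewrite [X in X + _]mulrC -mulrDr addrA -/k divfK//.
by rewrite gt_eqF.
Unshelve. all: by end_near. Qed.

(** A bundle chart takes values in model times fibre. [eval_snd] supplies the fibre component, and
    [scale_fst] the base component as a map of y times the constant 1, so that both are bilinear
    products of the same kind. *)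
Definition eval_snd {E F G : normedModType R} (g : clinear E F) (e : E) : G * F :=
  (0, g e).

Lemma eval_snd_linearl {E F G} e : linear (@eval_snd E F G ^~ e).
Proof. by move=> c g h; congr pair; rewrite /= scaler0 addr0. Qed.

Lemma eval_snd_linearr {E F G} g : linear (@eval_snd E F G g).
Proof.
move=> c e e'; have [gl _] := clinearP g; congr pair; last exact: gl.
by rewrite /= scaler0 addr0.
Qed.

Lemma eval_snd_continuous {E F G} :
  continuous (fun q : clinear E F * E => @eval_snd E F G q.1 q.2).
Proof.
move=> q; apply: cvg_pair_point; first exact: cvg_cst.
exact: clinear_eval_continuous.
Qed.

Definition scale_fst {G F : normedModType R} (h : G) (c : R) : G * F := (c *: h, 0).

Lemma scale_fst_linearl {F G} c : linear (@scale_fst F G ^~ c).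
Proof.
move=> d g h; congr pair; rewrite /= ?scaler0 ?addr0//.
by rewrite scalerDr !scalerA mulrC.
Qed.

Lemma scale_fst_linearr {F G} h : linear (@scale_fst F G h).
Proof.
move=> d c c'; congr pair; rewrite /= ?scaler0 ?addr0//.
by rewrite scalerDl scalerA.
Qed.

Lemma scale_fst_continuous {F G} :
  continuous (fun q : F * R => @scale_fst F G q.1 q.2).
Proof.
move=> q; apply: cvg_pair_point; last exact: cvg_cst.
by apply: cvgZ; [exact: cvg_snd|exact: cvg_fst].
Qed.

End evaluation.

(** * Sections of the bundle glued from trivial pieces *)

Section charts.
Context {R : realType} {M : topologicalType} {a : atlas R M}.
Hypothesis Ma : banach_manifold a.

Lemma chart_image_open (i : cix a) (V : set M) : open V ->
  open (chart a i @` (cdom a i `&` V)).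
Proof.
case: Ma => _ oD _ oI cK _ cc _ oV.
rewrite openE => _ [x [Dx Vx] <-].
have Ix : cimg a i (chart a i x) by exists x.
have cI : cinv a i @ within (cimg a i) (nbhs (chart a i x)) --> cinv a i (chart a i x).
  by have /subspace_continuousP/(_ _ Ix) := cc i.
rewrite cK// in cI; have H := cI _ (open_nbhs_nbhs (conj oV Vx)).
have {}H : \forall z \near chart a i x, cimg a i z -> V (cinv a i z) := H.
have nI : \forall z \near chart a i x, cimg a i z by exact: open_nbhs_nbhs.
apply: filterS2 H nI => z H Iz; have Vz := H Iz.
by case: Iz Vz => y Dy <-; rewrite cK// => Vy; exists y.
Qed.

Lemma chart_imageE (i : cix a) (V : set M) z :
  (chart a i @` (cdom a i `&` V)) z <-> cimg a i z /\ V (cinv a i z).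
Proof.
case: Ma => _ _ _ _ cK _ _ _; split.
  by move=> [x [Dx Vx] <-]; rewrite cK//; split => //; exists x.
by move=> [[x Dx <-]]; rewrite cK// => Vx; exists x.
Qed.

Lemma smooth_fun_chart {F : normedModType R} (S V : set M) (h : M -> F) i :
  smooth_fun a S h -> open V -> V `<=` S ->
  smooth_at_all (chart a i @` (cdom a i `&` V)) (h \o cinv a i).
Proof.
move=> hS oV VS; apply: Cr_on_smooth (hS i); first exact: chart_image_open.
by move=> _ [x [Dx Vx] <-]; exists x => //; split => //; exact: VS.
Qed.

End charts.

Section bundle.
Context {R : realType} {M A : topologicalType} {a : atlas R M} {b : vbundle R M A}.
Hypotheses (Ma : banach_manifold a) (Ab : banach_vector_bundle a b).

Lemma transition_exists j j' : exists G : M -> clinear (fib j) (fib j'),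
  smooth_fun a (tdom b j `&` tdom b j') G /\
  forall x f, tdom b j x -> tdom b j' x -> triv b j' (tinv b j x f) = G x f.
Proof. by case: Ab. Qed.

Definition transition j j' := projT1 (cid (transition_exists j j')).

Lemma transition_smooth j j' : smooth_fun a (tdom b j `&` tdom b j') (transition j j').
Proof. by have [] := projT2 (cid (transition_exists j j')). Qed.

Lemma transitionE j j' x f : tdom b j x -> tdom b j' x ->
  triv b j' (tinv b j x f) = transition j j' x f.
Proof. by have [_] := projT2 (cid (transition_exists j j')); apply. Qed.

Lemma tdom_exists x : exists j, tdom b j x.
Proof. by case: Ab. Qed.

(** The choice varies with [x] without any regularity; it only serves to name points of the fibre,
    and [triv_glued] shows that coordinates do not depend on it. *)
Definition local_index x := projT1 (cid (tdom_exists x)).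

Lemma local_indexP x : tdom b (local_index x) x.
Proof. exact: projT2 (cid (tdom_exists x)). Qed.

Lemma zero_vector_triv e j : zero_vector b e -> tdom b j (proj b e) -> triv b j e = 0.
Proof.
case: (Ab) => _ _ _ _ tK _ _ _ [j' Uj' e0] Uj.
by rewrite -[e](tK j')// e0 transitionE// clinear_eval0.
Qed.

Lemma total_eq e e' j : tdom b j (proj b e) -> proj b e = proj b e' ->
  triv b j e = triv b j e' -> e = e'.
Proof.
case: Ab => _ _ _ _ tK _ _ _ Uj pe te.
by rewrite -[e](tK j)// te pe tK// -pe.
Qed.

Section section_of_pieces.
Variables (N : nat) (jj : 'I_N -> tix b) (th : 'I_N -> M -> R)
  (F : forall i : 'I_N, R * R -> fib (jj i)).

(* [tinv] is only meaningful over the trivializing domain, hence the value 0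
   elsewhere. *)
Definition piece_map (i : 'I_N) (j : tix b) (y : M) : clinear (fib (jj i)) (fib j) :=
  if pselect (tdom b (jj i) y) then th i y *: transition (jj i) j y else 0.

Definition glued (p : (R * R) * M) : A :=
  tinv b (local_index p.2) p.2
    (\sum_(i < N) piece_map i (local_index p.2) p.2 (F i p.1)).

Lemma proj_glued p : proj b (glued p) = p.2.
Proof.
case: (Ab) => _ _ _ tP _ _ _ _.
by have [] := tP _ _ (\sum_(i < N) piece_map i (local_index p.2) p.2 (F i p.1)) (local_indexP p.2).
Qed.

(** By linearity and the cocycle identity of the transition maps, passing from the chosen
    trivialization to [j] turns each piece into the same expression for [j]. *)
Lemma triv_glued j p : tdom b j p.2 ->
  triv b j (glued p) = \sum_(i < N) piece_map i j p.2 (F i p.1).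
Proof.
case: (Ab) => _ _ _ tP tK _ _ _ Uj.
have UJ := local_indexP p.2.
rewrite transitionE// clinear_sum; apply: eq_bigr => i _.
rewrite /piece_map; case: pselect => Ui; last by rewrite !clinear_zeroE clinear_eval0.
rewrite !clinear_scaleE clinearZ; congr (_ *: _).
have [pe _] := tP (jj i) p.2 (F i p.1) Ui.
rewrite -!transitionE//; congr (triv b j _).
rewrite -{2}[tinv b (jj i) p.2 (F i p.1)](tK (local_index p.2)) ?pe//.
Qed.

End section_of_pieces.

End bundle.

Section glued_smooth.
Context {R : realType} {M A : topologicalType} {a : atlas R M} {b : vbundle R M A}.
Hypotheses (Ma : banach_manifold a) (Ab : banach_vector_bundle a b).
Variables (alpha beta : R) (ltab : alpha < beta) (W : set (R * M)) (r : option nat).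
Variables (N : nat) (jj : 'I_N -> tix b) (th : 'I_N -> M -> R)
  (F : forall i : 'I_N, R * R -> fib (jj i)) (C : 'I_N -> set (R * R)) (V : 'I_N -> set M).
Hypotheses (CF : forall i n, le_order n r -> Cplane n (strip alpha beta) (F i))
  (closedC : forall i, closed (C i))
  (F0 : forall i x, strip alpha beta x -> ~ C i x -> F i x = 0)
  (openV : forall i, open (V i))
  (Vsm : forall i i0 j, smooth_at_all (chart a i0 @` (cdom a i0 `&` (V i `&` tdom b j)))
     (piece_map Ab jj th i j \o cinv a i0))
  (WV : forall i (p : (R * R) * M), strip alpha beta p.1 -> W (p.1.2, p.2) -> C i p.1 -> V i p.2).

Let D : set ((R * R) * M) := [set p | strip alpha beta p.1 /\ W (p.1.2, p.2)].
Let u := glued Ab th F.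

Let chart_dom i0 j1 j2 : set ((R * R) * model i0) :=
  [set p | [/\ cimg a i0 p.2, D (p.1, cinv a i0 p.2), cdom a j1 (cinv a i0 p.2) &
     tdom b j2 (cinv a i0 p.2)]].

Let in_chart i0 j1 j2 (p : (R * R) * model i0) : model j1 * fib j2 :=
  scale_fst (trans a i0 j1 p.2) 1 +
  \sum_(i < N) eval_snd (piece_map Ab jj th i j2 (cinv a i0 p.2)) (F i p.1).

Let openU j : open (tdom b j). Proof. by case: Ab. Qed.
Let openD i : open (cdom a i). Proof. by case: Ma. Qed.

(** Each summand is a bilinear product whose parameter factor [F i] vanishes off the closed set
    [C i], and whose point factor is smooth over [V i]. [WV] ensures that y lies in [V i] wherever
    [F i] may be nonzero. *)
Lemma in_chart_Crs i0 j1 j2 : Crs_on r None (@chart_dom i0 j1 j2) (@in_chart i0 j1 j2).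
Proof.
apply: Crs_onD.
  apply: (Crs_on_bilinear (B := @scale_fst R _ _) (D := strip alpha beta) (C := setT)
    (f := cst (1 : R)) (O := chart a i0 @` (cdom a i0 `&` cdom a j1)) (h := trans a i0 j1)).
  - exact: scale_fst_linearl.
  - exact: scale_fst_linearr.
  - exact: scale_fst_continuous.
  - exact: fat_strip.
  - exact: closedT.
  - by move=> x _ [].
  - by move=> n _; exact: Cplane_cst.
  - exact: chart_image_open.
  - by case: Ma => _ _ _ _ _ _ _ tr; apply: Cr_on_smooth (tr i0 j1) => //; exact: chart_image_open.
  - move=> p [Ip [Sp Wp] D1 U2]; split => // _.
    by apply/(chart_imageE Ma).
apply: Crs_on_sum => i.
apply: (Crs_on_bilinear (B := @eval_snd R _ _ _) (D := strip alpha beta) (C := C i)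
    (f := F i) (O := chart a i0 @` (cdom a i0 `&` (V i `&` tdom b j2)))
    (h := piece_map Ab jj th i j2 \o cinv a i0)) => //.
- exact: eval_snd_linearl.
- exact: eval_snd_linearr.
- exact: eval_snd_continuous.
- exact: fat_strip.
- exact: F0.
- exact: CF.
- by apply: chart_image_open => //; exact: openI.
- move=> p [Ip [Sp Wp] D1 U2]; split => // Cp.
  apply/(chart_imageE Ma); split => //; split => //.
  by apply: (WV (p := (p.1, cinv a i0 p.2))).
Qed.

Lemma in_chartE i0 j1 j2 p : @chart_dom i0 j1 j2 p ->
  @in_chart i0 j1 j2 p =
  (chart a j1 (proj b (u (p.1, cinv a i0 p.2))), triv b j2 (u (p.1, cinv a i0 p.2))).
Proof.
move=> [Ip Dp D1 U2]; rewrite proj_glued triv_glued//=.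
rewrite /in_chart /scale_fst /eval_snd /= scale1r.
have -> : \sum_(i < N) ((0 : model j1), piece_map Ab jj th i j2 (cinv a i0 p.2) (F i p.1)) =
    ((0 : model j1), \sum_(i < N) piece_map Ab jj th i j2 (cinv a i0 p.2) (F i p.1)).
  by elim/big_rec2: _ => // i x _ _ ->; congr pair; rewrite /= add0r.
by congr pair; rewrite /= ?addr0 ?add0r.
Qed.

(** Near a given point one chart and one trivialization suffice: there [u] is [tinv] applied to the
    fibre component of [in_chart], which is already known to be continuous. *)
Lemma glued_continuous : {within D, continuous u}.
Proof.
apply/subspace_continuousP => -[x y] [/= Sx Wy].
case: (Ma) => _ _ cov oI cK cc _ _; have [i0 Di0] := cov y.
have U2 := local_indexP Ab y; set j := local_index Ab y in U2.
case: (Ab) => _ _ _ _ tK _ tc _.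
have cS : @chart_dom i0 i0 j (x, chart a i0 y).
  by split; rewrite /= ?cK//; exists y.
have [/subspace_continuousP/(_ _ cS) c1 _ _ _] := in_chart_Crs i0 i0 j.
have n1 : \forall q \near (x, y), cdom a i0 q.2 by exact: (cvg_snd (open_nbhs_nbhs (conj (openD i0) Di0))).
have n2 : \forall q \near (x, y), tdom b j q.2 by exact: (cvg_snd (open_nbhs_nbhs (conj (openU j) U2))).
have cy : chart a i0 @ y --> chart a i0 y.
  have /subspace_continuousP/(_ _ Di0) := cc i0.
  by rewrite within_interior// (iffLR (interior_id _) (openD i0)).
pose DD := D `&` [set q | cdom a i0 q.2 /\ tdom b j q.2].
have sub q : DD q -> @chart_dom i0 i0 j (q.1, chart a i0 q.2).
  by case: q => q1 q2 [Dq [/= Dq' Uq]]; split; rewrite /= ?cK//; exists q2.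
have c2 : (fun q : (R * R) * M => (q.1, chart a i0 q.2)) @ within DD (nbhs (x, y)) --> (x, chart a i0 y).
  apply: cvg_within_filter; apply: cvg_pair_point; first exact: cvg_fst.
  by apply: cvg_comp cy; exact: cvg_snd.
have c3 := within_comp c2 sub c1.
have uE q : DD q -> u q = tinv b j q.2 (@in_chart i0 i0 j (q.1, chart a i0 q.2)).2.
  move=> Dq; rewrite in_chartE; last exact: sub.
  case: q Dq => q1 q2 [Dq [/= Dq' Uq]]; rewrite /= cK//.
  have pq : proj b (u (q1, q2)) = q2 by rewrite proj_glued.
  by have := tK j (u (q1, q2)); rewrite pq => ->.
have DDxy : DD (x, y) by [].
have c4 : (fun q : (R * R) * M => (q.2, (@in_chart i0 i0 j (q.1, chart a i0 q.2)).2)) @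
    within DD (nbhs (x, y)) --> (y, (@in_chart i0 i0 j (x, chart a i0 y)).2).
  apply: cvg_pair_point; first by apply: cvg_within_filter; exact: cvg_snd.
  by apply: cvg_comp c3 _; exact: cvg_snd.
have tc' : (fun p : M * fib j => tinv b j p.1 p.2) @
    (y, (@in_chart i0 i0 j (x, chart a i0 y)).2) -->
    tinv b j y (@in_chart i0 i0 j (x, chart a i0 y)).2.
  have Ux : (tdom b j `*` setT) (y, (@in_chart i0 i0 j (x, chart a i0 y)).2) by split.
  have /subspace_continuousP/(_ _ Ux) := tc j.
  rewrite within_interior//.
  have nU : nbhs y (tdom b j) := open_nbhs_nbhs (conj (openU j) U2).
  exists (tdom b j, setT); last by [].
  by split; [exact: nU|exact: filterT].
have c5 := cvg_comp _ _ c4 tc'.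
rewrite -(uE (x, y) DDxy) in c5 => Vn /c5 H.
have {}H : \forall q \near (x, y), DD q ->
    Vn (tinv b j q.2 (@in_chart i0 i0 j (q.1, chart a i0 q.2)).2) := H.
change (\forall q \near (x, y), D q -> Vn (u q)).
by apply: filterS3 H n1 n2 => q H D1 D2 Dq; rewrite uE//; exact: H.
Qed.

Lemma glued_Crs : Crs_map a (total_atlas a b) r None D u.
Proof.
split; first exact: glued_continuous.
move=> i0 [j1 j2] fi /=.
have -> : [set p | [/\ cimg a i0 p.2, D (p.1, cinv a i0 p.2) &
    (proj b @^-1` (cdom a j1 `&` tdom b j2)) (fi p)]] = @chart_dom i0 j1 j2.
  apply/seteqP; split => p [Ip Dp].
    by rewrite /preimage /= proj_glued => -[D1 U2].
  by move=> D1 U2; split => //; rewrite /preimage /= proj_glued.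
by apply: Crs_on_eq (in_chart_Crs i0 j1 j2) => p /in_chartE.
Qed.

End glued_smooth.

Lemma Cplane_linear {R : realType} {E F : normedModType R} (L : E -> F) n D (f : R * R -> E) :
  linear L -> continuous L -> Cplane n D f -> Cplane n D (L \o f).
Proof.
move=> lL cL; have cont (g : R * R -> E) : {within D, continuous g} -> {within D, continuous (L \o g)}.
  move=> /subspace_continuousP cg; apply/subspace_continuousP => p Dp.
  by apply: cvg_comp (cg p Dp) _; exact: cL.
elim: n f => [|n IH] f [cf Hf]; first by split => //; exact: cont.
split; first exact: cont.
move: Hf => [f1 [f2 [F1 F2 F3]]]; exists (L \o f1), (L \o f2).
split; [exact: IH|exact: IH|move=> p /F3[d1 d2]].
by split; exact: is_derive_linear.
Qed.

(** * The adapted section obtained from a partition of the parameter rectangle *)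

Section adapted.
Context {R : realType} {M A : topologicalType} {a : atlas R M} {b : vbundle R M A}.
Hypotheses (Ma : banach_manifold a) (Ab : banach_vector_bundle a b).
Variables (gamma : R * R -> M) (eta : R) (l : option nat) (c : R * R -> A).
Hypotheses (eta0 : 0 < eta)
  (cC : Cr_map (total_atlas a b) l unit_square c)
  (pc : forall p, unit_square p -> proj b (c p) = gamma p).
Variables (alpha beta : R) (I : set R) (W : set (R * M)).
Hypotheses (ltab : alpha < beta) (alpha0 : 0 <= alpha) (beta1 : beta <= 1)
  (IE : forall e, I e <-> alpha <= e <= beta).
Variables (N : nat) (jj : 'I_N -> tix b) (th : 'I_N -> M -> R) (psi : 'I_N -> R * R -> R)
  (t_ : 'I_N -> R) (V : 'I_N -> set M) (rho : R).
Local Notation rect := (rect alpha beta).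
Local Notation strip := (strip alpha beta).
Hypotheses (rho0 : 0 < rho)
  (psiC : forall i n, Cplane n rect (psi i))
  (psi_near : forall i p, rect p -> tdom b (jj i) (gamma p) \/
     exists O, [/\ open O, O p & forall q, rect q -> O q -> psi i q = 0])
  (psi_supp : forall i p, rect p -> psi i p != 0 ->
     `|p.2 - t_ i| <= rho /\ th i (gamma p) = 1)
  (psi_sum : forall p, rect p -> \sum_(i < N) psi i p = 1)
  (openV : forall i, open (V i))
  (Vsm : forall i i0 j, smooth_at_all (chart a i0 @` (cdom a i0 `&` (V i `&` tdom b j)))
     (piece_map Ab jj th i j \o cinv a i0))
  (WV : forall i e t y, I e -> W (t, y) -> `|t - t_ i| <= 2 * rho -> V i y).

Let piece i (p : R * R) : fib (jj i) := psi i p *: triv b (jj i) (c p).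

Let rect_square p : rect p -> unit_square p.
Proof.
case: p => e t [/= /andP[ae eb] t01]; split; rewrite /= in_itv //=.
by rewrite (le_trans alpha0 ae) (le_trans eb beta1).
Qed.

Let psi_dom i p : rect p -> psi i p != 0 -> tdom b (jj i) (gamma p).
Proof.
move=> Rp p0; case: (psi_near i Rp) => // -[O [_ Op Oz]].
by move: p0; rewrite (Oz p Rp Op) eqxx.
Qed.

(** [triv b (jj i) (c p)] carries no information where [gamma p] leaves the trivializing domain, but
    by [psi_near] the factor [psi i] then vanishes in a neighbourhood. Elsewhere the fibre
    coordinate is the second component of [c] in a bundle chart. *)
Let piece_Cplane i n : le_order n l -> Cplane n rect (piece i).
Proof.
move=> le; apply: Cplane_local; first exact: fat_rect.
move=> p Rp; case: (psi_near i Rp) => [Ui|[O [oO Op Oz]]]; last first.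
  exists O; split => //; apply: Cplane_eq (Cplane_cst n _ 0) => q [Rq Oq].
  by rewrite /piece Oz// scale0r.
case: (Ma) => _ oD cov _ _ _ _ _; have [i1 Di1] := cov (gamma p).
case: (Ab) => projc oU _ _ _ _ _ _.
have Sp := rect_square Rp.
pose O := proj b @^-1` (cdom a i1 `&` tdom b (jj i)).
have oO : open O.
  by apply: open_comp; [move=> q _; exact: projc|exact: openI].
have Oc : O (c p) by rewrite /O /preimage /= pc.
have [/subspace_continuousP/(_ _ Sp) cc cr] := cC.
have : \forall q \near p, unit_square q -> O (c q).
  exact: (cc _ (open_nbhs_nbhs (conj oO Oc))).
move=> Bp; pose B := interior [set q | unit_square q -> O (c q)].
have HB q : B q -> unit_square q -> O (c q) by move/interior_subset.
exists B; split; [exact: open_interior|exact: Bp|]; apply: CplaneZ; first by apply: Cplane_sub (psiC i n) => q [].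
have C1 := Cr_on_Cplane (cr (i1, jj i)) le.
have C2 := Cplane_linear (L := snd) _ _ C1.
apply: (Cplane_sub _ (C2 _ _)).
- move=> q [Rq Bq]; split; first exact: rect_square.
  by apply: HB => //; exact: rect_square.
- by move=> d x y.
- by move=> q; exact: cvg_snd.
Qed.

(** The bound 1/2 separates the two collars, [eta / 2] makes the extension vanish where constancy in
    t is required, and [rho / 2] lets it enlarge supports by at most [rho]. *)
Let tau : R := Num.min (Num.min (1 / 2) (eta / 2)) (rho / 2).

Let tauP : [/\ 0 < tau, tau <= 1 / 2, tau <= eta / 2 & 2 * tau <= rho].
Proof.
split.
- by rewrite !lt_min !divr_gt0.
- by rewrite /tau !ge_min lexx.
- by rewrite /tau !ge_min lexx orbT.
- by have : tau <= rho / 2 by [rewrite /tau !ge_min lexx orbT]; lra.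
Qed.

Let ext_exists i : exists F : R * R -> fib (jj i),
  [/\ forall n, le_order n l -> Cplane n strip F,
      forall p, rect p -> F p = piece i p,
      forall p, strip p -> p.2 <= - tau \/ 1 + tau <= p.2 -> F p = 0
    & forall p, strip p ->
        (forall t, 0 <= t <= 1 -> `|t - p.2| <= 2 * tau -> piece i (p.1, t) = 0) ->
        F p = 0].
Proof. by case: tauP => *; apply: extend_Cplane => // n; exact: piece_Cplane. Qed.

(** On the curve the pieces add up to [c] because the [psi i] sum to 1 and [th i] is 1 wherever
    [psi i] is nonzero. *)
Lemma adapted_section_exists : exists u, adapted_section a b gamma eta l I W c u.
Proof.
have [F FP] : exists F : forall i, R * R -> fib (jj i), forall i,
    [/\ forall n, le_order n l -> Cplane n strip (F i),
      forall p, rect p -> F i p = piece i p,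
      forall p, strip p -> p.2 <= - tau \/ 1 + tau <= p.2 -> F i p = 0
    & forall p, strip p ->
        (forall t, 0 <= t <= 1 -> `|t - p.2| <= 2 * tau -> piece i (p.1, t) = 0) ->
        F i p = 0].
  by exists (fun i => projT1 (cid (ext_exists i))) => i; exact: (projT2 (cid (ext_exists i))).
have [tau0 tau1 taue taur] := tauP.
exists (glued Ab th F).
have piece0 i p : rect p -> psi i p = 0 -> piece i p = 0.
  by move=> _ p0; rewrite /piece p0 scale0r.
have rectI e t : I e -> 0 <= t <= 1 -> rect (e, t) by move=> /IE.
split.
(* [psi i] lives within [rho] of [t_ i], and the extension reaches [2 * tau <= rho] further. *)
- pose C i : set (R * R) := [set x | `|x.2 - t_ i| <= 2 * rho].
  have cl i : closed (C i).
    apply: (@closed_comp _ _ (fun x : R * R => `|x.2 - t_ i|) [set y | y <= 2 * rho]).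
      move=> q _; apply: (cvg_comp (fun x : R * R => x.2 - t_ i) (fun y : R => `|y|)).
        by apply: cvgB; [exact: cvg_snd|exact: cvg_cst].
      exact: norm_continuous.
    exact: closed_le.
  have -> : [set p : R * R * M | I p.1.1 /\ W (p.1.2, p.2)] =
      [set p : (R * R) * M | strip p.1 /\ W (p.1.2, p.2)].
    by apply/seteqP; split => p [/IE].
  apply: (glued_Crs Ma ltab (C := C) (V := V)) => //.
  + by move=> i n le; case: (FP i) => H _ _ _; exact: H.
  + move=> i x Sx nC; case: (FP i) => _ _ _ H; apply: H => // t t01 tx.
    have Rt : rect (x.1, t) by split.
    have [|p0] := eqVneq (psi i (x.1, t)) 0; first exact: piece0.
    have [/= H _] := psi_supp Rt p0; exfalso; apply: nC; rewrite /C /=.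
    have := ler_distD t x.2 (t_ i); rewrite [`|x.2 - t|]distrC; have := taur; lra.
  + by move=> i p Sp Wp Cp; exact: (WV (iffRL (IE p.1.1) Sp) Wp Cp).
- by move=> e t y _ _; rewrite proj_glued.
- move=> e t Ie t01; have Rp := rectI e t Ie t01.
  have Sp := rect_square Rp; have pcE := pc Sp.
  have Uj := local_indexP Ab (gamma (e, t)); set j := local_index _ _ in Uj.
  apply: (total_eq Ab (j := j)); rewrite ?proj_glued//= triv_glued//=.
  rewrite -[RHS]scale1r -(psi_sum Rp) scaler_suml; apply: eq_bigr => i _.
  case: (FP i) => _ -> // _ _; have [p0|p0] := eqVneq (psi i (e, t)) 0.
    by rewrite piece0// p0 scale0r clinear_eval0.
  have Ui := psi_dom Rp p0; rewrite /piece clinearZ; congr (_ *: _).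
  rewrite /piece_map; case: pselect => // ?.
  have [_ ->] := psi_supp Rp p0; rewrite scale1r -transitionE//.
  by case: (Ab) => _ _ _ _ tK _ _ _; rewrite -pcE tK// pcE.
- move=> e t t' y Ie _ _ tt'.
  (* These times are beyond the reach [tau] of the extension, so the section is zero at both of
     them. *)
  have z i (x : R) : (- eta <= x <= - (eta / 2)) \/ (1 + eta / 2 <= x <= 1 + eta) ->
      F i (e, x) = 0.
    move=> xx; case: (FP i) => _ _ H _; apply: H => /=; first exact/IE.
    by have := taue; case: xx => /andP[? ?]; [left|right]; lra.
  rewrite /glued /=; congr (tinv b _ _ _); apply: eq_bigr => i _.
  by case: tt' => -[h1 h2]; rewrite !z; auto.
move=> e t Ie t01 zc y _.
have Rp : rect (e, t) by apply: rectI => //; case: t01 => ->; rewrite ?lexx ?ler01.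
have Sp := rect_square Rp; have pcE := pc Sp.
exists (local_index Ab y); first by rewrite proj_glued; exact: local_indexP.
rewrite triv_glued; last exact: local_indexP.
apply: big1 => i _ /=; case: (FP i) => _ -> // _ _.
have [p0|p0] := eqVneq (psi i (e, t)) 0; first by rewrite piece0// clinear_eval0.
rewrite /piece (zero_vector_triv Ab zc) ?scaler0 ?clinear_eval0// pcE.
exact: psi_dom.
Qed.

End adapted.

(** * Partition of the parameter domain and conclusion *)

Section partition.
Context {R : realType}.

(** Smooth bump of radius 1/m around i/m, written as a difference of consecutive translates of
    [step] so that the sum over [i] telescopes. *)
Definition hat (m i : nat) (x : R) : R :=
  step (m%:R * x - i%:R + 1) - step (m%:R * x - i%:R).

Lemma hat_out m i x : (0 < m)%N -> m%:R^-1 <= `|x - i%:R / m%:R| -> hat m i x = 0.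
Proof.
move=> m0; have m0' : 0 < m%:R :> R by rewrite ltr0n.
have -> : x - i%:R / m%:R = (m%:R * x - i%:R) / m%:R.
  by rewrite mulrBl mulrAC divff ?mul1r// gt_eqF.
rewrite normrM normfV [`|m%:R|]gtr0_norm// -[X in X <= _]mul1r ler_pM2r ?invr_gt0//.
rewrite /hat; set y := _ - _; rewrite ler_normr => /orP[y1|y1].
  by rewrite !step_ge1 ?subrr//; lra.
by rewrite !step_le0 ?subrr//; lra.
Qed.

Lemma hat_sum m x : 0 <= x <= 1 -> \sum_(i < m.+1) hat m i x = 1.
Proof.
move=> /andP[x0 x1].
have H k : \sum_(i < k) hat m i x = step (m%:R * x + 1) - step (m%:R * x - k%:R + 1).
  elim: k => [|k IH]; first by rewrite big_ord0 subr0 subrr.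
  rewrite big_ord_recr /= IH /hat; set A := step (_ + 1); set B := step _.
  have -> : m%:R * x - k.+1%:R + 1 = m%:R * x - k%:R by rewrite -[k.+1]addn1 natrD; lra.
  by rewrite addrA subrK.
rewrite H step_ge1 ?step_le0 ?subr0//.
  by rewrite -[m.+1]addn1 natrD; have : m%:R * x <= m%:R :> R; [rewrite ler_piMr|lra].
by rewrite lerDr mulr_ge0.
Qed.

Lemma Cplane_hat_snd n D m i : Cplane n D (fun p : R * R => hat m i p.2).
Proof.
have H1 := Cplane_step n D 0 (m%:R : R) (1 - i%:R).
have H2 := CplaneZ (Cplane_cst n D (-1 : R)) (Cplane_step n D 0 (m%:R : R) (- i%:R)).
apply: Cplane_eq (CplaneD H1 H2) => p _; rewrite /hat /= scaleN1r mul0r add0r.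
by congr (step _ - step _); rewrite ?addrA//; lra.
Qed.

Lemma Cplane_hat_fst n D m i : Cplane n D (fun p : R * R => hat m i p.1).
Proof.
have H1 := Cplane_step n D (m%:R : R) 0 (1 - i%:R).
have H2 := CplaneZ (Cplane_cst n D (-1 : R)) (Cplane_step n D (m%:R : R) 0 (- i%:R)).
apply: Cplane_eq (CplaneD H1 H2) => p _; rewrite /hat /= scaleN1r mul0r addr0.
by congr (step _ - step _); lra.
Qed.

End partition.

Section lebesgue_number.
Context {R : realType} {M : topologicalType}.

(** Compactness as a near-covering property gives one [n] for all points. The factor 3 leaves room
    for the support of a bump (one mesh width) together with its enlargement by the extension (one
    more). *)
Lemma lebesgue_number (Q : set (R * R)) (g : R * R -> M) (I : Type) (U : I -> set M) :
  compact Q -> {within Q, continuous g} -> (forall i, open (U i)) ->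
  (forall x, exists i, U i x) ->
  exists n : nat, forall p, Q p -> exists i, forall q, Q q ->
    `|q.1 - p.1| <= 3 / n.+1%:R -> `|q.2 - p.2| <= 3 / n.+1%:R -> U i (g q).
Proof.
move=> cQ /subspace_continuousP gc oU covU.
pose P (n : nat) (p : R * R) := exists i, forall q, Q q ->
    `|q.1 - p.1| <= 3 / n.+1%:R -> `|q.2 - p.2| <= 3 / n.+1%:R -> U i (g q).
have /near_covering_withinP cov : near_covering Q by apply/compact_near_coveringP.
have H : \forall n \near \oo, Q `<=` P n.
  apply: cov => p Qp; have [i Ui] := covU (g p).
  have : \forall q \near p, Q q -> U i (g q).
    exact: (gc p Qp _ (open_nbhs_nbhs (conj (oU i) Ui))).
  move=> /nbhs_ballP[r /= r0 Hr].
  (* With mesh below [r / 6] the box has half-side below [r / 2]; centred within [r / 2] of [p], it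
     stays in the ball of radius [r]. *)
  have r6 : 0 < r / 6 by rewrite divr_gt0.
  have r2 : 0 < r / 2 by rewrite divr_gt0.
  exists (ball p (r / 2), [set n | n.+1%:R^-1 < r / 6]).
    split; first exact: nbhsx_ballx.
    apply: filterS (nbhs_infty_ge (Num.truncn (r / 6)^-1)) => n /= Kn.
    rewrite invf_plt ?posrE ?ltr0n//; apply: lt_le_trans (truncnS_gt _) _.
    by rewrite ler_nat ltnS.
  move=> [p' n] [/= [p1 p2] n6] Qp'; exists i => q Qq q1 q2; apply: Hr => //.
  have n3 : 3 / n.+1%:R < r / 2.
    by move: n6 => /=; set z := _^-1; lra.
  split; rewrite /ball /=.
    have := ler_distD p'.1 p.1 q.1; rewrite [`|p'.1 - q.1|]distrC.
    by move: p1; rewrite /ball /=; move: q1 n3; set z := 3 / _; lra.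
  have := ler_distD p'.2 p.2 q.2; rewrite [`|p'.2 - q.2|]distrC.
  by move: p2; rewrite /ball /=; move: q2 n3; set z := 3 / _; lra.
have [n Hn] := filter_ex H; by exists n.
Qed.

End lebesgue_number.

Section smoothness_of_pieces.
Context {R : realType} {M A : topologicalType} {a : atlas R M} {b : vbundle R M A}.
Hypotheses (Ma : banach_manifold a) (Ab : banach_vector_bundle a b).
Variables (N : nat) (jj : 'I_N -> tix b).

Let openU j : open (tdom b j). Proof. by case: Ab. Qed.

Lemma piece_map_smooth (th : 'I_N -> M -> R) i i0 j :
  smooth_at_all (chart a i0 @` (cdom a i0 `&` setT)) (th i \o cinv a i0) ->
  smooth_at_all (chart a i0 @` (cdom a i0 `&` (tdom b (jj i) `&` tdom b j)))
    (piece_map Ab jj th i j \o cinv a i0).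
Proof.
move=> sth; have oO : open (tdom b (jj i) `&` tdom b j) by exact: openI.
have oI := chart_image_open Ma i0 oO.
apply: (@smooth_at_all_eq _ _ _ _
   (fun z => (th i \o cinv a i0) z *: (transition Ab (jj i) j \o cinv a i0) z)) => //.
  move=> z /(chart_imageE Ma)[_ [Ui _]] /=.
  by rewrite /piece_map; case: pselect.
apply: smooth_at_allZ => //.
  apply: smooth_at_all_sub sth => z /(chart_imageE Ma)[Iz _].
  by apply/(chart_imageE Ma).
apply: (smooth_fun_chart Ma (S := tdom b (jj i) `&` tdom b j)) => //.
exact: transition_smooth.
Qed.

(** Two open sets cover: over the trivializing domain the piece is a product of smooth maps, and off
    the closed support of [th i] it is 0. *)
Lemma piece_map_smooth_supp (th : 'I_N -> M -> R) i i0 j :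
  smooth_fun a setT (th i) -> closure [set x | th i x != 0] `<=` tdom b (jj i) ->
  smooth_at_all (chart a i0 @` (cdom a i0 `&` (setT `&` tdom b j)))
    (piece_map Ab jj th i j \o cinv a i0).
Proof.
move=> sth supp; pose Z := ~` closure [set x | th i x != 0].
have oZ : open Z by apply: closed_openC; exact: closed_closure.
have S1 := piece_map_smooth j (smooth_fun_chart Ma i0 sth openT (@subset_refl _ setT)).
have S2 : smooth_at_all (chart a i0 @` (cdom a i0 `&` (Z `&` tdom b j)))
    (piece_map Ab jj th i j \o cinv a i0).
  have oO : open (Z `&` tdom b j) by exact: openI.
  apply: smooth_at_all_eq (smooth_at_all_cst _ 0); first exact: chart_image_open.
  move=> z /(chart_imageE Ma)[_ [Zz _]] /=; rewrite /piece_map; case: pselect => // Ui.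
  have -> : th i (cinv a i0 z) = 0; last by rewrite scale0r.
  by apply/eqP/negPn/negP => h; apply: Zz; exact: subset_closure.
apply: smooth_at_all_sub (smooth_at_allU S1 S2) => z.
move=> /(chart_imageE Ma)[Iz [_ Uj]].
have [Zz|/contrapT Zz] := pselect (Z (cinv a i0 z)).
  by right; apply/(chart_imageE Ma).
by left; apply/(chart_imageE Ma); do 2 split => //; exact: supp.
Qed.

(** In a partition of unity subordinate to [U] and the complement of [K], the second function
    vanishes on [K], so the first is 1 there. *)
Lemma bump_exists (K U : set M) : smoothly_paracompact a -> closed K -> open U -> K `<=` U ->
  exists h : M -> R, [/\ smooth_fun a setT h,
    closure [set x | h x != 0] `<=` U & forall x, K x -> h x = 1].
Proof.
move=> spc cK oU KU; pose O (i : bool) := if i then U else ~` K.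
have [||h] := spc bool O.
- by case; rewrite /O //; exact: closed_openC.
- apply/seteqP; split => // x _; have [Kx|nKx] := pselect (K x).
    by exists true => //; exact: KU.
  by exists false.
move=> [hs _ hsupp _ hsum]; exists (h true); split; [exact: hs|exact: (hsupp true)|].
move=> x Kx; rewrite -(hsum x).
have h0 : h false x = 0.
  apply/eqP/negPn/negP => hx; have := hsupp false x.
  by rewrite /O /=; apply => //; exact: subset_closure.
rewrite -(@fsbig_widen _ _ _ _ [set true]) ?fsbig_set1//.
by move=> [|] [_ /=].
Qed.

End smoothness_of_pieces.

(** The premise on t is a closed condition, so each implication is an open one, and there are
    finitely many. *)
Lemma open_tube {R : realType} {M : topologicalType} (N : nat) (t_ : 'I_N -> R) (rho : R)
    (U : 'I_N -> set M) : (forall i, open (U i)) ->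
  open [set p : R * M | forall i, `|p.1 - t_ i| <= rho -> U i p.2].
Proof.
move=> oU; rewrite openE => p Hp; 
suff H i : \forall q \near p, `|q.1 - t_ i| <= rho -> U i q.2.
  exact: (filter_forall (nbhs_filter p) H).
have [le|gt] := leP `|p.1 - t_ i| rho.
  have n1 : \forall q \near p, U i q.2.
    exact: (cvg_snd (open_nbhs_nbhs (conj (oU i) (Hp i le)))).
  by apply: filterS n1.
have cn : (fun q : R * M => `|q.1 - t_ i|) @ p --> `|p.1 - t_ i|.
  apply: (cvg_comp (fun x : R * M => x.1 - t_ i) (fun y : R => `|y|)).
    by apply: cvgB; [exact: cvg_fst|exact: cvg_cst].
  exact: norm_continuous.
have n1 : \forall q \near p, rho < `|q.1 - t_ i| by exact: (cn _ (lt_nbhsr gt)).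
by apply: filterS n1 => q; rewrite ltNge => /negP q1 /q1.
Qed.

Lemma open_norm_gt {R : realType} (g : R * R -> R) (x r : R) : continuous g ->
  open [set q | r < `|g q - x|].
Proof.
move=> gc; rewrite (_ : [set _ | _] = (fun q => `|g q - x|) @^-1` [set y | r < y])//.
apply: open_comp; last exact: open_gt.
move=> q _; apply: (cvg_comp (fun q => g q - x) (fun y : R => `|y|)).
  by apply: cvgB; [exact: gc|exact: cvg_cst].
exact: norm_continuous.
Qed.

Lemma hat_neq0 {R : realType} m i (x : R) : (0 < m)%N -> hat m i x != 0 ->
  `|x - i%:R / m%:R| <= m%:R^-1.
Proof. by move=> m0; apply: contraNT; rewrite -ltNge => /ltW /(hat_out m0) ->. Qed.

Theorem theoremA (R : realType) (M A : topologicalType)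
  (a : atlas R M) (b : vbundle R M A)
  (M_manifold : banach_manifold a)
  (A_bundle : banach_vector_bundle a b)
  (A_connection : inhabited (linear_connection a b))
  (TM_connection : inhabited (linear_connection a (tangent_bundle a)))
  (M_regular : regular_space M)
  (k : option nat) (k_ge2 : le_order 2 k)
  (gamma : R * R -> M)
  (gamma_Ck : Cr_map a k unit_square gamma)
  (gamma_start : forall e : R, 0 <= e <= 1 -> gamma (e, 0) = gamma (0, 0))
  (gamma_end : forall e : R, 0 <= e <= 1 -> gamma (e, 1) = gamma (0, 1))
  (eta : R) (eta_gt0 : 0 < eta)
  (ghat : R * R -> M)
  (ghat_Ck : Cr_map a k ([set p : R * R | 0 <= p.1 <= 1 /\ - eta <= p.2 <= 1 + eta]) ghat)
  (ghat_ext : forall e t : R, 0 <= e <= 1 -> 0 <= t <= 1 ->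
    ghat (e, t) = gamma (e, t))
  (ghat_left : forall e t : R, 0 <= e <= 1 -> - eta <= t <= - (eta / 2) ->
    ghat (e, t) = gamma (e, 0))
  (ghat_right : forall e t : R, 0 <= e <= 1 -> 1 + eta / 2 <= t <= 1 + eta ->
    ghat (e, t) = gamma (e, 1)) :
  let J : set R := `[- eta, 1 + eta]%classic in
  (forall s : R, 0 <= s <= 1 ->
    exists (delta : R) (W : set (R * M)),
      let I : set R := `[0, 1]%classic `&` `[s - delta, s + delta]%classic in
      [/\ 0 < delta,
          (exists2 O : set (R * M), open O & W = (J `*` setT) `&` O),
          (forall e t : R, I e -> J t -> W (t, ghat (e, t)))
        & forall l : option nat, (forall j, le_order j l -> le_order j k) ->
          forall c : R * R -> A,
            Cr_map (total_atlas a b) l unit_square c ->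
            (forall p, unit_square p -> proj b (c p) = gamma p) ->
          exists u : (R * R) * M -> A, adapted_section a b gamma eta l I W c u])
  /\
  (smoothly_paracompact a ->
    forall l : option nat, (forall j, le_order j l -> le_order j k) ->
    forall c : R * R -> A,
      Cr_map (total_atlas a b) l unit_square c ->
      (forall p, unit_square p -> proj b (c p) = gamma p) ->
    exists u : (R * R) * M -> A,
      adapted_section a b gamma eta l `[0, 1]%classic (J `*` setT) c u).
Proof.
move=> J; have eta0 := eta_gt0.
pose Q : set (R * R) := [set p | 0 <= p.1 <= 1 /\ - eta <= p.2 <= 1 + eta].
have cQ : compact Q.
  have -> : Q = `[0, 1]%classic `*` `[- eta, 1 + eta]%classic.
    by apply/seteqP; split => p; rewrite /Q /= !in_itv.
  by apply: compact_setX; exact: segment_compact.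
case: (A_bundle) => _ openU _ _ _ _ _ _.
have covU := tdom_exists A_bundle.
have [n nP] := lebesgue_number cQ (ghat_Ck.1) openU covU.
set m := n.+1 in nP; have m0 : (0 < m)%N by [].
have rho0 : 0 < m%:R^-1 :> R by rewrite invr_gt0 ltr0n.
set rho : R := m%:R^-1 in rho0.
have rho3 : 3 / m%:R = 3 * rho by [].
have /choice[jf jP] : forall p, exists j, Q p -> forall q, Q q ->
    `|q.1 - p.1| <= 3 / m%:R -> `|q.2 - p.2| <= 3 / m%:R -> tdom b j (ghat q).
  move=> p; have [Qp|nQ] := pselect (Q p); first by have [j H] := nP p Qp; exists j.
  by have [j _] := covU (gamma p); exists j.
have node (i : 'I_m.+1) : 0 <= (i%:R / m%:R : R) <= 1.
  rewrite divr_ge0//= ler_pdivrMr ?ltr0n// mul1r ler_nat.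
  by rewrite -ltnS ltn_ord.
split.
  (* The mesh is uniform over all of [Q], so the same delta serves every [s]. *)
  move=> s /andP[s0 s1]; exists rho.
  pose t_ (i : 'I_m.+1) : R := i%:R / m%:R.
  pose jj (i : 'I_m.+1) := jf (s, t_ i).
  (* The nodes cover [0, 1] only. For t farther than [2 * rho] from every node nothing is required
     of y, since all pieces vanish there. *)
  pose W : set (R * M) := (J `*` setT) `&`
    [set p | forall i, `|p.1 - t_ i| <= 2 * rho -> tdom b (jj i) p.2].
  exists W => I.
  have Qc i : Q (s, t_ i).
    by have := node i; rewrite /Q /= s0 s1 -/(t_ i); split => //; lra.
  have IP e : I e <-> Num.max 0 (s - rho) <= e <= Num.min 1 (s + rho).
    rewrite /I /= !in_itv /= ge_max le_min; split.
      by move=> [/andP[-> ->] /andP[-> ->]].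
    by move=> /andP[/andP[-> ->] /andP[-> ->]].
  have Is e : I e -> `|e - s| <= rho /\ 0 <= e <= 1.
    rewrite /I /= !in_itv /= => -[-> /andP[h1 h2]]; split => //.
    by rewrite ler_norml; apply/andP; split; lra.
  have near_U i e t : I e -> J t -> `|t - t_ i| <= 2 * rho -> tdom b (jj i) (ghat (e, t)).
    move=> /Is[es e01]; rewrite /J /= in_itv /= => Jt tt.
    by apply: (jP _ (Qc i)) => //=; rewrite rho3; lra.
  split => //.
  - exists [set p | forall i, `|p.1 - t_ i| <= 2 * rho -> tdom b (jj i) p.2] => //.
    exact: (@open_tube _ _ _ t_ (2 * rho) _ (fun i => openU (jj i))).
  - by move=> e t Ie Jt; split => // i /=; exact: near_U.
  move=> l _ c cC pc.
  have rectI p : rect (Num.max 0 (s - rho)) (Num.min 1 (s + rho)) p ->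
      [/\ I p.1, J p.2 & ghat p = gamma p].
    move=> [/IP Ip p01]; have [_ e01] := Is _ Ip; split => //.
      by rewrite /J /= in_itv /=; case/andP: p01 => ? ?; apply/andP; split; lra.
    by case: p p01 Ip e01 => e t /= p01 _ e01; exact: ghat_ext.
  (* No cutoff on M is used: [th] is constantly 1, and [W] keeps y in the trivializing domain of
     each piece that may be nonzero. *)
  apply: (@adapted_section_exists _ _ _ _ _ M_manifold A_bundle _ _ _ _ eta0 cC pc
     (Num.max 0 (s - rho)) (Num.min 1 (s + rho)) I W _ _ _ IP _
     jj (fun _ _ => 1) (fun i p => hat m i p.2) t_ (fun i => tdom b (jj i)) rho rho0) => //.
  - by rewrite gt_max !lt_min; apply/andP; split; apply/andP; split; lra.
  - by rewrite le_max lexx.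
  - by rewrite ge_min lexx.
  - by move=> i j; exact: Cplane_hat_snd.
  - move=> i p /rectI[Ip Jp gp]; have [le|gt] := leP `|p.2 - t_ i| rho.
      by left; rewrite -gp [p]surjective_pairing; apply: near_U => //; lra.
    right; exists [set q | rho < `|q.2 - t_ i|]; split => //.
      by apply: open_norm_gt => q; exact: cvg_snd.
    by move=> q _ /ltW; exact: hat_out.
  - by move=> i p _ /(hat_neq0 m0).
  - by move=> p [_ p01]; exact: hat_sum.
  - by move=> i i0 j; apply: piece_map_smooth => //; exact: smooth_at_all_cst.
  - by move=> i e t y _ [_ H]; exact: H.
move=> spc l _ c cC pc.
(* With eps ranging over all of [0, 1], the trivialization must also change with eps, so the nodes
   form a grid, enumerated by an ordinal. *)
pose T : finType := ('I_m.+1 * 'I_m.+1)%type.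
pose e_ (i : 'I_#|T|) : R := (enum_val i).1%:R / m%:R.
pose t_ (i : 'I_#|T|) : R := (enum_val i).2%:R / m%:R.
pose jj (i : 'I_#|T|) := jf (e_ i, t_ i).
pose psi (i : 'I_#|T|) (p : R * R) : R := hat m (enum_val i).1 p.1 * hat m (enum_val i).2 p.2.
have Qc i : Q (e_ i, t_ i).
  have := node (enum_val i).1; have := node (enum_val i).2.
  by rewrite /Q /= -/(t_ i) -/(e_ i); split => //; lra.
(* The part of the surface on which [psi i] may be nonzero. It is compact, hence closed in the
   Hausdorff space M, so a bump equal to 1 on it with support in the trivializing domain exists. *)
pose K i : set M := ghat @` (Q `&` ([set q | `|q.1 - e_ i| <= rho] `&` [set q | `|q.2 - t_ i| <= rho])).
have cK i : closed (K i).
  case: (M_manifold) => hM _ _ _ _ _ _ _; apply: compact_closed => //.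
  apply: continuous_compact.
    by apply: continuous_subspaceW (ghat_Ck.1) => q [].
  apply: compact_closedI => //.
  have E (g : R * R -> R) x : continuous g -> closed [set q | `|g q - x| <= rho].
    move=> gc; rewrite (_ : [set _ | _] = ~` [set q | rho < `|g q - x|]).
      by apply: open_closedC; exact: open_norm_gt.
    by apply/seteqP; split => q /=; rewrite leNgt => /negP.
  by apply: closedI; apply: E => q; [exact: cvg_fst|exact: cvg_snd].
have KU i : K i `<=` tdom b (jj i).
  move=> _ [q [Qq [/= q1 q2]] <-].
  by apply: (jP _ (Qc i)) => //=; rewrite rho3; lra.
have /choice[th thP] : forall i, exists h : M -> R, [/\ smooth_fun a setT h,
    closure [set x | h x != 0] `<=` tdom b (jj i) & forall x, K i x -> h x = 1].
  by move=> i; exact: bump_exists.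
have rectQ p : rect 0 1 p -> Q p /\ ghat p = gamma p.
  move=> [p1 p2]; split.
    by split => //; case/andP: p2 => ? ?; apply/andP; split; lra.
  by case: p p1 p2 => e t /= p1 p2; exact: ghat_ext.
have IE e : (`[0, 1]%classic : set R) e <-> 0 <= e <= 1 by rewrite /= in_itv.
have inK i p : rect 0 1 p -> `|p.1 - e_ i| <= rho -> `|p.2 - t_ i| <= rho -> K i (gamma p).
  by move=> Rp h1 h2; have [Qp gp] := rectQ p Rp; rewrite -gp; exists p.
(* Multiplied by their bumps, the pieces are smooth on the whole of M, so [V] can be everything and
   no condition on y remains. *)
apply: (@adapted_section_exists _ _ _ _ _ M_manifold A_bundle _ _ _ _ eta0 cC pc
     0 1 _ (J `*` setT) ltr01 (lexx 0) (lexx 1) IE _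
     jj th psi t_ (fun=> setT) rho rho0) => //.
- move=> i j; apply: (CplaneZ (f := fun p => hat m (enum_val i).2 p.2)).
    exact: Cplane_hat_fst.
  exact: Cplane_hat_snd.
- move=> i p Rp; have [h1|h1] := leP `|p.1 - e_ i| rho; last first.
    right; exists [set q | rho < `|q.1 - e_ i|]; split => //.
      by apply: open_norm_gt => q; exact: cvg_fst.
    by move=> q _ /ltW; rewrite /psi => /(hat_out m0) ->; rewrite mul0r.
  have [h2|h2] := leP `|p.2 - t_ i| rho; last first.
    right; exists [set q | rho < `|q.2 - t_ i|]; split => //.
      by apply: open_norm_gt => q; exact: cvg_snd.
    by move=> q _ /ltW; rewrite /psi => /(hat_out m0) ->; rewrite mulr0.
  by left; apply: KU; exact: inK.
- move=> i p Rp; rewrite mulf_eq0 negb_or => /andP[/(hat_neq0 m0) h1 /(hat_neq0 m0) h2].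
  split => //; have [_ _ H] := thP i; apply: H; exact: inK.
- move=> p [p1 p2].
  rewrite -(big_enum_val (fun x : T => hat m x.1 p.1 * hat m x.2 p.2)) /=.
  rewrite -(pair_bigA _ (fun i j : 'I_m.+1 => hat m i p.1 * hat m j p.2)) /=.
  rewrite -big_distrlr /= !hat_sum// mulr1//.
- move=> i; exact: openT.
- move=> i i0 j; have [h1 h2 _] := thP i.
  exact: piece_map_smooth_supp.
Qed.
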